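(* Let $n\ge 1$ and $k\ge 0$ be integers, let $Y$ be a separable Banach space, let $T\in\mathscr D'(\mathbf R^n,Y)$, and let $A$ be the set of points $a\in\mathbf R^n$ at which $T$ is pointwise differentiable of order $k$. Then $A$ is a Borel set and, for each $y\in Y$, the function mapping $a\in A$ onto the real valued symmetric $k$-linear map on $(\mathbf R^n)^k$ with value $$\operatorname{pt}\mathrm D^kT(a)(v_1,\dots,v_k)(y)\quad\text{at }(v_1,\dots,v_k)\in(\mathbf R^n)^k$$ is a Borel function. In particular, if $Y^\ast$ is separable (in its norm topology), then $\operatorname{pt}\mathrm D^kT$ is a Borel function on $A$ with values in $\bigodot^k(\mathbf R^n,Y^\ast)$ (with its norm topology).
   Context: All vector spaces are real. $Y^\ast$ is the Banach space of continuous linear functionals on $Y$, and $\langle y,\upsilon\rangle=\upsilon(y)$ for $y\in Y$, $\upsilon\in Y^\ast$ (also applied pointwise to functions). $\mathscr L^n$ is Lebesgue measure. $\mathscr D(\mathbf R^n,Y)$ is the space of compactly supported $C^\infty$ functions $\mathbf R^n\to Y$ with its usual locally convex (inductive limit) topology, and $\mathscr D'(\mathbf R^n,Y)$ is the space of continuous linear maps $T:\mathscr D(\mathbf R^n,Y)\to\mathbf R$. One writes $T_x(\phi(x))$ for $T(\phi)$. For a normed space $Z$, $\bigodot^m(\mathbf R^n,Z)$ is the normed space of symmetric $m$-linear maps $(\mathbf R^n)^m\to Z$ with norm $\|\psi\|=\sup\{|\psi(v_1,\dots,v_m)|:|v_i|\le1\}$, and $\bigodot^0(\mathbf R^n,Z)=Z$;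 the $m$-th derivative $\mathrm D^mf(a)$ of a $Z$-valued function on $\mathbf R^n$ belongs to $\bigodot^m(\mathbf R^n,Z)$. Definition. For an integer $k\ge -1$, $T\in\mathscr D'(\mathbf R^n,Y)$ is pointwise differentiable of order $k$ at $a\in\mathbf R^n$ iff there is a polynomial function $P:\mathbf R^n\to Y^\ast$ of degree at most $k$ (the zero function if $k=-1$) such that, with $S(\phi)=\int\langle\phi,P\rangle\,d\mathscr L^n$ for $\phi\in\mathscr D(\mathbf R^n,Y)$, $$\lim_{r\to0+}r^{-k-n}(T-S)_x\big(\phi(r^{-1}(x-a))\big)=0\quad\text{for all }\phi\in\mathscr D(\mathbf R^n,Y).$$ Such $P$ is unique; if $k\ge0$, one defines $\operatorname{pt}\mathrm D^kT(a)=\mathrm D^kP(a)\in\bigodot^k(\mathbf R^n,Y^\ast)$. *)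

(* Defs.v *)
From HB Require Import structures.
From mathcomp Require Import all_boot all_order all_algebra all_fingroup.
From mathcomp Require Import all_classical all_reals all_analysis.

Set SsrOldRewriteGoalsOrder.
Set Implicit Arguments.
Unset Strict Implicit.
Unset Printing Implicit Defensive.

Import Order.TTheory GRing.Theory Num.Theory.
Import numFieldNormedType.Exports.

Local Open Scope classical_set_scope.
Local Open Scope ring_scope.

Section SupNorm.
Variables (R : realType) (T : Type) (Z : normedModType R) (S : set T).
Implicit Types f g : T -> Z.

Definition supnorm f : R := sup [set `|f x| | x in S].
Definition bounded_on f := exists M, forall x, S x -> `|f x| <= M.

Lemma supnorm_ub f x : bounded_on f -> S x -> `|f x| <= supnorm f.
Proof.
move=> [M fM] Sx; apply: ub_le_sup; last by exists x.
by exists M => _ [y Sy <-]; exact: fM.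
Qed.

Hypothesis S0 : S !=set0.

Lemma supnorm_le f M : (forall x, S x -> `|f x| <= M) -> supnorm f <= M.
Proof.
move=> fM; apply: ge_sup; first by case: S0 => x Sx; exists `|f x|, x.
by move=> _ [x Sx <-]; exact: fM.
Qed.

Lemma supnormD f g : bounded_on f -> bounded_on g ->
  supnorm (f \+ g) <= supnorm f + supnorm g.
Proof.
move=> bf bg; apply: supnorm_le => x Sx /=.
by rewrite (le_trans (ler_normD _ _))// lerD//; exact: supnorm_ub.
Qed.

Lemma supnormZ_le a f : bounded_on f ->
  supnorm (fun x => a *: f x) <= `|a| * supnorm f.
Proof.
move=> bf; apply: supnorm_le => x Sx.
by rewrite normrZ ler_wpM2l//; exact: supnorm_ub.
Qed.

Lemma supnormZ a f : bounded_on f ->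
  supnorm (fun x => a *: f x) = `|a| * supnorm f.
Proof.
move=> bf; apply/eqP; rewrite eq_le supnormZ_le//=.
have [->|a0] := eqVneq a 0.
  rewrite normr0 mul0r; case: S0 => x Sx.
  apply: le_trans (@supnorm_ub (fun x => 0 *: f x) x _ Sx) => //.
  by exists 0 => y _; rewrite scale0r normr0.
rewrite mulrC -ler_pdivlMr ?normr_gt0// mulrC -normfV.
apply: le_trans (@supnormZ_le a^-1 (fun x => a *: f x) _); last first.
  by case: bf => M fM; exists (`|a| * M) => x Sx; rewrite normrZ ler_wpM2l// fM.
rewrite (_ : (fun x => a^-1 *: (a *: f x)) = f)//.
by apply/funext => x; rewrite scalerA mulVf// scale1r.
Qed.

Lemma supnorm0_eq f x : bounded_on f -> supnorm f = 0 -> S x -> f x = 0.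
Proof.
move=> bf f0 Sx; apply/normr0_eq0/eqP; rewrite eq_le normr_ge0 andbT -f0.
exact: supnorm_ub.
Qed.

End SupNorm.

Section Dual.
Variables (R : realType) (Y : normedModType R).

Definition dual_pred : pred (Y -> R) :=
  fun f => `[< linear (f : Y -> R^o) /\ continuous f >].

(* The dual Y^*, made below a normed space with the dual norm
   sup {|f y| : |y| <= 1}. *)
Record dual := Dual { dual_fun :> Y -> R ; _ : dual_pred dual_fun }.

HB.instance Definition _ := [isSub for dual_fun].
HB.instance Definition _ := [Choice of dual by <:].

Lemma dual_submod : submod_closed dual_pred.
Proof.
split.
  apply/asboolP; split => [a u v|]; first by rewrite /= scaler0 addr0.
  exact: cst_continuous.
move=> a f g /asboolP[fl fc] /asboolP[gl gc]; apply/asboolP; split.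
  move=> b u v; rewrite /= !fctE /= fl gl /GRing.scale /=.
  by rewrite !mulrDr !mulrA (mulrC a b) addrACA.
move=> x; apply: continuousD; last exact: gc.
by apply: continuousM; [exact: cst_continuous|exact: fc].
Qed.

HB.instance Definition _ := GRing.isSubmodClosed.Build R (Y -> R)
  dual_pred dual_submod.
HB.instance Definition _ := [SubChoice_isSubLmodule of dual by <:].

Lemma dual_linear (f : dual) : linear (f : Y -> R^o).
Proof. by case: f => f /= /asboolP[]. Qed.

Lemma dual_continuous (f : dual) : continuous f.
Proof. by case: f => f /= /asboolP[]. Qed.

Lemma dualD (f g : dual) y : (f + g) y = f y + g y. Proof. by []. Qed.
Lemma dualZ a (f : dual) y : (a *: f) y = a * f y. Proof. by []. Qed.

Let B := [set y : Y | `|y| <= 1].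

Definition dual_norm (f : dual) : R := supnorm (Z := R^o) B f.

Let B0 : B !=set0. Proof. by exists 0; rewrite /B /= normr0 ler01. Qed.

Let dual_bounded (f : dual) : bounded_on (Z := R^o) B f.
Proof.
pose h : {linear Y -> R^o} :=
  HB.pack (f : Y -> R^o) (GRing.isLinear.Build R Y R^o _ f (dual_linear f)).
have /linear_bounded_continuous/bounded_funP/(_ 1)[M hM] : continuous h.
  exact: dual_continuous.
by exists M => y; exact: hM.
Qed.

Let dual_normD f g : dual_norm (f + g) <= dual_norm f + dual_norm g.
Proof. exact: supnormD. Qed.

Let dual_normZ a f : dual_norm (a *: f) = `|a| * dual_norm f.
Proof. exact: (@supnormZ R Y R^o). Qed.

Let dual_norm0_eq0 f : dual_norm f = 0 -> f = 0.
Proof.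
move=> f0; apply/val_inj/funext => y /=.
have c0 : 0 < `|y| + 1 by rewrite ltr_wpDl.
have -> : y = (`|y| + 1) *: ((`|y| + 1)^-1 *: y) + 0.
  by rewrite addr0 scalerA mulfV ?gt_eqF// scale1r.
rewrite dual_linear (@supnorm0_eq R Y R^o B f ((`|y| + 1)^-1 *: y))//.
  rewrite scaler0 add0r.
  by have := dual_linear f 1 0 0; rewrite !scale1r addr0 => /esym/eqP;
     rewrite -subr_eq0 addrK => /eqP.
by rewrite /B /= normrZ gtr0_norm ?invr_gt0// ler_pdivrMl// mulr1 lerDl ler01.
Qed.

HB.instance Definition _ := Lmodule_isNormed.Build R dual
  dual_normD dual_normZ dual_norm0_eq0.

End Dual.

(* The norm of 'rV[R]_n in the library is the sup norm; this is the Euclidean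
   norm. *)
Definition enorm (R : realType) (n : nat) (v : 'rV[R]_n) : R :=
  Num.sqrt (\sum_i v 0 i ^+ 2).

Lemma enormZ (R : realType) n a (v : 'rV[R]_n) : enorm (a *: v) = `|a| * enorm v.
Proof.
rewrite /enorm -sqrtr_sqr -sqrtrM ?sqr_ge0//; congr Num.sqrt.
by rewrite mulr_sumr; apply: eq_bigr => i _; rewrite mxE exprMn.
Qed.

Lemma enorm0 (R : realType) n : enorm (0 : 'rV[R]_n) = 0.
Proof. by rewrite -(scale0r (0 : 'rV[R]_n)) enormZ normr0 mul0r. Qed.

Lemma coord_enorm (R : realType) n (v : 'rV[R]_n) i : `|v 0 i| <= enorm v.
Proof.
rewrite /enorm -sqrtr_sqr ler_sqrt ?sumr_ge0//; last by move=> *; exact: sqr_ge0.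
by rewrite (bigD1 i)//= lerDl sumr_ge0// => *; exact: sqr_ge0.
Qed.

Lemma enorm_delta (R : realType) n (i : 'I_n) : enorm (delta_mx 0 i : 'rV[R]_n) = 1.
Proof.
rewrite /enorm (bigD1 i)//= big1 ?addr0; last first.
  by move=> j ji; rewrite mxE/= (negbTE ji) expr0n.
by rewrite mxE !eqxx expr1n sqrtr1.
Qed.

Definition upd (I : eqType) (T : Type) (v : I -> T) (i : I) (u : T) : I -> T :=
  fun j => if j == i then u else v j.

Section SymMulti.
Variables (R : realType) (n m : nat) (Z : normedModType R).
Local Notation V := 'rV[R]_n.
Implicit Types v : 'I_m -> V.

Definition multilinear (f : ('I_m -> V) -> Z) := forall v i (a : R) (u w : V),
  f (upd v i (a *: u + w)) = a *: f (upd v i u) + f (upd v i w).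

Definition symmetric_map (f : ('I_m -> V) -> Z) :=
  forall v (s : 'S_m), f (v \o s) = f v.

Definition symmulti_pred : pred (('I_m -> V) -> Z) :=
  fun f => `[< multilinear f /\ symmetric_map f >].

(* The space of symmetric m-linear maps (R^n)^m -> Z, made below a normed space
   with the norm sup {|f (v_1, ..., v_m)| : |v_i| <= 1}. *)
Record symmulti := SymMulti
  { symmulti_fun :> ('I_m -> V) -> Z ; _ : symmulti_pred symmulti_fun }.

HB.instance Definition _ := [isSub for symmulti_fun].
HB.instance Definition _ := [Choice of symmulti by <:].

Lemma symmulti_submod : submod_closed symmulti_pred.
Proof.
split.
  apply/asboolP; split => [v i a u w|//]; by rewrite /= scaler0 addr0.
move=> a f g /asboolP[fl fs] /asboolP[gl gs]; apply/asboolP; split.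
  move=> v i b u w; rewrite /= !fctE /= fl gl.
  by rewrite !scalerDr !scalerA (mulrC a b) addrACA.
by move=> v s; rewrite !fctE /= fs gs.
Qed.

HB.instance Definition _ := GRing.isSubmodClosed.Build R (('I_m -> V) -> Z)
  symmulti_pred symmulti_submod.
HB.instance Definition _ := [SubChoice_isSubLmodule of symmulti by <:].

Lemma symmultiP (f : symmulti) : multilinear f.
Proof. by case: f => f /= /asboolP[]. Qed.

Lemma symmulti_sym (f : symmulti) : symmetric_map f.
Proof. by case: f => f /= /asboolP[]. Qed.

Lemma updE v i : upd v i (v i) = v.
Proof. by apply/funext => j; rewrite /upd; case: eqP => // ->. Qed.

Lemma multilinear0 f v i : multilinear f -> f (upd v i 0) = 0.
Proof.
move=> fl; have := fl v i 1 0 0; rewrite !scale1r addr0 => /esym/eqP.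
by rewrite -subr_eq0 addrK => /eqP.
Qed.

Lemma multilinear_sum f v i (I : Type) (s : seq I) (c : I -> R) (u : I -> V) :
  multilinear f ->
  f (upd v i (\sum_(l <- s) c l *: u l)) = \sum_(l <- s) c l *: f (upd v i (u l)).
Proof.
move=> fl; elim: s => [|l s IH]; first by rewrite !big_nil multilinear0.
by rewrite !big_cons fl IH.
Qed.

Lemma multilinearZ f v (c : 'I_m -> R) : multilinear f ->
  f (fun j => c j *: v j) = (\prod_j c j) *: f v.
Proof.
move=> fl; have key s : uniq s ->
    f (fun j => if j \in s then c j *: v j else v j) = (\prod_(j <- s) c j) *: f v.
  elim: s => [_|i s IH /= /andP[is_ us]]; first by rewrite big_nil scale1r.
  rewrite big_cons -scalerA -IH//; set g := fun j => if j \in s then _ else _.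
  have -> : (fun j => if j \in i :: s then c j *: v j else v j) =
      upd g i (c i *: v i + 0).
    apply/funext => j; rewrite /upd /g inE addr0; case: eqP => //= ->//.
  rewrite fl multilinear0// addr0; congr (_ *: f _).
  by rewrite -[RHS](updE _ i) {3}/g (negbTE is_).
rewrite -key ?index_enum_uniq//; congr f; apply/funext => j.
by rewrite mem_index_enum.
Qed.

Let B := [set v : 'I_m -> V | forall j, enorm (v j) <= 1].

Definition symmulti_norm (f : symmulti) : R := supnorm B f.

Let B0 : B !=set0.
Proof. by exists (fun=> 0) => j /=; rewrite enorm0 ler01. Qed.

Let symmulti_bounded (f : symmulti) : bounded_on B f.
Proof.
have fl := symmultiP f.
suff [M fM] : exists M, forall v, B v ->
    (forall j, j \notin index_enum 'I_m -> exists l, v j = delta_mx 0 l) ->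
    `|f v| <= M.
  by exists M => v Bv; apply: fM => // j; rewrite mem_index_enum.
elim: (index_enum _) => [|i s [M IH]].
  exists (\sum_(g : {ffun 'I_m -> 'I_n}) `|f (fun j => delta_mx 0 (g j))|).
  move=> v Bv vd.
  have /choice[g vg] : forall j, exists l, v j = delta_mx 0 l.
    by move=> j; exact: vd.
  rewrite (bigD1 [ffun j => g j])//= -[leLHS]addr0 lerD// ?sumr_ge0//.
  rewrite le_eqVlt; apply/orP; left; apply/eqP; congr (`|f _|).
  by apply/funext => j; rewrite vg ffunE.
exists (n%:R * M) => v Bv vd.
rewrite -(updE v i) [v i in X in f X]row_sum_delta multilinear_sum//.
rewrite (le_trans (ler_norm_sum _ _ _))//.
apply: (@le_trans _ _ (\sum_(l < n) M)); last first.
  by rewrite sumr_const card_ord mulr_natl.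
apply: ler_sum => l _; rewrite normrZ.
have fM : `|f (upd v i (delta_mx 0 l))| <= M.
  apply: IH => [j|j js]; rewrite /upd; case: eqP => [_|/eqP ji].
  - by rewrite enorm_delta.
  - exact: Bv.
  - by exists l.
  - by apply: vd; rewrite inE negb_or ji.
rewrite -[leRHS]mul1r ler_pM//.
exact: le_trans (coord_enorm _ _) (Bv i).
Qed.

Let symmulti_normD f g :
  symmulti_norm (f + g) <= symmulti_norm f + symmulti_norm g.
Proof. exact: supnormD. Qed.

Let symmulti_normZ a f : symmulti_norm (a *: f) = `|a| * symmulti_norm f.
Proof. exact: supnormZ. Qed.

Let symmulti_norm0_eq0 f : symmulti_norm f = 0 -> f = 0.
Proof.
move=> f0; apply/val_inj/funext => v /=.
have c0 j : 0 < enorm (v j) + 1 by rewrite ltr_wpDl// sqrtr_ge0.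
have -> : v = fun j => (enorm (v j) + 1) *: ((enorm (v j) + 1)^-1 *: v j).
  by apply/funext => j; rewrite scalerA mulfV ?gt_eqF// scale1r.
rewrite multilinearZ; last exact: symmultiP.
rewrite (supnorm0_eq (symmulti_bounded f) f0) ?scaler0// => j.
by rewrite enormZ gtr0_norm ?invr_gt0// ler_pdivrMl// mulr1 lerDl ler01.
Qed.

HB.instance Definition _ := Lmodule_isNormed.Build R symmulti
  symmulti_normD symmulti_normZ symmulti_norm0_eq0.

End SymMulti.

Section Smooth.
Variables (R : realType) (n : nat) (W : normedModType R).
Local Notation V := 'rV[R]_n.
Implicit Types (f g : V -> W).

Fixpoint iterD (s : seq V) f : V -> W :=
  if s is v :: s' then 'D_v (iterD s' f) else f.

(* D^i f(x)(v_1, ..., v_i) *)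
Definition derivn i f (x : V) (v : 'I_i -> V) : W :=
  iterD [seq v j | j <- enum 'I_i] f x.

(* C^m: as the domain is finite dimensional, the derivative of f is C^m as a map
   into linear maps iff each directional derivative of f is C^m. *)
Fixpoint Ck (m : nat) f : Prop :=
  if m is m'.+1 then
    (forall x, differentiable f x) /\ forall v, Ck m' ('D_v f)
  else continuous f.

Definition smooth f := forall m, Ck m f.

Definition supp f := closure [set x | f x != 0].

Lemma derive_lin a f g v : (forall x, differentiable f x) ->
  (forall x, differentiable g x) ->
  'D_v (a *: f + g) = a *: 'D_v f + 'D_v g.
Proof.
move=> df dg; apply/funext => x.
have fd := diff_derivable (v := v) (df x); have gd := diff_derivable (v := v) (dg x).
by rewrite deriveD ?deriveZ//; exact: derivableZ.
Qed.

Lemma Ck_lin m a f g : Ck m f -> Ck m g -> Ck m (a *: f + g).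
Proof.
elim: m f g => [|m IH] f g /=.
  move=> cf cg x.
  have caf : {for x, continuous (a *: f)} by apply: continuousZr; exact: cf.
  exact: (continuousD caf (cg x)).
move=> [df Df] [dg Dg]; split=> [x|v].
  by apply: differentiableD => //; exact: differentiableZ.
by rewrite derive_lin//; exact: IH.
Qed.

Lemma Ck0 m : Ck m 0.
Proof.
elim: m => [|m IH] /=; first exact: cst_continuous.
split=> [x|v]; first exact: differentiable_cst.
by rewrite (_ : 'D_v 0 = 0)//; apply/funext => x; rewrite derive_cst.
Qed.

Definition aff (c : R) (a : V) := fun x : V => c *: (x - a).

Lemma aff_diff c a x : differentiable (aff c a) x.
Proof. by apply: differentiableZ; apply: differentiableB. Qed.

Lemma derive_aff c a f v : (forall x, differentiable f x) ->
  'D_v (f \o aff c a) = 'D_(c *: v) f \o aff c a.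
Proof.
move=> df; apply/funext => x.
have da := aff_diff c a x.
have dfa : differentiable (f \o aff c a) x by exact: differentiable_comp.
have dav : 'd (aff c a) x v = c *: v.
  rewrite -deriveE//.
  have -> : aff c a = c *: (id - cst a) by apply/funext.
  have did : derivable (id : V -> V) x v by exact: derivable_id.
  have dcs : derivable (cst a : V -> V) x v by exact: derivable_cst.
  have E := deriveZ c (derivableB did dcs).
  by rewrite E (deriveB did dcs) derive_cst derive_id subr0.
have E1 := deriveE v dfa.
have E2 := deriveE (c *: v) (df (aff c a x)).
have E3 := diff_comp da (df (aff c a x)).
by rewrite E1 E3 /= dav -E2.
Qed.

Lemma Ck_aff m c a f : Ck m f -> Ck m (f \o aff c a).
Proof.
elim: m f => [|m IH] f /= => [cf x|[df Df]].
  apply: continuous_comp; last exact: cf.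
  exact/differentiable_continuous/aff_diff.
split=> [x|v]; first exact: differentiable_comp.
by rewrite derive_aff//; exact: IH.
Qed.

Definition testfun_pred : pred (V -> W) :=
  fun f => `[< smooth f /\ compact (supp f) >].

(* D(R^n, W); its topology is defined below. *)
Record testfun :=
  TestFun { testfun_fun :> V -> W ; _ : testfun_pred testfun_fun }.

HB.instance Definition _ := [isSub for testfun_fun].
HB.instance Definition _ := [Choice of testfun by <:].

Lemma supp_sub (K : set V) f : compact K ->
  (forall x, ~ K x -> f x = 0) -> compact (supp f).
Proof.
move=> cK fK; apply: (subclosed_compact _ cK); first exact: closed_closure.
have clK : closed K by apply: compact_closed => //; exact: norm_hausdorff.
rewrite /supp closureE => x /(_ K); apply; split=> // y /= fy0.
by apply: contrapT => /fK fy; rewrite fy eqxx in fy0.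
Qed.

Lemma suppN f x : ~ supp f x -> f x = 0.
Proof.
move=> sx; apply/eqP; apply: contrapT => fx0; apply: sx.
by apply: subset_closure => /=; exact/negP.
Qed.

Lemma testfun_submod : submod_closed testfun_pred.
Proof.
split.
  apply/asboolP; split => [m|]; first exact: Ck0.
  by apply: (@supp_sub set0) => //; exact: compact0.
move=> a f g /asboolP[fs fc] /asboolP[gs gc]; apply/asboolP; split => [m|].
  by apply: Ck_lin; [exact: fs|exact: gs].
apply: (@supp_sub (supp f `|` supp g)) => [|x]; first exact: compactU.
by move/not_orP => [fx gx]; rewrite !fctE (suppN fx) (suppN gx) scaler0 addr0.
Qed.

HB.instance Definition _ := GRing.isSubmodClosed.Build R (V -> W)
  testfun_pred testfun_submod.
HB.instance Definition _ := [SubChoice_isSubLmodule of testfun by <:].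

Lemma testfun_aff (f : testfun) (c : R) a : c != 0 -> testfun_pred (f \o aff c a).
Proof.
move=> c0; case: f => f /= /asboolP[fs fc]; apply/asboolP; split.
  by move=> m; exact: Ck_aff.
apply: (@supp_sub ((fun y => c^-1 *: y + a) @` supp f)).
  apply: continuous_compact fc; apply: continuous_subspaceT => x.
  apply: continuousD; last exact: cst_continuous.
  exact: scaler_continuous.
move=> x; apply: contra_notP => /= fx0; exists (c *: (x - a)).
  by apply: contrapT => /suppN.
by rewrite scalerA mulVf// scale1r subrK.
Qed.

(* x |-> f (r^-1 (x - a)); this is the intended function for r != 0
   (see rescaleE), the only case in which it is used. *)
Definition rescale (f : testfun) (a : V) (r : R) : testfun :=
  insubd 0 (fun x : V => f (r^-1 *: (x - a))).

Lemma rescaleE (f : testfun) a r : r != 0 ->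
  rescale f a r = (fun x : V => f (r^-1 *: (x - a))) :> (V -> W).
Proof. by move=> r0; apply: insubdK; apply: testfun_aff; rewrite invr_eq0. Qed.

(* U contains a neighbourhood of 0 in the space D_K of test functions supported
   in K, topologized by the seminorms sup_x |D^i f(x)|. *)
Definition nbhs0_DK (K : set V) (U : set testfun) : Prop :=
  exists m (e : R), 0 < e /\ forall f : testfun, supp f `<=` K ->
    (forall i, (i <= m)%N -> forall (x : V) (v : 'I_i -> V),
       (forall j, enorm (v j) <= 1) -> `|derivn f x v| <= e) ->
    U f.

Definition absconvex (U : set testfun) : Prop :=
  forall (f g : testfun) (s t : R), U f -> U g -> `|s| + `|t| <= 1 ->
    U (s *: f + t *: g).

(* The locally convex inductive limit topology of the D_K, K compact: a basis of
   neighbourhoods of 0 is given by the absolutely convex sets whose trace on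
   each D_K is a neighbourhood of 0 there. *)
Definition testfun_open (U : set testfun) : Prop :=
  forall f : testfun, U f -> exists N : set testfun,
    [/\ absconvex N, forall K, compact K -> nbhs0_DK K N &
        forall h, N h -> U (f + h)].

Let testfun_openT : testfun_open setT.
Proof.
by move=> f _; exists setT; split=> // K _; exists 0%N, 1; split=> //; exact: ltr01.
Qed.

Let testfun_openI : setI_closed testfun_open.
Proof.
move=> A B oA oB f [/oA[M [Mc MK MA]] /oB[N [Nc NK NB]]].
exists (M `&` N); split=> [g h s t [Mg Ng] [Mh Nh] st|K cK|h [Mh Nh]].
- by split; [exact: Mc|exact: Nc].
- have [m1 [e1 [e10 H1]]] := MK _ cK; have [m2 [e2 [e20 H2]]] := NK _ cK.
  exists (maxn m1 m2), (Num.min e1 e2); split; first by rewrite lt_min e10.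
  move=> g gK H; split.
  + apply: H1 => // i im x v v1.
    have := H i _ x v v1; rewrite leq_max im => /(_ isT).
    by rewrite le_min => /andP[].
  + apply: H2 => // i im x v v1.
    have := H i _ x v v1; rewrite leq_max im orbT => /(_ isT).
    by rewrite le_min => /andP[].
- by split; [exact: MA|exact: NB].
Qed.

Let testfun_open_bigU (I : Type) (F : I -> set testfun) :
  (forall i, testfun_open (F i)) -> testfun_open (\bigcup_i F i).
Proof.
move=> oF f [i _ Fif]; have [N [Nc NK NF]] := oF i f Fif.
by exists N; split=> // h Nh; exists i => //; exact: NF.
Qed.

HB.instance Definition _ := isOpenTopological.Build testfun
  testfun_openT testfun_openI testfun_open_bigU.

End Smooth.

Section Poly.
Variables (R : realType) (n : nat).
Local Notation V := 'rV[R]_n.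

Inductive spoly : (V -> R) -> Prop :=
| spoly_cst c : spoly (cst c)
| spoly_coord i : spoly (fun x => x 0 i)
| spoly_add f g : spoly f -> spoly g -> spoly (f + g)
| spoly_mul f g : spoly f -> spoly g -> spoly (f * g).

Lemma spoly_diff f x : spoly f -> differentiable f x.
Proof.
elim=> {f} [c|i|f g _ df _ dg|f g _ df _ dg].
- exact: differentiable_cst.
- exact: differentiable_coord.
- exact: differentiableD.
- exact: differentiableM.
Qed.

Lemma spoly_derivable f x v : spoly f -> derivable f x v.
Proof. by move=> pf; exact/diff_derivable/spoly_diff. Qed.

Lemma sderive_cst c (v : V) : 'D_v (cst c : V -> R) = cst 0.
Proof. by apply/funext => x; rewrite derive_cst. Qed.

Lemma sderive_coord i (v : V) : 'D_v (fun x : V => x 0 i) = cst (v 0 i).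
Proof.
have hl : linear ((fun x => x 0 i) : V -> R^o) by move=> a u w; rewrite !mxE.
pose h : {linear V -> R^o} :=
  HB.pack ((fun x => x 0 i) : V -> R^o) (GRing.isLinear.Build R V R^o _ _ hl).
have ch : continuous h by move=> y; exact: coord_continuous.
apply/funext => x; have E := deriveE v (linear_differentiable x ch).
by rewrite E (diff_lin x ch).
Qed.

Lemma sderiveD f g v : spoly f -> spoly g -> 'D_v (f + g) = 'D_v f + 'D_v g.
Proof.
move=> pf pg; apply/funext => x.
have E := deriveD (@spoly_derivable f x v pf) (@spoly_derivable g x v pg).
by rewrite E.
Qed.

Lemma sderiveM f g v : spoly f -> spoly g ->
  'D_v (f * g) = f * 'D_v g + 'D_v f * g.
Proof.
move=> pf pg; apply/funext => x.
have E := deriveM (@spoly_derivable f x v pf) (@spoly_derivable g x v pg).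
rewrite E.
by rewrite /GRing.scale /= (mulrC (g x)).
Qed.

Lemma spoly_derive f v : spoly f -> spoly ('D_v f).
Proof.
elim=> {f} [c|i|f g pf df pg dg|f g pf df pg dg].
- by rewrite (sderive_cst c v); constructor.
- by rewrite (sderive_coord i v); constructor.
- by rewrite (@sderiveD f g v pf pg); constructor.
- by rewrite (@sderiveM f g v pf pg); constructor; constructor.
Qed.

(* The two commutation lemmas abstract the operator 'D to keep unification from
   unfolding it. *)
Lemma spoly_comm f v w : spoly f -> 'D_v ('D_w f) = 'D_w ('D_v f).
Proof.
have [D DE] : exists D, D = (fun (u : V) (h : V -> R) => 'D_u h : V -> R).
  by eexists.
have Dc u c : D u (cst c) = cst 0 by rewrite DE; exact: sderive_cst.
have Dx u i : D u (fun x => x 0 i) = cst (u 0 i).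
  by rewrite DE; exact: sderive_coord.
have DD u h1 h2 : spoly h1 -> spoly h2 -> D u (h1 + h2) = D u h1 + D u h2.
  by rewrite DE; exact: sderiveD.
have DM u h1 h2 : spoly h1 -> spoly h2 ->
    D u (h1 * h2) = h1 * D u h2 + D u h1 * h2.
  by rewrite DE; exact: sderiveM.
have pD u h : spoly h -> spoly (D u h) by rewrite DE; exact: spoly_derive.
have pM h1 h2 : spoly h1 -> spoly h2 -> spoly (h1 * h2) by constructor.
suff : spoly f -> D v (D w f) = D w (D v f) by rewrite DE.
move: DE => _; elim=> {f} [c|i|f g pf df pg dg|f g pf df pg dg].
- by rewrite !Dc.
- by rewrite !Dx !Dc.
- by rewrite (DD w)// (DD v f g)// (DD v)//; auto; rewrite (DD w); auto;
  rewrite df dg.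
- rewrite (DM w f g)// (DM v f g)// (DD v) ?(DD w); auto.
  rewrite (DM v) ?(DM v _ g) ?(DM w) ?(DM w _ g); auto.
  rewrite df dg -!addrA; congr (_ + _).
  by rewrite addrCA.
Qed.

Variable W : normedModType R.

Inductive vpoly : (V -> W) -> Prop :=
| vpoly_scale f c : spoly f -> vpoly (fun x => f x *: c)
| vpoly_add f g : vpoly f -> vpoly g -> vpoly (f + g).

Lemma vpoly_diff f x : vpoly f -> differentiable f x.
Proof.
elim=> {f} [f c pf|f g _ df _ dg]; last exact: differentiableD.
by apply: differentiableZl; exact: spoly_diff.
Qed.

Lemma vpoly_derivable f x v : vpoly f -> derivable f x v.
Proof. by move=> pf; exact/diff_derivable/vpoly_diff. Qed.

Lemma vderiveD f g v : vpoly f -> vpoly g -> 'D_v (f + g) = 'D_v f + 'D_v g.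
Proof.
move=> pf pg; apply/funext => x.
have E := deriveD (@vpoly_derivable f x v pf) (@vpoly_derivable g x v pg).
by rewrite E.
Qed.

Lemma vderiveZ f (c : W) v : spoly f ->
  'D_v (fun x => f x *: c) = (fun x => 'D_v f x *: c).
Proof.
move=> pf; apply/funext => x.
have df := @spoly_diff f x pf.
have dfc : differentiable (fun x => f x *: c) x by exact: differentiableZl.
have E1 := deriveE v dfc; have E2 := deriveE v df.
by rewrite E1 E2 (diffZl _ df).
Qed.

Lemma vpoly_derive f v : vpoly f -> vpoly ('D_v f).
Proof.
elim=> {f} [f c pf|f g pf df pg dg]; last first.
  by rewrite (@vderiveD f g v pf pg); constructor.
by rewrite (@vderiveZ f c v pf); constructor; exact: spoly_derive.
Qed.

Lemma vpoly_comm f v w : vpoly f -> 'D_v ('D_w f) = 'D_w ('D_v f).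
Proof.
have [D DE] : exists D, D = (fun (u : V) (h : V -> W) => 'D_u h : V -> W).
  by eexists.
have [d dE] : exists d, d = (fun (u : V) (h : V -> R) => 'D_u h : V -> R).
  by eexists.
have DZ u h c : spoly h -> D u (fun x => h x *: c) = (fun x => d u h x *: c).
  by rewrite DE dE; exact: vderiveZ.
have dC h u1 u2 : spoly h -> d u1 (d u2 h) = d u2 (d u1 h).
  by rewrite dE; exact: spoly_comm.
have pd u h : spoly h -> spoly (d u h) by rewrite dE; exact: spoly_derive.
have DD u h1 h2 : vpoly h1 -> vpoly h2 -> D u (h1 + h2) = D u h1 + D u h2.
  by rewrite DE; exact: vderiveD.
have pD u h : vpoly h -> vpoly (D u h) by rewrite DE; exact: vpoly_derive.
suff : vpoly f -> D v (D w f) = D w (D v f) by rewrite DE.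
move: DE dE => _ _; elim=> {f} [f c pf|f g pf df pg dg].
  by rewrite (DZ w)// (DZ v f)// (DZ v) ?(DZ w) ?(dC f v w); auto.
by rewrite (DD w)// (DD v f g)// (DD v) ?(DD w) ?df ?dg; auto.
Qed.

Lemma vpoly_iterD s f : vpoly f -> vpoly (iterD s f).
Proof. by move=> pf; elim: s => //= v s; exact: vpoly_derive. Qed.

Lemma iterD_rot (u : V) s1 s2 f : vpoly f ->
  iterD (s1 ++ u :: s2) f = iterD (u :: s1 ++ s2) f.
Proof.
move=> pf; elim: s1 => //= v s1 ->/=.
exact: (@vpoly_comm (iterD (s1 ++ s2) f) v u (vpoly_iterD _ pf)).
Qed.

Lemma iterD_perm (s t : seq V) f : vpoly f -> perm_eq s t ->
  iterD s f = iterD t f.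
Proof.
move=> pf; elim: s t => [|u s IH] t; first by rewrite perm_sym => /perm_nilP ->.
move=> st; have ut : u \in t by rewrite -(perm_mem st) mem_head.
case/path.splitPr: t / ut st => t1 t2 st.
have pst : perm_eq s (t1 ++ t2).
  by rewrite -(perm_cons u) (perm_trans st)// -cat1s perm_catCA.
by rewrite (@iterD_rot u t1 t2 f pf) /= (IH _ pst).
Qed.

Lemma iterD_multi m (v : 'I_m -> V) i a u w s f : vpoly f -> uniq s -> i \in s ->
  iterD [seq upd v i (a *: u + w) j | j <- s] f =
  a *: iterD [seq upd v i u j | j <- s] f + iterD [seq upd v i w j | j <- s] f.
Proof.
move=> pf; elim: s => //= j s IH /andP[js us]; rewrite inE => /orP[/eqP ij|ijs].
  subst j; have E z : [seq upd v i z j | j <- s] = [seq v j | j <- s].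
    apply/eq_in_map => j jS; rewrite /upd; case: eqP => // ji.
    by rewrite -ji jS in js.
  have U z : upd v i z i = z by rewrite /upd eqxx.
  rewrite /= !E !U; set g := iterD _ _; apply/funext => x.
  have dg : differentiable g x by apply/vpoly_diff/vpoly_iterD.
  have D z : 'D_z g x = 'd g x z := deriveE z dg.
  by rewrite !fctE !D linearP.
have U z : upd v i z j = v j.
  by rewrite /upd; case: eqP ijs js => // -> ->.
rewrite /= (IH us ijs) !U.
have pd s' : forall x, differentiable (iterD s' f) x.
  by move=> x; exact/vpoly_diff/vpoly_iterD.
exact: (@derive_lin R n W a _ _ (v j) (pd _) (pd _)).
Qed.

Definition polyfun (k : nat) (P : V -> W) : Prop :=
  exists c : {ffun 'I_n -> 'I_k.+1} -> W, forall x,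
    P x = \sum_(alpha : {ffun 'I_n -> 'I_k.+1} | (\sum_i alpha i <= k)%N)
            (\prod_i x 0 i ^+ alpha i) *: c alpha.

Lemma polyfun_vpoly k P : polyfun k P -> vpoly P.
Proof.
move=> [c PE]; have {PE} -> : P = \sum_(alpha : {ffun 'I_n -> 'I_k.+1} |
    (\sum_i alpha i <= k)%N) (fun x : V => (\prod_i x 0 i ^+ alpha i) *: c alpha).
  by apply/funext => x; rewrite PE fct_sumE.
have p0 : vpoly 0.
  rewrite (_ : 0 = fun x : V => (cst 0 : V -> R) x *: (0 : W)).
    by constructor; constructor.
  by apply/funext => x; rewrite scaler0.
elim/big_ind : _ => // [f g|alpha _]; first by constructor.
apply: (@vpoly_scale (fun x : V => \prod_i x 0 i ^+ alpha i)).
rewrite (_ : (fun x : V => _) = \prod_i (fun x : V => x 0 i ^+ alpha i)).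
  elim/big_ind : _ => [|f g|i _]; first exact: (spoly_cst 1).
    by constructor.
  elim: (nat_of_ord _) => [|m IH]; first exact: (spoly_cst 1).
  rewrite (_ : (fun x : V => _) = (fun x : V => x 0 i) * (fun x : V => x 0 i ^+ m)).
    by constructor => //; constructor.
  by apply/funext => x; rewrite exprS.
by apply/funext => x; rewrite fct_prodE.
Qed.

(* D^m f(a); the default value 0 of insubd is not used when f is a polynomial
   function (see DsymE). *)
Definition Dsym m (f : V -> W) (a : V) : symmulti n m W :=
  insubd 0 (fun v : 'I_m -> V => derivn f a v).

Lemma DsymE k m P a : polyfun k P ->
  Dsym m P a = (fun v : 'I_m -> V => derivn P a v) :> (_ -> _).
Proof.
move=> /polyfun_vpoly pP; apply: insubdK; apply/asboolP; split.
  move=> v i c u w; rewrite /derivn iterD_multi ?enum_uniq ?mem_enum//.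
move=> v s; rewrite /derivn; congr (_ a); apply: iterD_perm => //.
rewrite (map_comp v s) perm_map// uniq_perm ?enum_uniq//.
  by rewrite map_inj_uniq ?enum_uniq//; exact: perm_inj.
move=> j; rewrite mem_enum; apply/mapP; exists ((s^-1)%g j).
  by rewrite mem_enum.
by rewrite permKV.
Qed.

End Poly.

Section Lebesgue.
Variable R : realType.
Local Notation mR := (measurableTypeR R).

Definition tcons n (p : n.-tuple mR * mR) : n.+1.-tuple mR := [tuple of p.2 :: p.1].

Lemma measurable_tcons n : measurable_fun [set: n.-tuple mR * mR] (@tcons n).
Proof. exact: measurable_cons. Qed.

(* Lebesgue measure on R^n, R^n being here the type of n-tuples with the product
   sigma-algebra: the n-fold product of the Lebesgue measure of R. *)
Fixpoint lebesgue_tuple n : {measure set (n.-tuple mR) -> \bar R} :=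
  if n is n'.+1 then
    measure_function_pushforward__canonical__measure_function_Measure
      [the measure _ _ of (lebesgue_tuple n' \x (@lebesgue_measure R))%E]
      (@measurable_tcons n')
  else [the measure _ _ of dirac ([tuple] : 0.-tuple mR)].

Lemma lebesgue_tupleS n (A : set (n.+1.-tuple mR)) :
  lebesgue_tuple n.+1 A =
  pushforward (lebesgue_tuple n \x (@lebesgue_measure R))%E (@tcons n) A.
Proof. by []. Qed.

End Lebesgue.

Section Distribution.
Variables (R : realType) (n : nat) (Y : normedModType R).
Local Notation V := 'rV[R]_n.

(* S(f) = \int <f, P> dL^n *)
Definition poly_distribution (P : V -> dual Y) (f : testfun n Y) : R :=
  \int[lebesgue_tuple R n]_t
    (P (\row_i tnth t i)) (f (\row_i tnth t i)).

(* P is a polynomial function of degree at most k witnessing that T is pointwise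
   differentiable of order k at a. *)
Definition pt_jet (T : testfun n Y -> R) (k : nat) (a : V) (P : V -> dual Y) :
    Prop :=
  polyfun k P /\ forall f : testfun n Y,
    r ^- (k + n) * (T (rescale f a r) - poly_distribution P (rescale f a r))
      @[r --> (0 : R)^'+] --> (0 : R).

Definition pt_differentiable (T : testfun n Y -> R) (k : nat) (a : V) : Prop :=
  exists P, pt_jet T k a P.

(* The pointwise differential of order k; at points where T is not pointwise
   differentiable of order k the value is irrelevant. *)
Definition ptD (T : testfun n Y -> R) (k : nat) (a : V) : symmulti n k (dual Y) :=
  Dsym k (xget (fun=> 0) [set P | pt_jet T k a P]) a.

End Distribution.

Section Evaluation.
Variables (R : realType) (n m : nat) (Y : normedModType R).

Lemma symmulti_eval_subproof (f : symmulti n m (dual Y)) (y : Y) :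
  symmulti_pred (Z := R^o) (fun v => f v y).
Proof.
apply/asboolP; split=> [v i a u w|v s]; first by rewrite (symmultiP f).
by rewrite (symmulti_sym f).
Qed.

Definition symmulti_eval (y : Y) (f : symmulti n m (dual Y)) : symmulti n m R^o :=
  SymMulti (symmulti_eval_subproof f y).

End Evaluation.

Definition separable (X : topologicalType) : Prop :=
  exists2 D : set X, countable D & dense D.

Definition borel (X : ptopologicalType) := g_sigma_algebraType (@open X).
HB.instance Definition _ (X : ptopologicalType) := Measurable.on (borel X).

(* Main.v *)
(* Let psi_be, |be| <= k, be test functions on R^n biorthogonal to the monomials
   of degree at most k. If T has the jet P at a, the coefficient of P at a of
   index be, evaluated at y, is the limit as r -> 0 of
   r^(-|be|-n) T((psi_be y)((x - a) / r)). Since every test function is the sum of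
   functions psi_be y_be and of one whose moments of order at most k vanish, T is
   pointwise differentiable of order k at a iff these quantities converge with
   error o(r^(k-|be|)) and T(f((x - a) / r)) = o(r^(k+n)) for all test functions f
   with vanishing moments; that the limits are continuous in y follows from the
   uniform boundedness principle.
   Both conditions state that a family of functionals, depending continuously on
   a, tends to zero at every point of a separable complete space: of Y, and of the
   test functions with support in a fixed ball and vanishing moments. By uniform
   boundedness it is enough to require boundedness on some neighbourhood of zero,
   a countable union of closed conditions on a, and convergence on a countable
   dense set, hence the set of all such a is Borel. The coefficients are pointwise
   limits of continuous functions of a, and the norm of Y^* is a supremum over a
   countable set. *)

Require Import Defs.
From HB Require Import structures.
From mathcomp Require Import all_boot all_order all_algebra.
From mathcomp Require Import interval_inference.
From mathcomp Require Import all_classical all_reals all_analysis.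
From mathcomp Require Import measurable_realfun.
From mathcomp Require Import ring lra zify.

Set Implicit Arguments.
Unset Strict Implicit.
Unset Printing Implicit Defensive.

Import Order.TTheory GRing.Theory Num.Theory.
Import numFieldNormedType.Exports.

Local Open Scope classical_set_scope.
Local Open Scope ring_scope.

(* The library has notions named iterD and derivn, too. *)
Local Notation iterD := Defs.iterD.
Local Notation derivn := Defs.derivn.

(** * Uniform boundedness *)

(** Differentiability at a asks for the existence of some P with coefficients in the dual of Y, and
    a union over all such P is uncountable. Both conditions are therefore stated without P: the
    coefficients through a Cauchy condition on pairs of radii s <= r, the remainder through test
    functions annihilated by every polynomial of degree at most k. The space of all test functions
    is not metrizable, so the remainder condition is imposed for each radius j = 0, 1, ... of the
    support separately. Both then become instances of one statement on a space with an increasing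
    sequence of seminorms. The functionals are indexed by uncountably many radii, which is harmless
    because closed conditions may be intersected at will; only the vectors at which they are
    evaluated have to be countable in number. The seminorms are given as relations, so that no
    supremum of derivatives has to be formed. Splitting off the functions psi_be y_be requires the
    moments of f as vectors of Y, that is, integrals of Y-valued functions; they are obtained as
    limits of integrals of simple functions. *)

(* [P m e x] stands for "q_m x <= e", where q_0 <= q_1 <= ... are seminorms. *)
Record gauge (R : realType) (X : lmodType R) (S : set X)
    (P : nat -> R -> X -> Prop) : Prop := Gauge {
  gauge_S : forall a x y, S x -> S y -> S (a *: x + y);
  gauge_ex : S !=set0;
  gauge_homo : forall m p e x, (m <= p)%N -> P p e x -> P m e x;
  gauge_le : forall m e e' x, e <= e' -> P m e x -> P m e' x;
  gauge_lin : forall m e e' a x y,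
    P m e x -> P m e' y -> P m (`|a| * e + e') (a *: x + y);
  gauge_0 : forall m, P m 0 0 }.

Section Gauge.
Variables (R : realType) (X : lmodType R) (S : set X).
Variable P : nat -> R -> X -> Prop.
Hypothesis G : gauge S P.

Lemma gaugeZ m e a x : P m e x -> P m (`|a| * e) (a *: x).
Proof.
by move=> Px; have := gauge_lin G a Px (gauge_0 G m); rewrite !addr0.
Qed.

Lemma gaugeD m e e' x y : P m e x -> P m e' y -> P m (e + e') (x + y).
Proof.
by move=> Px Py; have := gauge_lin G 1 Px Py; rewrite normr1 mul1r scale1r.
Qed.

Lemma gaugeB m e e' x y : P m e x -> P m e' y -> P m (e' + e) (x - y).
Proof.
move=> Px Py; have := gauge_lin G (-1) Py Px.
by rewrite normrN normr1 mul1r scaleN1r addrC [- y + x]addrC [e + e']addrC.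
Qed.

Lemma gauge_S0 : S 0.
Proof.
have [x Sx] := gauge_ex G.
by have := gauge_S G (-1) Sx Sx; rewrite scaleN1r addNr.
Qed.

Lemma gauge_SZ a x : S x -> S (a *: x).
Proof. by move=> Sx; rewrite -(addr0 (a *: x)); exact: (gauge_S G a Sx gauge_S0). Qed.

Lemma gauge_SB x y : S x -> S y -> S (x - y).
Proof. by move=> Sx Sy; rewrite addrC -scaleN1r; exact: (gauge_S G (-1) Sy Sx). Qed.

Definition gauge_complete := forall y : nat -> X, (forall i, S (y i)) ->
  (forall m (e : R), 0 < e ->
     exists N, forall p q, (N <= p)%N -> (N <= q)%N -> P m e (y p - y q)) ->
  exists2 x, S x & forall m (e : R), 0 < e ->
    exists N, forall p, (N <= p)%N -> P m e (x - y p).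

Definition gauge_separable := forall m (e : R), 0 < e -> exists D : set X,
  [/\ countable D, D `<=` S &
      forall x, S x -> exists2 y, D y & P m e (x - y)].

Lemma gauge_bound m (L : X -> R) (C : R) x e :
  (forall a x y, L (a *: x + y) = a * L x + L y) ->
  (forall x, S x -> P m 1 x -> `|L x| <= C) -> S x -> 0 < e -> P m e x ->
  `|L x| <= e * C.
Proof.
move=> lL LC Sx e0 Px.
have L0 : L 0 = 0.
  by have := lL 1 0 0; rewrite scale1r addr0 mul1r; lra.
have E : L (e^-1 *: x) = e^-1 * L x by rewrite -[X in L X]addr0 lL L0 addr0.
have P1 : P m 1 (e^-1 *: x).
  by have := gaugeZ e^-1 Px; rewrite normfV gtr0_norm// mulVf// gt_eqF.
have := LC _ (gauge_SZ _ Sx) P1.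
by rewrite E normrM normfV (gtr0_norm e0) ler_pdivrMl.
Qed.

End Gauge.

Lemma inv_exp3_le (R : realType) (e : R) : 0 < e ->
  exists N : nat, forall n, (N <= n)%N -> (3 ^- n : R) <= e.
Proof.
move=> e0; exists (Num.bound e^-1) => n Nn.
have h : e^-1 < (Num.bound e^-1)%:R.
  by apply: archi_boundP; rewrite invr_ge0 ltW.
rewrite -[leRHS]invrK lef_pV2 ?posrE ?invr_gt0 ?exprn_gt0//.
rewrite (le_trans (ltW h))// -natrX ler_nat (leq_trans Nn)//.
exact/ltnW/ltn_expl.
Qed.

Section UBP.
Variables (R : realType) (X : lmodType R) (S : set X).
Variable P : nat -> R -> X -> Prop.
Hypothesis G : gauge S P.

(* Sokal's proof of the uniform boundedness principle: the signs of the terms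
   of the series sum_n +- 3^-n x_n are chosen one after the other so that the
   n-th functional is large at the n-th partial sum. *)
Lemma uniform_boundedness (I : Type) (J : nat -> set I) (L : I -> X -> R) m0 :
  gauge_complete S P ->
  (forall i j, (i <= j)%N -> J j `<=` J i) ->
  (forall t a x y, L t (a *: x + y) = a * L t x + L t y) ->
  (forall t, exists C, forall x, S x -> P m0 1 x -> `|L t x| <= C) ->
  (forall x, S x -> exists i, forall t, J i t -> `|L t x| <= 2^-1) ->
  exists i, forall x, S x -> P i 1 x -> forall t, J i t -> `|L t x| <= i%:R.
Proof.
move=> CS Jd lL bL cL; apply: contrapT => nH.
have LB t x y : L t (x - y) = L t x - L t y.
  by rewrite addrC -scaleN1r lL mulN1r addrC.
have bad i : exists tx : I * X,
    [/\ J i tx.1, S tx.2, P i 1 tx.2 & i%:R < `|L tx.1 tx.2|].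
  apply: contrapT => h; apply: nH; exists i => x Sx Px t Jt.
  by rewrite leNgt; apply/negP => lt; apply: h; exists (t, x).
(* One index serves several purposes: being at least m0 it makes every functional bounded on the
   unit ball of its seminorm; being at least n it makes the partial sums Cauchy for all seminorms
   and puts [t n] into [J n]; and 6 * 3^n is the size required of the functional. *)
pose idx n := (m0 + n + 6 * 3 ^ n)%N.
have idx_mono : {homo idx : m n / (m <= n)%N}.
  by move=> m n mn; rewrite /idx leq_add ?leq_add2l// leq_mul2l/= leq_exp2l.
have choose n : exists w : I * X * R,
    [/\ J (idx n) w.1.1, S w.1.2, P (idx n) 1 w.1.2,
        (forall x, S x -> P (idx n) 1 x -> `|L w.1.1 x| <= w.2) &
        6 * 3 ^+ n <= w.2 /\ 5 / 6 * w.2 <= `|L w.1.1 w.1.2| ].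
  have [[t x]/= [Jt Sx Px Lx]] := bad (idx n).
  pose A := [set `|L t z| | z in [set z | S z /\ P (idx n) 1 z]].
  have Ane : A !=set0 by exists `|L t x|, x.
  have Aub : has_ubound A.
    have [C HC] := bL t; exists C => _ [z [Sz Pz] <-]; apply: HC => //.
    by apply: (gauge_homo G _ Pz); rewrite /idx -addnA leq_addr.
  have sA : 6 * 3 ^+ n <= sup A.
    apply: (@le_trans _ _ `|L t x|); last by apply: ub_le_sup => //; exists x.
    rewrite (le_trans _ (ltW Lx))// -natrX -natrM ler_nat /idx.
    by rewrite leq_addl.
  have s0 : 0 < sup A by rewrite (lt_le_trans _ sA)// mulr_gt0// exprn_gt0.
  (* 5/6 exceeds the share 2/3 that is lost at the end: 1/2 to the tail of the series and 1/6 to the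
     distance from a late partial sum to the limit. *)
  have [_ [z [Sz Pz] <-] Lz] : exists2 w, A w & 5 / 6 * sup A < w.
    by apply: sup_gt => //; lra.
  exists (t, z, sup A); split => //=.
  - by move=> y Sy Py; apply: ub_le_sup => //; exists y.
  - by split => //; exact: ltW.
have [w wP] := choice choose.
pose t n := (w n).1.1; pose x n := (w n).1.2; pose s n := (w n).2.
pose c n : R := 3 ^- n.
have c0 n : 0 < c n by rewrite invr_gt0 exprn_gt0.
have cS n : c n = 3 * c n.+1.
  rewrite /c exprS; have : (3 ^+ n : R) != 0 by rewrite gt_eqF ?exprn_gt0.
  by move=> ?; field.
pose step n z := if c n * `|L (t n) (x n)| <= `|L (t n) (c n *: x n + z)|
  then c n *: x n + z else - c n *: x n + z.
pose fix y n := if n is n'.+1 then step n' (y n') else 0.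
(* |L(z + c x)| + |L(z - c x)| >= 2 c |L x|, so one of the two signs works. *)
have Ly n : c n * `|L (t n) (x n)| <= `|L (t n) (y n.+1)|.
  rewrite /= /step; case: ifPn => //; rewrite -ltNge !lL.
  set a := L _ (y n); set b := L (t n) (x n).
  have -> : c n * `|b| = `|c n * b| by rewrite normrM gtr0_norm.
  rewrite mulNr; move: (c n * b) => {}b; move: a => a.
  by case: (ler0P (b + a)); case: (ler0P (- b + a)); case: (ler0P b); lra.
have dy n m : (m <= idx n)%N -> P m (c n) (y n.+1 - y n).
  move=> mn; have [_ _ Px _ _] := wP n; have Pmx := gauge_homo G mn Px.
  have := gaugeZ G (c n) Pmx; have := gaugeZ G (- c n) Pmx.
  rewrite normrN (gtr0_norm (c0 n)) mulr1 /= /step.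
  by case: ifPn => _; rewrite addrK.
have Sy n : S (y n).
  elim: n => [|n IH]; first exact: gauge_S0 G.
  have [_ Sx _ _ _] := wP n.
  by rewrite /= /step; case: ifPn => _; exact: (gauge_S G).
(* The bound is the sum of 3^-i over n < i <= n + d; keeping the subtracted term lets the induction
   close. *)
have tail n d : P (idx n) ((c n - c (n + d)%N) / 2) (y (n.+1 + d)%N - y n.+1).
  elim: d => [|d IH].
    by rewrite !addn0 !subrr mul0r; exact: gauge_0 G _.
  have le1 : (idx n <= idx (n.+1 + d))%N by apply: idx_mono; lia.
  have := gaugeD G (dy _ _ le1) IH.
  rewrite -addnS addrA subrK; apply: (gauge_le G).
  by rewrite (cS (n + d)%N) !addSn addnS; lra.
have tailP n p m : (m <= idx n)%N -> (n < p)%N -> P m (c n / 2) (y p - y n.+1).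
  move=> mn np; rewrite -(subnKC np); apply: (gauge_homo G mn).
  by apply: (gauge_le G _ (tail n _)); have := c0 (n + (p - n.+1))%N; lra.
have [|z Sz zy] := CS y Sy.
  move=> m e e0; have [N hN] := inv_exp3_le e0; exists (maxn N m).+1 => p q lp lq.
  have mi : (m <= idx (maxn N m))%N by rewrite /idx; lia.
  have := gaugeB G (tailP _ p _ mi lp) (tailP _ q _ mi lq).
  rewrite opprB addrA subrK; apply: (gauge_le G).
  by have := hN (maxn N m); rewrite leq_maxl /c => /(_ isT); lra.
(* The index i obtained for the limit z is also the step of the construction at which the
   contradiction appears: [t i] lies in [J i], while |L (t i) z| >= (5/6 - 2/3) c_i s_i >= 1. *)
have [i hi] := cL z Sz.
have [Jt Sx Px bs [s6 s56]] := wP i.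
have Jit : J i (t i).
  by apply: Jd Jt; rewrite /idx; lia.
have := hi _ Jit; apply/negP; rewrite -ltNge.
have [N hN] := zy (idx i) (c i / 6) (divr_gt0 (c0 i) (ltr0n _ 6)).
have hp := hN (maxn N i.+1) (leq_maxl _ _).
have hq := tailP i (maxn N i.+1) (idx i) (leqnn _) (leq_maxr _ _).
have := gaugeD G hp hq; rewrite addrA subrK => hz.
have e0 : 0 < c i / 6 + c i / 2 by have := c0 i; lra.
have := gauge_bound G (lL (t i)) bs (gauge_SB G Sz (Sy i.+1)) e0 hz.
rewrite LB => hz1.
have h1 := Ly i; have h2 : c i * (5 / 6 * s i) <= c i * `|L (t i) (x i)|.
  by rewrite ler_pM2l.
have h3 : `|L (t i) (y i.+1)| - `|L (t i) z - L (t i) (y i.+1)| <= `|L (t i) z|.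
  by have := ler_normB (L (t i) z) (L (t i) z - L (t i) (y i.+1)); rewrite subKr; lra.
have h4 : 6 <= c i * s i.
  have : c i * (6 * 3 ^+ i) <= c i * s i by rewrite ler_pM2l.
  have ne : (3 ^+ i : R) != 0 by rewrite gt_eqF ?exprn_gt0.
  by rewrite {1}/c mulrCA mulVf// mulr1.
rewrite -/(s i) -/(t i) in hz1 h1 h2 h3 h4 *.
have {}h2 : 5 / 6 * (c i * s i) <= c i * `|L (t i) (x i)| by lra.
have {}hz1 : `|L (t i) z - L (t i) (y i.+1)| <= 2 / 3 * (c i * s i) by lra.
by lra.
Qed.

End UBP.

(** * Borel sets of pointwise convergence *)

Lemma borel_open (V : ptopologicalType) (A : set V) :
  open A -> measurable (A : set (borel V)).
Proof. by move=> oA; exact: sub_sigma_algebra. Qed.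

Lemma borel_closed (V : ptopologicalType) (A : set V) :
  closed A -> measurable (A : set (borel V)).
Proof.
move=> cA; rewrite -(setCK (A : set (borel V))); apply: measurableC.
by apply: borel_open; exact: closed_openC.
Qed.

Lemma invS_le (R : realType) (e : R) : 0 < e ->
  exists N : nat, forall n, (N <= n)%N -> (n.+1%:R^-1 : R) <= e.
Proof.
move=> e0; exists (Num.bound e^-1) => n Nn.
have h : e^-1 < (Num.bound e^-1)%:R by apply: archi_boundP; rewrite invr_ge0 ltW.
rewrite -[leRHS]invrK lef_pV2 ?posrE ?invr_gt0 ?ltr0n//.
by rewrite (le_trans (ltW h))// ler_nat; lia.
Qed.

Lemma closed_norm_le (R : realType) (V : topologicalType) (I : Type)
    (D : set I) (g : I -> V -> R) (M : R) :
  (forall t, D t -> continuous (g t)) ->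
  closed [set a | forall t, D t -> `|g t a| <= M].
Proof.
move=> cg; rewrite (_ : [set a | _] =
    \bigcap_(t in D) ((fun a => `|g t a|) @^-1` [set x | x <= M])).
  apply: closed_bigI => t Dt; apply: preimage_closed; last exact: closed_le.
  by move=> x _; apply: continuous_comp; [exact: cg|exact: norm_continuous].
by apply/seteqP; split.
Qed.

Lemma countable_bigcup_measurable d (T : sigmaRingType d) (U : Type)
    (D : set U) (F : U -> set T) : countable D ->
  (forall x, D x -> measurable (F x)) -> measurable (\bigcup_(x in D) F x).
Proof.
elim/Pchoice: U => U in D F *.
move=> /countable_injP[f finj] mF; rewrite (_ : \bigcup_(x in D) F x =
    \bigcup_n \bigcup_(x in D `&` f @^-1` [set n]) F x).
  apply: bigcupT_measurable => n.
  have [/eqP -> |] := boolP (D `&` f @^-1` [set n] == set0).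
    by rewrite bigcup_set0.
  move=> /set0P[x [Dx fx]]; rewrite (_ : D `&` _ = [set x]).
    by rewrite bigcup_set1; exact: mF.
  apply/seteqP; split=> [y [Dy fy]|_ ->//].
  by apply: finj; rewrite ?inE//= fy fx.
apply/seteqP; split => [y [x Dx Fy]|y [n _ [x [Dx _] Fy]]]; last by exists x.
by exists (f x) => //; exists x.
Qed.

Lemma countable_bigcap_measurable d (T : measurableType d) (U : Type)
    (D : set U) (F : U -> set T) : countable D ->
  (forall x, D x -> measurable (F x)) -> measurable (\bigcap_(x in D) F x).
Proof.
move=> cD mF; rewrite -(setCK (\bigcap_(x in D) F x)) setC_bigcap.
apply: measurableC; apply: countable_bigcup_measurable => // x Dx.
by apply: measurableC; exact: mF.
Qed.

Section BorelConv.
Variables (R : realType) (V : ptopologicalType).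

(** For a fixed tolerance and a fixed i the condition is closed, whatever the size of [J i], and the
    tolerances may be restricted to 1/(p+1). *)
Lemma measurable_cvg0 (I : Type) (J : nat -> set I) (g : I -> V -> R) :
  (forall t, J 0%N t -> continuous (g t)) ->
  (forall i j, (i <= j)%N -> J j `<=` J i) ->
  measurable ([set a | forall e : R, 0 < e ->
    exists i, forall t, J i t -> `|g t a| <= e] : set (borel V)).
Proof.
move=> cg Jd; rewrite (_ : [set a | _] = \bigcap_p \bigcup_i
    [set a | forall t, J i t -> `|g t a| <= p.+1%:R^-1]).
  apply: bigcapT_measurable => p; apply: bigcupT_measurable => i.
  by apply: borel_closed; apply: closed_norm_le => t /(Jd _ _ (leq0n _)); exact: cg.
apply/seteqP; split => [a ha p _|a ha e e0].
  by have [|i hi] := ha p.+1%:R^-1; [rewrite invr_gt0|exists i].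
have [N hN] := invS_le e0.
have [i _ hi] := ha N Logic.I; exists i => t /hi /le_trans; apply.
exact: hN.
Qed.

Variables (X : lmodType R) (S : set X) (P : nat -> R -> X -> Prop).
Hypothesis G : gauge S P.

(* By uniform boundedness, convergence to zero on all of S amounts to the closed
   condition of boundedness by some i on some q_i-unit ball together with
   convergence on a countable dense set. *)
Lemma measurable_ptwise_cvg0 (I : Type) (J : nat -> set I)
    (L : V -> I -> X -> R) :
  gauge_complete S P -> gauge_separable S P ->
  (forall i j, (i <= j)%N -> J j `<=` J i) ->
  (forall a t, J 0%N t -> forall x y b, L a t (b *: x + y) = b * L a t x + L a t y) ->
  (forall a, exists m0, forall t, J 0%N t ->
    exists C, forall x, S x -> P m0 1 x -> `|L a t x| <= C) ->
  (forall t x, J 0%N t -> S x -> continuous (fun a => L a t x)) ->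
  measurable ([set a | forall x, S x -> forall e : R, 0 < e ->
    exists i, forall t, J i t -> `|L a t x| <= e] : set (borel V)).
Proof.
move=> CS SS Jd lL bL cL.
have [D DP] : exists D : nat -> set X, forall m : nat,
    [/\ countable (D m), D m `<=` S & forall x, S x ->
      forall e : R, 0 < e -> exists2 y, D m y & P m e (x - y)].
  suff /choice[D hD] : forall m : nat, exists D : set X, [/\ countable D, D `<=` S &
     forall x, S x -> forall e : R, 0 < e -> exists2 y, D y & P m e (x - y)].
    by exists D.
  move=> m; have [p|D hD] := @choice _ _ (fun p (D : set X) => [/\ countable D,
      D `<=` S & forall x, S x -> exists2 y, D y & P m p.+1%:R^-1 (x - y)]).
    by apply: SS; rewrite invr_gt0.
  exists (\bigcup_p D p); split.
  - by apply: bigcup_countable => // p _; have [] := hD p.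
  - by move=> x [p _]; have [_ + _] := hD p; exact.
  - move=> x Sx e e0; have [N hN] := invS_le e0.
    have [_ _ /(_ x Sx)[y Dy Py]] := hD N.
    by exists y; [exists N|exact: (gauge_le G (hN N (leqnn _)) Py)].
pose E i := [set a | forall xt : X * I,
  (S xt.1 /\ P i 1 xt.1) /\ J i xt.2 -> `|L a xt.2 xt.1| <= i%:R].
rewrite (_ : [set a | _] = (\bigcup_i E i) `&`
   \bigcap_m \bigcap_(x in D m)
     [set a | forall e : R, 0 < e -> exists i, forall t, J i t -> `|L a t x| <= e]).
  apply: measurableI.
    apply: bigcupT_measurable => i; apply: borel_closed.
    apply: closed_norm_le => -[x t]/= [[Sx _] Jt].
    by apply: cL => //; exact: Jd Jt.
  apply: bigcapT_measurable => m; have [cD DS _] := DP m.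
  apply: countable_bigcap_measurable => // x Dx.
  apply: (@measurable_cvg0 I J (fun t a => L a t x)) => // t Jt.
  by apply: cL => //; exact: DS.
apply/seteqP; split => [a ha|a [[i _ ai] aD] x Sx e e0].
  split; last first.
    by move=> m _ x Dx; apply: ha; have [_ + _] := DP m; exact.
  have [m0 hm0] := bL a.
  (* Linearity and boundedness are assumed only for t in [J 0], hence the subtype as index type. *)
  have [||||i hi] := @uniform_boundedness R X S P G {t | J 0%N t}
    (fun i => [set t | J i (sval t)]) (fun t => L a (sval t)) m0 CS.
  - by move=> i j ij t; exact: Jd.
  - by move=> [t Jt] b x y; exact: lL.
  - by move=> [t Jt]; exact: hm0.
  - by move=> x Sx; have [|i hi] := ha x Sx 2^-1; [lra|exists i => t; exact: hi].
  exists i => // -[x t]/= [[Sx Px] Jt].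
  exact: (hi x Sx Px (exist _ t (Jd _ _ (leq0n _) _ Jt))).
(* A functional bounded by i on the unit ball of q_i changes by at most e / 2 from x to y; i + 1
   stands for i, which may be 0. *)
have [_ DS /(_ x Sx (e / (2 * i.+1%:R)))[|y Dy Py]] := DP i.
  by rewrite divr_gt0 // mulr_gt0.
have [|j hj] := aD i Logic.I y Dy (e / 2); first by rewrite divr_gt0.
exists (maxn i j) => t Jt.
have /hj hy : J j t by apply: Jd Jt; exact: leq_maxr.
have J0 : J 0%N t by apply: Jd Jt; exact: leq0n.
have Ji : J i t by apply: Jd Jt; exact: leq_maxl.
have := gauge_bound G (fun b x y => lL a t J0 x y b) (C := i%:R) _ (gauge_SB G Sx (DS _ Dy)) _ Py.
move=> /(_ (fun x Sx Px => ai (x, t) (conj (conj Sx Px) Ji))).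
have e1 : 0 < e / (2 * i.+1%:R) by rewrite divr_gt0 // mulr_gt0.
move=> /(_ e1) h.
have Exy : L a t x = L a t (x - y) + L a t y.
  by have := lL a t J0 (x - y) y 1; rewrite scale1r mul1r subrK.
rewrite Exy (le_trans (ler_normD _ _))// (splitr e) lerD//.
rewrite (le_trans h)// invfM -mulrA -mulrA ler_pM2l// ler_piMr ?invr_ge0//.
by rewrite mulrC ler_pdivrMr// mul1r ler_nat.
Qed.

End BorelConv.

Definition dense_seq (R : realType) (W : normedModType R) (d : nat -> W) :=
  forall w (e : R), 0 < e -> exists n, `|w - d n| < e.

Lemma separable_dense_seq (R : realType) (W : normedModType R) :
  separable W -> exists d : nat -> W, dense_seq d.
Proof.
move=> [D cD dD].
have [x0 [_ Dx0]] := dD setT (@ex_intro _ _ 0 Logic.I) openT.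
have [f finj] := countable_injP _ cD.
pose d n := xget x0 [set x | D x /\ f x = n]; exists d => w e e0.
have [|x [/= wx Dx]] := dD (ball w e) _ (ball_open w e).
  by exists w; exact: ballxx.
exists (f x); rewrite /d; case: xgetP => [y _ [Dy fy]|/(_ x)/=]; last first.
  by move=> H; exfalso; apply: H.
have -> : y = x by apply: finj; rewrite ?inE.
by move: wx; rewrite -ball_normE.
Qed.

Lemma borel_measurable_fun d (T : measurableType d) (Z : ptopologicalType)
    (A : set T) (F : T -> borel Z) :
  (forall U : set Z, open U -> measurable (A `&` F @^-1` U)) ->
  measurable_fun A F.
Proof.
move=> H; apply: (@measurability _ _ _ _ A F (@open Z)) => //.
by move=> _ [U oU <-]; exact: H.
Qed.

Lemma measurable_sum_bounded_additive (R : realType) d (T : measurableType d)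
    (A : set T) (I : finType) (W : normedModType R) (ds : nat -> W)
    (Z : normedModType R) (c : I -> T -> W) (Phi : I -> W -> Z) (C : R) :
  dense_seq ds -> measurable A ->
  (forall i x y, Phi i (x - y) = Phi i x - Phi i y) ->
  (forall i x, `|Phi i x| <= C * `|x|) ->
  (forall i n e, measurable (A `&` [set a | `|c i a - ds n| < e])) ->
  measurable_fun A (fun a => \sum_i Phi i (c i a) : borel Z).
Proof.
move=> dW mA PhiB PhiC mc; apply: borel_measurable_fun => U oU.
pose r (N : nat) : R := N.+1%:R^-1.
have r0 N : 0 < r N by rewrite /r invr_gt0.
pose box (qN : {ffun I -> nat} * nat) := forall w : I -> W,
  (forall i, `|w i - ds (qN.1 i)| < r qN.2) -> U (\sum_i Phi i (w i)).
rewrite (_ : _ `&` _ = \bigcup_(qN in box) (A `&`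
   \bigcap_i (A `&` [set a | `|c i a - ds (qN.1 i)| < r qN.2]))); last first.
  apply/seteqP; split => [a [Aa Ua]|a [[q N] /= bx [Aa ca]]]; last first.
    by split => //=; apply: bx => i; have [] := ca i Logic.I.
  have /nbhs_ballP[e /= e0 eU] : nbhs (\sum_i Phi i (c i a)) U by exact: open_nbhs_nbhs.
  (* Within a box each coefficient varies by at most 2/(N+1), hence the sum by at most |I| |C|
     2/(N+1); the summand 1 makes K positive. *)
  pose K : R := #|I|%:R * (`|C| * 2) + 1.
  have K0 : 0 < K by rewrite ltr_wpDl ?mulr_ge0.
  have [N hN] := invS_le (divr_gt0 e0 K0).
  have /choice[q hq] : forall i, exists n, `|c i a - ds n| < r N.
    by move=> i; exact: dW.
  exists ([ffun i => q i], N); last first.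
    by split => // i _; split => //=; rewrite ffunE.
  move=> w /= hw; apply: eU; rewrite -ball_normE /=.
  rewrite -sumrB (le_lt_trans (ler_norm_sum _ _ _))//.
  apply: (@le_lt_trans _ _ (\sum_(i in I) (`|C| * 2 * r N))).
    apply: ler_sum => i _; rewrite -PhiB (le_trans (PhiC _ _))//.
    apply: (@le_trans _ _ (`|C| * `|c i a - w i|)).
      by rewrite ler_wpM2r// ler_norm.
    rewrite -mulrA ler_wpM2l//.
    have -> : c i a - w i = (c i a - ds (q i)) - (w i - ds (q i)) by rewrite opprB addrA subrK.
    rewrite (le_trans (ler_normB _ _))// mulr_natl mulr2n lerD// ltW//.
    by have := hw i; rewrite ffunE.
  rewrite sumr_const -[_ *+ #|I|]mulr_natl mulrA.
  have := hN N (leqnn _); rewrite ler_pdivlMr// -/(r N) => H.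
  apply: (lt_le_trans _ H). rewrite [ltRHS]mulrC ltr_pM2r ?r0//.
  by rewrite /K ltrDl.
apply: countable_bigcup_measurable; first exact: countableP.
move=> [q N] _; apply: measurableI => //.
apply: countable_bigcap_measurable; first exact: countableP.
by move=> i _; exact: mc.
Qed.

(** * Uniform limits of derivatives *)

Section MeanValue.
Variables (R : realType) (W : normedModType R).

(** Continuous induction replaces the mean value theorem, as g is vector-valued: the supremum s of
    the t with |g t - g 0| <= K t is itself such a t, and if s < 1 there is a larger one. *)
Lemma local_lipschitz_segment (g : R -> W) (K : R) :
  (forall t, 0 <= t <= 1 -> exists2 d : R, 0 < d &
     forall h, `|h| < d -> `|g (t + h) - g t| <= K * `|h|) ->
  `|g 1 - g 0| <= K.
Proof.
move=> gK; pose E := [set t | 0 <= t <= 1 /\ `|g t - g 0| <= K * t].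
have E0 : E 0 by split; rewrite ?lexx ?ler01// subrr normr0 mulr0.
have Eub : has_ubound E by exists 1 => t [/andP[]].
have Esup : has_sup E by split => //; exists 0.
pose s := sup E.
have s01 : 0 <= s <= 1.
  apply/andP; split; first by apply: ub_le_sup.
  by apply: ge_sup => [|t [/andP[]]//]; exists 0.
have [d d0 gd] := gK s s01.
have Es : E s.
  split=> //; have [t Et st] := sup_adherent d0 Esup.
  have ts : t <= s by apply: ub_le_sup.
  have [_ gt] := Et.
  have := gd (t - s); rewrite [s + _]addrC subrK distrC ger0_norm ?subr_ge0//.
  rewrite ltrBlDl -ltrBlDr => /(_ st) gs.
  have -> : g s - g 0 = (g t - g 0) - (g t - g s) by rewrite opprB [RHS]addrC subrKA.
  by rewrite (le_trans (ler_normB _ _))//; lra.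
have [s1|s1] := ltP s 1; last first.
  have sE : s = 1 by apply/eqP; rewrite eq_le s1 andbT; case/andP: s01.
  by case: Es => _; rewrite sE mulr1.
pose t := Num.min 1 (s + d / 2).
have st : s < t by rewrite lt_min s1 ltrDl divr_gt0.
have tsd : t <= s + d / 2 by rewrite ge_min lexx orbT.
have : E t.
  split; first by rewrite ge_min lexx andbT; case/andP: s01 => s0 _; lra.
  have := gd (t - s); rewrite [s + _]addrC subrK ger0_norm ?subr_ge0 ?(ltW st)//.
  move=> gts; have {}gts : `|g t - g s| <= K * (t - s) by apply: gts; lra.
  have [_ gs] := Es.
  have -> : g t - g 0 = (g t - g s) + (g s - g 0) by rewrite addrA subrK.
  by rewrite (le_trans (ler_normD _ _))//; lra.
by move=> /(ub_le_sup Eub); rewrite leNgt st.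
Qed.

Lemma mean_value_inequality (V : normedModType R) (f : V -> W) (x v : V) (M : R) :
  (forall y, derivable f y v) -> (forall y, `|'D_v f y| <= M) ->
  `|f (x + v) - f x| <= M.
Proof.
move=> df fM; apply/ler_addgt0Pr => e e0.
(* The difference quotients near a point are bounded by M only up to e. *)
have := @local_lipschitz_segment (fun t => f (x + t *: v)) (M + e).
rewrite scale1r scale0r addr0; apply => t _.
have /derivableP[/cvgrPdist_lt/(_ e e0)] := df (x + t *: v).
rewrite !nearE => /nbhs_ballP[d /= d0 H].
exists d => // h hd.
have [->|h0] := eqVneq h 0; first by rewrite addr0 subrr !normr0 mulr0.
have : `|'D_v f (x + t *: v) - h^-1 *: (f (h *: v + (x + t *: v)) - f (x + t *: v))| < e.
  by apply: H => //; rewrite /ball /= sub0r normrN.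
rewrite -[x in `|f x - _|]addrC.
have -> : h *: v + (x + t *: v) = x + (t + h) *: v.
  by rewrite addrCA scalerDl [h *: v + _]addrC.
set D := 'D_v f _; set F := f _ - f _ => H1.
have : `|h^-1 *: F| <= M + e.
  have -> : h^-1 *: F = D - (D - h^-1 *: F) by rewrite subKr.
  by rewrite (le_trans (ler_normB _ _))// lerD ?fM// ltW.
by rewrite normrZ normfV ler_pdivrMl ?normr_gt0// mulrC addrC.
Qed.

End MeanValue.

Lemma diff_telescope (Z : zmodType) (a b c d e h : Z) :
  a - b - h = ((a - c) - (b - d)) + (c - d - e) - (h - e).
Proof.
rewrite [X in _ = X - _]addrA [- (h - e)]opprB subrKA; congr (_ - h).
by rewrite [- (b - d)]opprB addrAC subrKA subrKA.
Qed.

Section Frechet.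
Variables (R : realType) (V W : normedModType R).

Lemma differentiable_eps (f : V -> W) x (df : {linear V -> W}) :
  continuous df ->
  (forall e : R, 0 < e -> exists2 d : R, 0 < d & forall h, `|h| < d ->
     `|f (h + x) - f x - df h| <= e * `|h|) ->
  differentiable f x /\ 'd f x = df :> (V -> W).
Proof.
move=> cdf H.
have E : f \o shift x = cst (f x) + df +o_ (0 : V) id.
  apply/eqaddoP => e /= e0; have [d d0 Hd] := H e e0.
  apply/nbhs_ballP; exists d => // h; rewrite -ball_normE /= sub0r normrN => hd.
  by rewrite !fctE opprD addrA; exact: Hd.
have E2 := diff_unique cdf E; split=> //.
by apply/diff_locallyP; rewrite E2.
Qed.

Lemma eps_differentiable (f : V -> W) x : differentiable f x ->
  forall e : R, 0 < e -> exists2 d : R, 0 < d & forall h, `|h| < d ->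
     `|f (h + x) - f x - 'd f x h| <= e * `|h|.
Proof.
move=> /diff_locallyP[_ /eqaddoP H] e e0.
have /nbhs_ballP[d /= d0 Hd] := H e e0.
exists d => // h hd; have := Hd h; rewrite -ball_normE /= sub0r normrN => /(_ hd).
by rewrite !fctE opprD addrA.
Qed.

(** By the mean value inequality the increments of F p - F N are small relative to |h|, uniformly in
    p. Letting p tend to infinity transfers this to G - F N, and differentiability of the single
    function F N completes the estimate. The error e |v| for the derivatives makes H linear and
    bounded in v. *)
Lemma differentiable_uniform_limit (F : nat -> V -> W) (G : V -> W)
    (H : V -> V -> W) :
  (forall p x, differentiable (F p) x) ->
  (forall x (e : R), 0 < e -> exists N, forall p, (N <= p)%N -> `|G x - F p x| <= e) ->
  (forall e : R, 0 < e -> exists N, forall p, (N <= p)%N ->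
     forall v x, `|H v x - 'D_v (F p) x| <= e * `|v|) ->
  forall x, differentiable G x /\ forall v, 'D_v G x = H v x.
Proof.
move=> dF FG DH x.
have DF p v y : 'D_v (F p) y = 'd (F p) y v by exact: deriveE.
have Hlin : linear (H ^~ x).
  move=> a u v; apply/eqP; rewrite -subr_eq0 -normr_eq0.
  rewrite eq_le normr_ge0 andbT; apply/ler_addgt0Pr => e e0; rewrite add0r.
  pose K := `|a *: u + v| + `|a| * `|u| + `|v| + 1.
  have K0 : 0 < K by rewrite ltr_wpDl// !addr_ge0// mulr_ge0.
  have [N hN] := DH (e / K) (divr_gt0 e0 K0).
  have h1 := hN N (leqnn _) (a *: u + v) x.
  have h2 := hN N (leqnn _) u x.
  have h3 := hN N (leqnn _) v x.
  move: h1 h2 h3; rewrite !DF linearP.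
  set d := 'd _ _ => h1 h2 h3.
  have -> : H (a *: u + v) x - (a *: H u x + H v x) =
     (H (a *: u + v) x - (a *: d u + d v)) - (a *: (H u x - d u) + (H v x - d v)).
    by rewrite scalerBr [X in _ = _ - X]addrACA -opprD opprB addrA subrK.
  rewrite (le_trans (ler_normB _ _))// (le_trans (lerD h1 (ler_normD _ _)))//.
  rewrite normrZ.
  have {}h2 := ler_wpM2l (normr_ge0 a) h2.
  apply: (@le_trans _ _ (e / K * (K - 1))).
    rewrite /K addrK; move: h2 h3; set q := e / _; nra.
  by rewrite mulrAC ler_pdivrMr// ler_pM2l// gerBl.
pose df : {linear V -> W} :=
  HB.pack (H ^~ x) (GRing.isLinear.Build R V W _ _ Hlin).
have cdf : continuous df.
  apply/linear_bounded_continuous/bounded_funP => r.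
  have [N /(_ N (leqnn _)) hN] := DH 1 ltr01.
  have [k k0 hk] := linear_lipschitz (diff_continuous (dF N x)).
  exists ((1 + k) * r) => v vr.
  have -> : df v = (H v x - 'D_v (F N) x) + 'd (F N) x v by rewrite DF subrK.
  rewrite (le_trans (ler_normD _ _))// mulrDl lerD//.
    by rewrite (le_trans (hN _ _))// mul1r mul1r.
  by rewrite (le_trans (hk _))// ler_pM2l.
have [|dG dGE] := @differentiable_eps G x df cdf; last first.
  by split=> // v; rewrite deriveE// dGE.
move=> e e0; have e4 : 0 < e / 4 by rewrite divr_gt0.
have [N hN] := DH _ e4.
have [d d0 hd] := eps_differentiable (dF N x) e4.
exists d => // h /hd h1; have h2 := hN N (leqnn _) h x.
have h3 : `|(G (h + x) - F N (h + x)) - (G x - F N x)| <= e / 2 * `|h|.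
  apply/ler_addgt0Pr => t t0; have t2 : 0 < t / 2 by rewrite divr_gt0.
  have [p1 hp1] := FG x _ t2; have [p2 hp2] := FG (h + x) _ t2.
  pose p := maxn N (maxn p1 p2).
  have {}hp1 : `|G x - F p x| <= t / 2 by apply: hp1; rewrite /p; lia.
  have {}hp2 : `|G (h + x) - F p (h + x)| <= t / 2 by apply: hp2; rewrite /p; lia.
  have dB y : derivable (F p - F N) y h by exact/derivableB/diff_derivable/dF/diff_derivable.
  have := @mean_value_inequality R W V (F p - F N) x h (e / 2 * `|h|) dB.
  rewrite !fctE [x + h]addrC => mv.
  have {}mv : `|F p (h + x) - F N (h + x) - (F p x - F N x)| <= e / 2 * `|h|.
    apply: mv => y; rewrite (deriveB (diff_derivable (dF p y)) (diff_derivable (dF N y))).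
    have a1 := hN N (leqnn _) h y; have a2 := hN p (leq_maxl _ _) h y.
    have -> : 'D_h (F p) y - 'D_h (F N) y =
      (H h y - 'D_h (F N) y) - (H h y - 'D_h (F p) y) by rewrite opprB [RHS]addrC subrKA.
    by rewrite (le_trans (ler_normB _ _))//; lra.
  have -> : G (h + x) - F N (h + x) - (G x - F N x) =
    (F p (h + x) - F N (h + x) - (F p x - F N x)) +
    ((G (h + x) - F p (h + x)) - (G x - F p x)).
    rewrite addrACA -opprD [F p (h + x) - _ + _]addrC subrKA.
    by rewrite [F p x - _ + _]addrC subrKA.
  rewrite (le_trans (ler_normD _ _))// lerD// (splitr t).
  by rewrite (le_trans (ler_normB _ _))// lerD.
have -> : G (h + x) - G x - df h =
  ((G (h + x) - F N (h + x)) - (G x - F N x)) +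
  (F N (h + x) - F N x - 'd (F N) x h) - (H h x - 'D_h (F N) x).
  by rewrite DF; exact: diff_telescope.
rewrite (le_trans (ler_normB _ _))//.
have := ler_normD ((G (h + x) - F N (h + x)) - (G x - F N x)) (F N (h + x) - F N x - 'd (F N) x h).
by move: h1 h2 h3; lra.
Qed.

End Frechet.

(** * Test functions *)

Lemma enorm_ge0 (R : realType) n (v : 'rV[R]_n) : 0 <= enorm v.
Proof. exact: sqrtr_ge0. Qed.

Lemma compact_norm_ball (R : realType) n (j : R) :
  compact [set x : 'rV[R]_n | `|x| <= j].
Proof.
apply: bounded_closed_compact.
  by exists j; split; [exact: num_real|move=> M jM x /= /le_trans; apply; exact: ltW].
apply: (@preimage_closed _ _ (fun x : 'rV[R]_n => `|x|) [set r | r <= j]).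
  by move=> x _; exact: norm_continuous.
exact: closed_le.
Qed.

Lemma coord_norm (R : realType) n (v : 'rV[R]_n) i : `|v 0 i| <= `|v|.
Proof.
rewrite [leRHS]/Num.Def.normr /= mx_normrE.
by apply/bigmax_geP; right => /=; exists (0, i).
Qed.

Lemma norm_row_le (R : realType) n (v : 'rV[R]_n) (M : R) :
  0 <= M -> (forall i, `|v 0 i| <= M) -> `|v| <= M.
Proof.
move=> M0 vM; rewrite [leLHS]/Num.Def.normr /= mx_normrE.
by apply/bigmax_leP; split => // -[i j] _ /=; rewrite ord1.
Qed.

Lemma norm_row_lt (R : realType) n (v : 'rV[R]_n) (M : R) :
  0 < M -> (forall i, `|v 0 i| < M) -> `|v| < M.
Proof.
move=> M0 vM; rewrite [ltLHS]/Num.Def.normr /= mx_normrE.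
by apply/bigmax_ltP; split => // -[i j] _ /=; rewrite ord1.
Qed.

Lemma norm_le_enorm (R : realType) n (v : 'rV[R]_n) : `|v| <= enorm v.
Proof. by apply: norm_row_le => [|i]; [exact: enorm_ge0|exact: coord_enorm]. Qed.

Lemma enorm_le_norm (R : realType) n (v : 'rV[R]_n) : enorm v <= n.+1%:R * `|v|.
Proof.
rewrite -[leRHS]ger0_norm ?mulr_ge0// -sqrtr_sqr ler_sqrt ?sqr_ge0//.
apply: (@le_trans _ _ (\sum_(i < n) `|v| ^+ 2)).
  apply: ler_sum => i _; rewrite -(real_normK (num_real (v 0 i))).
  by rewrite lerXn2r ?nnegrE ?coord_norm.
rewrite sumr_const card_ord -[_ *+ n]mulr_natl exprMn ler_wpM2r ?sqr_ge0//.
by rewrite -natrX ler_nat; lia.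
Qed.

Section IterD.
Variables (R : realType) (n : nat) (W : normedModType R).
Local Notation V := 'rV[R]_n.
Implicit Types f g : V -> W.

Lemma smooth_diff f x : smooth f -> differentiable f x.
Proof. by move=> /(_ 1%N)[]. Qed.

Lemma smooth_derive f v : smooth f -> smooth ('D_v f).
Proof. by move=> sf m; have [_] := sf m.+1; exact. Qed.

Lemma smooth_iterD s f : smooth f -> smooth (iterD s f).
Proof. by move=> sf; elim: s => //= v s; exact: smooth_derive. Qed.

Lemma smooth_lin a f g : smooth f -> smooth g -> smooth (a *: f + g).
Proof. by move=> sf sg m; exact: Ck_lin. Qed.

Lemma smooth0 : smooth (0 : V -> W).
Proof. by move=> m; exact: Ck0. Qed.

Lemma smooth_continuous f : smooth f -> continuous f.
Proof. by move=> /(_ 0%N). Qed.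

Lemma iterD_cat s1 s2 f : iterD (s1 ++ s2) f = iterD s1 (iterD s2 f).
Proof. by elim: s1 => //= v s ->. Qed.

Lemma iterD_rcons s v f : iterD (rcons s v) f = iterD s ('D_v f).
Proof. by rewrite -cats1 iterD_cat. Qed.

Lemma iterD_lin s a f g : smooth f -> smooth g ->
  iterD s (a *: f + g) = a *: iterD s f + iterD s g.
Proof.
move=> sf sg; elim: s => //= v s ->.
by apply: derive_lin => x; apply/smooth_diff/smooth_iterD.
Qed.

Lemma iterD0 s : iterD s (0 : V -> W) = 0.
Proof.
elim: s => //= v s ->.
by apply/funext => x; rewrite [LHS]derive_cst.
Qed.

Lemma iterDZ s a f : smooth f -> iterD s (a *: f) = a *: iterD s f.
Proof.
by move=> sf; have := iterD_lin s a sf smooth0; rewrite iterD0 !addr0.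
Qed.

Lemma iterDB s f g : smooth f -> smooth g ->
  iterD s (f - g) = iterD s f - iterD s g.
Proof.
move=> sf sg; rewrite addrC -scaleN1r iterD_lin// scaleN1r addrC //.
Qed.

Lemma smooth_sum (I : Type) (r : seq I) (c : I -> R) (g : I -> V -> W) :
  (forall i, smooth (g i)) -> smooth (\sum_(i <- r) c i *: g i).
Proof.
move=> sg; elim: r => [|i r IH]; first by rewrite big_nil; exact: smooth0.
by rewrite big_cons; exact: smooth_lin.
Qed.

Lemma iterD_sum s (I : Type) (r : seq I) (c : I -> R) (g : I -> V -> W) :
  (forall i, smooth (g i)) ->
  iterD s (\sum_(i <- r) c i *: g i) = \sum_(i <- r) c i *: iterD s (g i).
Proof.
move=> sg; elim: r => [|i r IH]; first by rewrite !big_nil iterD0.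
by rewrite !big_cons iterD_lin// ?IH//; exact: smooth_sum.
Qed.

Lemma deriveZv c v f : (forall x, differentiable f x) ->
  'D_(c *: v) f = c *: 'D_v f.
Proof.
by move=> df; apply/funext => x; rewrite fctE /= (deriveE _ (df x))
  [in RHS](deriveE _ (df x)) linearZ.
Qed.

Lemma derive_basis v f : (forall x, differentiable f x) ->
  'D_v f = \sum_(i < n) v 0 i *: 'D_(delta_mx 0 i) f.
Proof.
move=> df; apply/funext => x; rewrite fct_sumE (deriveE _ (df x)).
rewrite {1}(row_sum_delta v) linear_sum; apply: eq_bigr => i _.
by rewrite linearZ fctE /= [in RHS](deriveE _ (df x)).
Qed.

(* "sup_{x, i <= m} |D^i f(x)| <= e" *)
Definition deriv_le (m : nat) (e : R) f := forall s : seq V, (size s <= m)%N ->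
  (forall v, v \in s -> enorm v <= 1) -> forall x, `|iterD s f x| <= e.

Lemma deriv_leP m e f : deriv_le m e f <-> forall i, (i <= m)%N ->
  forall (x : V) (v : 'I_i -> V), (forall j, enorm (v j) <= 1) ->
  `|derivn f x v| <= e.
Proof.
split=> [H i im x v v1|H s sm s1 x].
  apply: H => [|w /mapP[j _ ->//]]; by rewrite size_map size_enum_ord.
have := H (size s) sm x (fun j => nth 0 s j); rewrite /derivn.
have -> : [seq nth 0 s (nat_of_ord j) | j <- enum 'I_(size s)] = s.
  by rewrite (map_comp (nth 0 s) (@nat_of_ord _)) val_enum_ord map_nth_iota0 ?take_size.
by apply=> j; apply: s1; exact: mem_nth.
Qed.

Lemma deriv_le_homo m p e f : (m <= p)%N -> deriv_le p e f -> deriv_le m e f.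
Proof. by move=> mp H s sm; apply: H; exact: leq_trans mp. Qed.

Lemma deriv_le_le m e e' f : e <= e' -> deriv_le m e f -> deriv_le m e' f.
Proof. by move=> ee H s sm s1 x; apply: (le_trans _ ee); exact: H. Qed.

Lemma deriv_le_lin m e e' a f g : smooth f -> smooth g ->
  deriv_le m e f -> deriv_le m e' g -> deriv_le m (`|a| * e + e') (a *: f + g).
Proof.
move=> sf sg Hf Hg s sm s1 x; rewrite iterD_lin// !fctE /=.
rewrite (le_trans (ler_normD _ _))// lerD ?Hg// normrZ ler_wpM2l//.
exact: Hf.
Qed.

Lemma deriv_le_derive m e f v : enorm v <= 1 -> deriv_le m.+1 e f -> deriv_le m e ('D_v f).
Proof.
move=> v1 H s sm s1 x; rewrite -iterD_rcons; apply: H.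
  by rewrite size_rcons.
by move=> w; rewrite mem_rcons inE => /orP[/eqP->//|]; exact: s1.
Qed.

Lemma enorm_normalize (v : V) : enorm ((enorm v + 1)^-1 *: v) <= 1.
Proof.
have c0 : 0 < enorm v + 1 by rewrite ltr_wpDl// enorm_ge0.
rewrite enormZ gtr0_norm ?invr_gt0// ler_pdivrMl// mulr1 lerDl ler01 //.
Qed.

(** Directions are divided by |v| + 1, which covers v = 0. The innermost direction is removed first,
    because the hypothesis passes from f to its directional derivative. *)
Lemma iterD_le s f e x : smooth f -> deriv_le (size s) e f ->
  `|iterD s f x| <= (\prod_(v <- s) (enorm v + 1)) * e.
Proof.
elim/last_ind: s f => [|s v IH] f sf H.
  by rewrite big_nil mul1r; exact: (H [::]).
have c0 : 0 < enorm v + 1 by rewrite ltr_wpDl// enorm_ge0.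
have vE : v = (enorm v + 1) *: ((enorm v + 1)^-1 *: v).
  by rewrite scalerA mulfV ?gt_eqF// scale1r.
set u := _ *: v in vE.
have E1 : 'D_v f = (enorm v + 1) *: 'D_u f.
  by rewrite {1}vE deriveZv// => y; exact: smooth_diff.
rewrite iterD_rcons E1 iterDZ; last exact: smooth_derive.
rewrite fctE /= normrZ gtr0_norm// -cats1 big_cat big_seq1 /=.
rewrite mulrAC mulrC ler_pM2r// IH//; first exact: smooth_derive.
by apply: deriv_le_derive; [exact: enorm_normalize|rewrite size_rcons in H].
Qed.

(** A direction of length at most 1 is a combination of n basis vectors with coefficients at most 1
    in modulus, which costs a factor n per derivative; with n + 1 in place of n the bound is
    monotone in the order. Thus finitely many derivatives control a seminorm. *)
Lemma deriv_le_basis m e f : smooth f ->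
  (forall l : seq 'I_n, (size l <= m)%N ->
     forall x, `|iterD [seq delta_mx 0 i | i <- l] f x| <= e) ->
  deriv_le m (n.+1%:R ^+ m * e) f.
Proof.
move=> sf H s sm s1 x.
have e0 : 0 <= e := le_trans (normr_ge0 _) (H [::] (leq0n _) x).
apply: (@le_trans _ _ (n.+1%:R ^+ size s * e)); last first.
  by rewrite ler_wpM2r// ler_weXn2l// ler1n.
elim/last_ind: s f m sf sm s1 H => [|s v IH] f m sf sm s1 H.
  by rewrite mul1r; exact: (H [::]).
rewrite size_rcons in sm *; case: m => // m in sm H *.
have v1 : enorm v <= 1 by apply: s1; rewrite mem_rcons mem_head.
rewrite iterD_rcons derive_basis; last by move=> y; exact: smooth_diff.
rewrite iterD_sum; last by move=> i; exact: smooth_derive.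
rewrite fct_sumE (le_trans (ler_norm_sum _ _ _))//.
apply: (@le_trans _ _ (\sum_(i < n) (n.+1%:R ^+ size s * e))).
  apply: ler_sum => i _; rewrite fctE /= normrZ -[leRHS]mul1r ler_pM//.
    exact: le_trans (coord_enorm _ _) v1.
  apply: (IH _ m) => //; first exact: smooth_derive.
    by move=> w ws; apply: s1; rewrite mem_rcons inE ws orbT.
  move=> l lm y; rewrite -iterD_rcons -map_rcons; apply: H.
  by rewrite size_rcons.
rewrite sumr_const card_ord -[_ *+ n]mulr_natl exprS -mulrA ler_wpM2r//.
  by rewrite mulr_ge0// exprn_ge0.
by rewrite ler_nat.
Qed.

Lemma deriv_le_lipschitz m e f s x y : smooth f -> deriv_le m.+1 e f ->
  (size s <= m)%N -> (forall v, v \in s -> enorm v <= 1) ->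
  `|iterD s f x - iterD s f y| <= n.+1%:R * e * `|x - y|.
Proof.
move=> sf H sm s1.
have e0 : 0 <= e.
  by apply: (le_trans (normr_ge0 (iterD [::] f 0))); exact: (H [::]).
have sg : smooth (iterD s f) by exact: smooth_iterD.
have [->|xy] := eqVneq x y; first by rewrite !subrr !normr0 mulr0.
have dv : 0 < enorm (x - y).
  by apply: lt_le_trans (norm_le_enorm _); rewrite normr_gt0 subr_eq0.
pose u := (enorm (x - y))^-1 *: (x - y).
have uE : x - y = enorm (x - y) *: u.
  by rewrite scalerA mulfV ?gt_eqF// scale1r.
have u1 : enorm u <= 1 by rewrite enormZ gtr0_norm ?invr_gt0// mulVf ?gt_eqF.
have -> : x = y + (x - y) by rewrite addrC subrK.
rewrite [y + _ - y]addrAC subrr add0r.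
apply: (@le_trans _ _ (e * enorm (x - y))); last first.
  by rewrite [_ * e]mulrC -mulrA ler_wpM2l// enorm_le_norm.
apply: mean_value_inequality => z; first exact/diff_derivable/smooth_diff.
have -> : derive (iterD s f) z (x - y) = enorm (x - y) *: derive (iterD s f) z u.
  have dz := smooth_diff z sg.
  by rewrite (deriveE _ dz) [in RHS](deriveE _ dz) -linearZ -uE.
rewrite normrZ gtr0_norm// mulrC ler_pM2r//.
apply: (H (u :: s)) => //.
by move=> v; rewrite inE => /orP[/eqP->//|]; exact: s1.
Qed.

(** Stands for compact support, by [testfun_vanish] and [testfunP]. The strict inequality describes
    an open set, so that the derivatives vanish on the same set. *)
Definition vanish (j : R) f := forall x, j < `|x| -> f x = 0.

Lemma vanish_derive j f v : vanish j f -> vanish j ('D_v f).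
Proof.
move=> Zf x jx; rewrite /derive; apply: cvg_lim => //.
apply/cvgrPdist_lt => e e0; rewrite !nearE; apply/nbhs_ballP.
have v0 : 0 < `|v| + 1 by rewrite ltr_wpDl.
have d0 : 0 < (`|x| - j) / (`|v| + 1) by rewrite divr_gt0// subr_gt0.
exists ((`|x| - j) / (`|v| + 1)) => // h; rewrite /ball /= sub0r normrN => hd _.
have hv : `|h *: v| < `|x| - j.
  rewrite normrZ (le_lt_trans _ (_ : `|h| * (`|v| + 1) < _))//.
    by rewrite ler_wpM2l// lerDl.
  by rewrite -ltr_pdivlMr.
have := ler_normB (h *: v + x) (h *: v); rewrite addrAC subrr add0r => hx.
have jh : j < `|h *: v + x| by lra.
by rewrite /= (Zf _ jh) (Zf _ jx) !subrr scaler0 subrr normr0.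
Qed.

Lemma vanish_iterD j f s : vanish j f -> vanish j (iterD s f).
Proof. by move=> Zf; elim: s => //= v s; exact: vanish_derive. Qed.

Lemma vanish_bounded j f : continuous f -> vanish j f ->
  exists2 M, 0 <= M & forall x, `|f x| <= M.
Proof.
move=> cf Zf; pose B := [set x : V | `|x| <= j].
have cB : compact B by exact: compact_norm_ball.
have /compact_bounded[M [_ HM]] : compact (f @` B).
  by apply: continuous_compact cB; exact: continuous_subspaceT.
exists (`|M| + 1) => [|x]; first by rewrite addr_ge0.
have [xB|jx] := leP `|x| j; last by rewrite Zf// normr0 addr_ge0.
apply: (HM (`|M| + 1)); last by exists x.
by rewrite (le_lt_trans (ler_norm M))// ltrDl.
Qed.

Lemma vanish_deriv_le m j f : smooth f -> vanish j f ->
  exists2 e, 0 <= e & deriv_le m e f.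
Proof.
move=> sf Zf.
suff [e e0 H] : exists2 e, 0 <= e & forall l : seq 'I_n, (size l <= m)%N ->
     forall x, `|iterD [seq delta_mx 0 i | i <- l] f x| <= e.
  exists (n.+1%:R ^+ m * e); last exact: deriv_le_basis.
  by rewrite mulr_ge0// exprn_ge0.
elim: m f sf Zf => [|m IH] f sf Zf.
  have [M M0 HM] := vanish_bounded (smooth_continuous sf) Zf.
  by exists M => // -[].
have [M M0 HM] := vanish_bounded (smooth_continuous sf) Zf.
have /choice[e he] : forall i : 'I_n, exists e, 0 <= e /\ forall l : seq 'I_n,
    (size l <= m)%N -> forall x,
    `|iterD [seq delta_mx 0 i | i <- l] ('D_(delta_mx 0 i) f) x| <= e.
  move=> i; have [e e0 He] := IH _ (smooth_derive (delta_mx 0 i) sf) (vanish_derive (delta_mx 0 i) Zf).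
  by exists e.
have se0 : 0 <= \sum_i e i by apply: sumr_ge0 => i _; have [] := he i.
exists (M + \sum_i e i); first exact: addr_ge0.
elim/last_ind => [_ x|l i _]; first by rewrite (le_trans (HM x))// lerDl.
rewrite size_rcons map_rcons => lm x; rewrite iterD_rcons.
have [ei0 /(_ l lm x) h] := he i.
rewrite (le_trans h)// (bigD1 i)//= addrCA lerDl addr_ge0// sumr_ge0// => k _.
by have [] := he k.
Qed.

End IterD.

Lemma complete_eps (R : realType) (W : completeNormedModType R) (u : nat -> W) :
  (forall e : R, 0 < e -> exists N, forall p q, (N <= p)%N -> (N <= q)%N ->
     `|u p - u q| <= e) ->
  exists l, forall e : R, 0 < e -> exists N, forall p, (N <= p)%N -> `|l - u p| <= e.
Proof.
move=> cu; have cvu : cvg (u @ \oo).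
  apply: cauchy_cvg; apply: cauchy_exP => e e0.
  have [N hN] := cu (e / 2) (divr_gt0 e0 (ltr0n _ 2)).
  exists (u N); exists N => // p Np; rewrite /= -ball_normE /=.
  by rewrite (le_lt_trans (hN _ _ (leqnn _) Np))// ltr_pdivrMr// ltr_pMr// ltr1n.
exists (lim (u @ \oo)) => e e0; have /cvgrPdist_le/(_ e e0)[N _ hN] := cvu.
by exists N => p; exact: hN.
Qed.

Section GaugeNormed.
Variables (R : realType) (Y : completeNormedModType R).

Definition norm_gauge (m : nat) (e : R) (y : Y) : Prop := `|y| <= e.

Lemma gauge_normed : gauge setT norm_gauge.
Proof.
split => //= [|m e e' x ee xe|m e e' a x y|m].
- by exists 0.
- exact: le_trans xe ee.
- rewrite /norm_gauge => xe ye; rewrite (le_trans (ler_normD _ _))// lerD//.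
  by rewrite normrZ ler_wpM2l.
- by rewrite /norm_gauge normr0.
Qed.

Lemma gauge_complete_normed : gauge_complete setT norm_gauge.
Proof.
move=> y _ cy; have [l hl] := @complete_eps R Y y (fun e => cy 0%N e).
by exists l => // m e; exact: hl.
Qed.

Lemma gauge_separable_normed (d : nat -> Y) : dense_seq d ->
  gauge_separable setT norm_gauge.
Proof.
move=> dd m e e0; exists (range d); split=> // [|x _].
  by apply: (@sub_countable _ _ _ [set: nat]); [exact: card_image_le|exact: countableP].
by have [k hk] := dd x e e0; exists (d k); [exists k|exact: ltW].
Qed.

End GaugeNormed.

(** The coordinates are rounded down on a grid of mesh 1/(N+1) <= d. Outside the ball [inord] yields
    a cell without significance. *)
Lemma grid_cells (R : realType) n (j d : R) : 0 < d ->
  exists (C : finType) (kappa : 'rV[R]_n -> C), forall x x',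
    `|x| <= j -> `|x'| <= j -> kappa x = kappa x' -> `|x - x'| <= d.
Proof.
move=> d0; have [N /(_ N (leqnn _)) hN] := invS_le d0.
have N0 : 0 < N.+1%:R :> R by rewrite ltr0n.
pose c (t : R) := Num.truncn ((t + j) * N.+1%:R).
pose M := Num.truncn ((j + j) * N.+1%:R).
exists {ffun 'I_n -> 'I_M.+1}, (fun x => [ffun i => inord (c (x 0 i))]).
have cM (x : 'rV[R]_n) i : `|x| <= j ->
    [/\ (c (x 0%R i) < M.+1)%N, (c (x 0 i))%:R <= (x 0 i + j) * N.+1%:R &
     (x 0 i + j) * N.+1%:R < (c (x 0 i)).+1%:R].
  move=> xj; have := le_trans (coord_norm x i) xj; rewrite ler_norml => /andP[h1 h2].
  have p0 : 0 <= (x 0 i + j) * N.+1%:R by rewrite mulr_ge0//; lra.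
  have /andP[h3 h4] := truncn_itv p0; split=> //.
  by rewrite ltnS; apply: le_truncn; rewrite ler_pM2r//; lra.
move=> x x' xj x'j E; apply: norm_row_le => [|i]; first exact: ltW.
have [h1 h2 h3] := cM x i xj; have [h1' h2' h3'] := cM x' i x'j.
move: E => /ffunP/(_ i); rewrite !ffunE => /(congr1 val); rewrite /= !inordK// => E.
rewrite !mxE (le_trans _ hN)//.
rewrite -[leRHS]mul1r ler_pdivlMr// -[X in _ * X](gtr0_norm N0) -normrM.
rewrite -E -natr1 in h2' h3'; rewrite -[(c _).+1%:R]natr1 in h3.
by rewrite ler_norml; apply/andP; split; lra.
Qed.

Section TestFunctions.
Variables (R : realType) (n : nat) (Y : normedModType R) (j : R).
Local Notation V := 'rV[R]_n.
Local Notation X := (testfun n Y).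

Lemma testfun_smooth (f : X) : smooth f.
Proof. by case: f => f /= /asboolP[]. Qed.

Lemma testfun_vanish (f : X) : exists j0 : R, vanish j0 f.
Proof.
case: f => f /= /asboolP[_ /compact_bounded[M [_ HM]]].
exists (M + 1) => x jx; apply: suppN => sx.
have := HM (M + 1); rewrite ltrDl ltr01 => /(_ isT _ sx) /=.
by rewrite leNgt jx.
Qed.

Lemma testfunP (f : V -> Y) : smooth f -> vanish j f -> testfun_pred f.
Proof.
move=> sf Zf; apply/asboolP; split => //.
apply: (@supp_sub _ _ _ [set x : V | `|x| <= j] f) => [|x /negP].
  exact: compact_norm_ball.
by rewrite -ltNge; exact: Zf.
Qed.

End TestFunctions.

Section GaugeTest.
Variables (R : realType) (n : nat) (Y : completeNormedModType R) (j : R).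
Local Notation V := 'rV[R]_n.
Local Notation X := (testfun n Y).

Variable Lam : set (X -> R).
Hypothesis Lam_lin : forall l, Lam l -> forall a f g, l (a *: f + g) = a * l f + l g.
Hypothesis Lam_bound : forall l, Lam l -> exists C : R, forall f : X, forall e,
  vanish j f -> deriv_le 0 e f -> `|l f| <= C * e.

(** A closed subspace of D_K, where K is the ball of radius j, because the functionals in [Lam] are
    bounded by the sup norm. They will be the moments of order at most k. *)
Definition test_subspace : set X := [set f : X | vanish j f /\ forall l, Lam l -> l f = 0].
Definition test_seminorm_le (m : nat) (e : R) (f : X) := deriv_le m e f.

Lemma gauge_test : gauge test_subspace test_seminorm_le.
Proof.
split=> [a f g [Zf Lf] [Zg Lg]||m p e f|m e e' f|m e e' a f g Pf Pg|m].
- split=> [x jx|l Ll]; first by rewrite /= !fctE Zf// Zg// scaler0 addr0.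
  by rewrite Lam_lin// Lf// Lg// mulr0 addr0.
- exists 0; split=> // l Ll.
  by have := Lam_lin Ll (-1) 0 0; rewrite scaleN1r addNr mulN1r addNr.
- exact: deriv_le_homo.
- exact: deriv_le_le.
- exact (deriv_le_lin a (testfun_smooth f) (testfun_smooth g) Pf Pg).
- by move=> s _ _ x; rewrite /= iterD0 normr0.
Qed.

(** For every list s of directions the derivatives [iterD s (y p)] converge uniformly to a function
    G(s, .). By [differentiable_uniform_limit] the derivative of G(s, .) along v is G(v :: s, .);
    hence G([::], .) is smooth and its derivatives are the limits. *)
Lemma gauge_complete_test : gauge_complete test_subspace test_seminorm_le.
Proof.
move=> y Sy cy.
have sy p : smooth (y p) := testfun_smooth (y p).
have iB s p q x : iterD s (y p) x - iterD s (y q) x = iterD s (y p - y q : X) x.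
  have := congr1 (fun h => h x) (iterDB s (sy p) (sy q)).
  by move=> /= ->.
have cs s (e : R) : 0 < e -> exists N, forall p q, (N <= p)%N -> (N <= q)%N ->
    forall x, `|iterD s (y p) x - iterD s (y q) x| <= e.
  move=> e0; set C := \prod_(v <- s) (enorm v + 1).
  have C0 : 0 < C by apply: prodr_gt0 => v _; rewrite ltr_wpDl// enorm_ge0.
  have [N hN] := cy (size s) (e / C) (divr_gt0 e0 C0).
  exists N => p q Np Nq x; rewrite iB.
  have := iterD_le x (testfun_smooth (y p - y q)) (hN p q Np Nq).
  by rewrite -/C mulrC divfK// gt_eqF.
have /choice[G hG] : forall sx : seq V * V, exists l, forall e : R, 0 < e ->
    exists N, forall p, (N <= p)%N -> `|l - iterD sx.1 (y p) sx.2| <= e.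
  move=> [s x]; apply: complete_eps => e /(cs s)[N hN].
  by exists N => p q Np Nq; exact: hN.
have Gle s x q (e : R) N : (forall p, (N <= p)%N ->
    `|iterD s (y p) x - iterD s (y q) x| <= e) -> `|G (s, x) - iterD s (y q) x| <= e.
  move=> H; apply/ler_addgt0Pr => t t0; have [M hM] := hG (s, x) t t0.
  have h1 := hM (maxn N M) (leq_maxr _ _); have h2 := H (maxn N M) (leq_maxl _ _).
  by have := ler_distD (iterD s (y (maxn N M)) x) (G (s, x)) (iterD s (y q) x); lra.
have DG s x : differentiable (fun x => G (s, x)) x /\
    forall v, derive (fun x => G (s, x)) x v = G (v :: s, x).
  apply: (@differentiable_uniform_limit R V Y (fun p => iterD s (y p)) _
      (fun v x => G (v :: s, x))).
  - by move=> p z; exact/smooth_diff/smooth_iterD.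
  - by move=> z e e0; exact: (hG (s, z)).
  (* With v = |v| u and |u| = 1, the direction u contributes the factor |u| + 1 = 2 in [iterD_le],
     and n + 1 compares the Euclidean norm of v with its sup norm. *)
  move=> e e0; pose C := (\prod_(v <- s) (enorm v + 1)) * (2 * n.+1%:R) : R.
  have C0 : 0 < C.
    by rewrite mulr_gt0 ?mulr_gt0//; apply: prodr_gt0 => v _; rewrite ltr_wpDl// enorm_ge0.
  have [N hN] := cy (size s).+1 (e / C) (divr_gt0 e0 C0).
  exists N => p Np v z; apply: (Gle (v :: s) z p _ N) => q Nq; rewrite iB.
  set h : X := y q - y p; have hh := hN q p Nq Np.
  have sh := smooth_iterD s (testfun_smooth h).
  have [->|v0] := eqVneq v 0.
    by rewrite /= derive0 !normr0 mulr0.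
  have dv : 0 < enorm v by apply: lt_le_trans (norm_le_enorm _); rewrite normr_gt0.
  pose u := (enorm v)^-1 *: v.
  have uE : v = enorm v *: u by rewrite scalerA mulfV ?gt_eqF// scale1r.
  have u1 : enorm u = 1 by rewrite enormZ gtr0_norm ?invr_gt0// mulVf ?gt_eqF.
  have -> : iterD (v :: s) h z = enorm v *: iterD (u :: s) h z.
    have dz := smooth_diff z sh.
    by rewrite /= (deriveE _ dz) [in RHS](deriveE _ dz) -linearZ -uE.
  rewrite normrZ gtr0_norm//.
  have := iterD_le (s := u :: s) z (testfun_smooth h) hh.
  rewrite big_cons u1 => hi.
  have h2 := enorm_le_norm v.
  apply: le_trans (ler_pM (ltW dv) (normr_ge0 _) h2 hi) _.
  rewrite le_eqVlt; apply/orP; left; apply/eqP; rewrite /C.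
  have Q0 : \prod_(v <- s) (enorm v + 1) != 0 :> R.
    by rewrite gt_eqF//; apply: prodr_gt0 => w _; rewrite ltr_wpDl// enorm_ge0.
  have n0 : n.+1%:R != 0 :> R by rewrite pnatr_eq0.
  move: Q0 n0; set Q := \prod_(v <- s) _; set k := n.+1%:R => Q0 n0.
  by field; apply/andP.
have CG m s : Ck m (fun x => G (s, x)).
  elim: m s => [|m IH] s /=.
    by move=> x; have [/differentiable_continuous] := DG s x.
  split=> [x|v]; first by have [] := DG s x.
  rewrite (_ : 'D_v _ = fun x => G (v :: s, x)); first exact: IH.
  by apply/funext => x; have [_ ->] := DG s x.
have DGs s : iterD s (fun x => G ([::], x)) = fun x => G (s, x).
  elim: s => //= v s ->.
  by apply/funext => x; have [_ ->] := DG s x.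
have ZG : vanish j (fun x => G ([::], x)).
  move=> x jx; apply/eqP; rewrite -normr_eq0 eq_le normr_ge0 andbT.
  apply/ler_addgt0Pr => e e0; rewrite add0r.
  have [N /(_ N (leqnn _))] := hG ([::], x) e e0.
  by rewrite /= (Sy N).1// subr0.
pose f : X := TestFun (testfunP (fun m => CG m [::]) ZG).
have fy m (e : R) : 0 < e -> exists N, forall p, (N <= p)%N -> test_seminorm_le m e (f - y p).
  move=> e0; have [N hN] := cy m e e0; exists N => p Np s sm s1 x.
  have -> : iterD s (f - y p : X) x = G (s, x) - iterD s (y p) x.
    have := congr1 (fun h => h x) (iterDB s (testfun_smooth f) (sy p)).
    by rewrite /= DGs => ->.
  apply: (Gle _ _ _ _ N) => q Nq; rewrite iB.
  exact: (hN q p Nq Np s sm s1).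
exists f => //; split=> // l Ll.
have [C HC] := Lam_bound Ll.
apply/eqP; rewrite -normr_eq0 eq_le normr_ge0 andbT.
apply/ler_addgt0Pr => e e0; rewrite add0r.
have C0 : 0 < `|C| + 1 by rewrite ltr_wpDl.
have [N /(_ N (leqnn _)) hN] := fy 0%N (e / (`|C| + 1)) (divr_gt0 e0 C0).
have -> : l f = l (f - y N).
  by rewrite addrC -scaleN1r Lam_lin// (Sy N).2// mulr0 add0r.
have Z : vanish j (f - y N : X).
  by move=> x jx; rewrite /= !fctE ZG// (Sy N).1// subr0.
rewrite (le_trans (HC _ _ Z hN))// mulrA ler_pdivrMr// mulrC ler_wpM2l ?(ltW e0)//.
by rewrite (le_trans (ler_norm C))// lerDl.
Qed.

(* Up to a prescribed error in the first m derivatives, a test function is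
   determined by approximate values of these derivatives on the cells of a fine
   grid, and for the approximate values there are countably many choices. *)
Lemma gauge_separable_test (d : nat -> Y) : dense_seq d ->
  gauge_separable test_subspace test_seminorm_le.
Proof.
move=> dd m e e0.
have c0 : 0 < n.+1%:R ^+ m * 2 :> R by rewrite mulr_gt0// exprn_gt0.
(* Two functions with the same approximate values differ by at most 2 eps in each coordinate
   derivative, and [deriv_le_basis] costs the factor (n+1)^m. *)
pose eps := e / (n.+1%:R ^+ m * 2).
have eps0 : 0 < eps by rewrite divr_gt0.
pose del (N : nat) : R := N.+1%:R^-1.
have del0 N : 0 < del N by rewrite invr_gt0.
pose db (l : seq 'I_n) : seq V := [seq delta_mx 0 i | i <- l].
have /choice[D hD] : forall N : nat, exists D : set X,
    [/\ countable D, D `<=` test_subspace & forall f : X, test_subspace f ->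
      (forall (l : seq 'I_n) x y, (size l <= m)%N -> `|x - y| <= del N ->
          `|iterD (db l) f x - iterD (db l) f y| <= eps / 2) ->
      exists2 g, D g & test_seminorm_le m e (f - g)].
  move=> N; have [C [kappa hk]] := grid_cells n j (del0 N).
  (* A code assigns to each list of at most m coordinate directions and each cell the number of a
     point of the dense sequence; D contains one function from every nonempty class [Sel tau]. *)
  pose T := {ffun m.-bseq 'I_n * C -> nat}.
  pose Sel (tau : T) := [set f : X | test_subspace f /\ forall (l : m.-bseq 'I_n) x,
     `|x| <= j -> `|iterD (db l) f x - d (tau (l, kappa x))| <= eps].
  pose D := (fun tau => xget 0 (Sel tau)) @` [set tau | Sel tau !=set0].
  have DS tau : Sel tau !=set0 -> Sel tau (xget 0 (Sel tau)).
    by move=> [f Sf]; apply: (@xgetPex _ 0 (Sel tau)); exists f.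
  exists D; split.
  - apply: (@sub_countable _ _ _ [set tau | Sel tau !=set0]).
      exact: card_image_le.
    exact: countableP.
  - by move=> _ [tau /= /DS[Sf _] <-].
  move=> f Sf uf.
  have /choice[tau htau] : forall lc : m.-bseq 'I_n * C, exists k, forall x,
      `|x| <= j -> kappa x = lc.2 -> `|iterD (db lc.1) f x - d k| <= eps.
    move=> [l c].
    have [[x0 [x0j x0c]]|nx] := pselect (exists x, `|x| <= j /\ kappa x = c); last first.
      by exists 0%N => x xj xc; exfalso; apply: nx; exists x.
    have [k hk'] := dd (iterD (db l) f x0) (eps / 2) (divr_gt0 eps0 (ltr0n _ 2)).
    exists k => x xj /= xc.
    have h1 := uf l x x0 (size_bseq l) (hk _ _ xj x0j (etrans xc (esym x0c))).
    by have := ler_distD (iterD (db l) f x0) (iterD (db l) f x) (d k); lra.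
  pose t : T := [ffun lc => tau lc].
  have St : Sel t f.
    by split=> // l x xj; rewrite ffunE; exact: (htau (l, kappa x)).
  have [[Zg Lg] Sg] := DS t (ex_intro _ f St).
  set g := xget 0 (Sel t) in Zg Lg Sg.
  exists g; first by exists t => //; exists f.
  have -> : e = n.+1%:R ^+ m * (eps * 2).
    by rewrite /eps; move: c0; set q := n.+1%:R ^+ m => c0; field; lra.
  apply: deriv_le_basis; first exact: (testfun_smooth (f - g)).
  move=> l lm x.
  have -> : iterD (db l) (f - g : X) x = iterD (db l) f x - iterD (db l) g x.
    have := congr1 (fun h => h x) (iterDB (db l) (testfun_smooth f) (testfun_smooth g)).
    by [].
  have [xj|jx] := leP `|x| j; last first.
    rewrite (vanish_iterD _ Sf.1)// (vanish_iterD _ Zg)// subrr normr0.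
    by rewrite mulr_ge0// ltW.
  pose b : m.-bseq 'I_n := Bseq lm.
  have h1 := Sg b x xj; have h2 := St.2 b x xj.
  by have := ler_distD (d (t (b, kappa x))) (iterD (db b) f x) (iterD (db b) g x);
    rewrite (distrC (d _)) /=; lra.
exists (\bigcup_N D N); split.
- by apply: bigcup_countable => // N _; have [] := hD N.
- by move=> f [N _]; have [_ + _] := hD N; exact.
(* The bound on the derivatives of order m + 1 makes those up to order m Lipschitz, so on a grid of
   some mesh they oscillate by at most eps / 2 in each cell. *)
- move=> f Sf; have [B B0 hB] := vanish_deriv_le m.+1 (testfun_smooth f) Sf.1.
  have q0 : 0 < n.+1%:R * B + 1 by rewrite ltr_wpDl// mulr_ge0.
  have e20 : 0 < eps / 2 / (n.+1%:R * B + 1) by rewrite !divr_gt0.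
  have [N hN] := invS_le e20.
  have [_ _ /(_ f Sf)[|g Dg Pg]] := hD N; last by exists g => //; exists N.
  move=> l x y lm xy.
  have := deriv_le_lipschitz x y (testfun_smooth f) hB (s := db l).
  rewrite size_map => /(_ lm) H.
  apply: (le_trans (H _)) => [v /mapP[i _ ->]|]; first by rewrite enorm_delta.
  apply: (@le_trans _ _ ((n.+1%:R * B + 1) * del N)).
    by rewrite ler_pM// ?mulr_ge0// lerDl.
  by rewrite mulrC -ler_pdivlMr// hN.
Qed.

End GaugeTest.

(** * Integration over R^n *)

Section LebesgueTuple.
Variable R : realType.
Local Notation mR := (measurableTypeR R).
Local Notation mu n := (lebesgue_tuple R n).
Local Notation lam := (@lebesgue_measure R).

Definition cube n (j : R) : set (n.-tuple mR) := [set t | forall i, `|tnth t i| <= j].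

Arguments cube : clear implicits.

Lemma measurable_norm_le (j : R) : measurable ([set x | `|x| <= j] : set mR).
Proof.
rewrite (_ : [set x | _] = [set` `[- j, j]]) ?measurable_itv//.
by apply/seteqP; split => x /=; rewrite in_itv /= ler_norml.
Qed.

Lemma measurable_cube n j : measurable (cube n j).
Proof.
rewrite (_ : cube n j = \bigcap_(i : 'I_n)
    ((fun t : n.-tuple mR => tnth t i) @^-1` [set x | `|x| <= j])).
  apply: countable_bigcap_measurable => [|i _]; first exact: countableP.
  rewrite -[X in measurable X]setTI; apply: (measurable_tnth i) => //.
  exact: measurable_norm_le.
apply/seteqP; split => t ht i; first by move=> _; exact: ht.
exact: (ht i Logic.I).
Qed.

Lemma tcons_cube n j :
  @tcons R n @^-1` cube n.+1 j = cube n j `*` [set x | `|x| <= j].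
Proof.
apply/seteqP; split => -[t x] /= h.
  split => [i|]; last exact: (h ord0).
  by have := h (lift ord0 i); rewrite tnthS.
case: h => h1 h2 i; case: (unliftP ord0 i) => [k|] -> //.
by rewrite tnthS; exact: h1.
Qed.

Lemma lebesgue_norm_le_lty (j : R) : (lam [set x : R | (`|x| <= j)%R] < +oo)%E.
Proof.
have -> : [set x : R | `|x| <= j] = [set` `[- j, j]].
  by apply/seteqP; split => x /=; rewrite in_itv /= ler_norml.
by rewrite lebesgue_measure_itv /=; case: ifPn => // _; rewrite -EFinD ltry.
Qed.

Lemma lebesgue_tuple_cube_lty n j : (mu n (cube n j) < +oo)%E.
Proof.
elim: n => [|n IH].
  by rewrite /= /dirac /= indicE ltry.
rewrite lebesgue_tupleS /pushforward tcons_cube.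
have mc := @measurable_cube n j; have mj := measurable_norm_le j.
have -> := @product_measure1E _ _ _ _ R (mu n) lebesgue_measure _ _ mc mj.
rewrite lte_mul_pinfty// ?ge0_fin_numE//.
exact: lebesgue_norm_le_lty.
Qed.

Lemma sigma_finite_lebesgue_tuple n : sigma_finite setT (mu n).
Proof.
exists (fun j : nat => cube n j%:R); last first.
  by move=> j; split; [exact: measurable_cube|exact: lebesgue_tuple_cube_lty].
apply/seteqP; split => // t _.
pose M := \sum_i `|tnth t i|.
exists (Num.bound M) => // i; apply: (@le_trans _ _ M).
  by rewrite /M (bigD1 i)//= lerDl sumr_ge0.
by rewrite ltW// archi_boundP// sumr_ge0.
Qed.

(* A copy of [lebesgue_tuple] that carries the structure of a sigma-finite
   measure, as Fubini's theorem requires. *)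
Definition sigma_finite_mu n : set (n.-tuple mR) -> \bar R := mu n.

HB.instance Definition _ n := Measure.copy (@sigma_finite_mu n) (mu n).
HB.instance Definition _ n := Measure_isSigmaFinite.Build _ _ _
  (@sigma_finite_mu n) (sigma_finite_lebesgue_tuple n).

Local Open Scope ereal_scope.

Lemma measurable_tuple_section n (G : n.+1.-tuple mR -> \bar R) :
  measurable_fun [set: n.+1.-tuple mR] G -> (forall t, 0 <= G t) ->
  measurable_fun [set: n.-tuple mR] (fun t => \int[lam]_x G [tuple of x :: t]).
Proof.
move=> mG G0.
apply: (@measurable_fun_fubini_tonelli_F _ _ _ _ _ lam (fun p : n.-tuple mR * mR => G (tcons p))) => //.
by apply: measurableT_comp => //; exact: measurable_tcons.
Qed.

Lemma tonelli_tuple n (G : n.+1.-tuple mR -> \bar R) :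
  measurable_fun [set: n.+1.-tuple mR] G -> (forall t, 0 <= G t) ->
  \int[mu n.+1]_t G t = \int[mu n]_t \int[lam]_x G [tuple of x :: t].
Proof.
move=> mG G0.
rewrite [LHS]/= ge0_integral_pushforward//; last exact: measurable_tcons.
rewrite preimage_setT.
apply: (@fubini_tonelli1 _ _ _ _ R (@sigma_finite_mu n) lam (fun p : n.-tuple mR * mR => G (tcons p))) => //.
by apply: measurableT_comp => //; exact: measurable_tcons.
Qed.

End LebesgueTuple.
Arguments cube {R} n j.

Section Affine.
Variable R : realType.
Local Notation mR := (measurableTypeR R).
Local Notation mu n := (lebesgue_tuple R n).
Local Notation lam := (@lebesgue_measure R).
Local Open Scope ereal_scope.

Lemma measurable_affine (a r : R) :
  measurable_fun [set: mR] ((fun x => a + r * x)%R : mR -> mR).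
Proof. by apply: measurable_funD => //; exact: measurable_funM. Qed.

(** The image of Lebesgue measure under the affine map, multiplied by r, agrees with Lebesgue
    measure on half-open intervals, hence everywhere. *)
Lemma lebesgue_measure_affine (a r : R) (r0 : (0 < r)%R) (A : set mR) :
  measurable A ->
  lam A = r%:E * lam ((fun x => a + r * x)%R @^-1` A).
Proof.
pose phi : mR -> mR := fun x => (a + r * x)%R.
have mphi : measurable_fun [set: mR] phi := measurable_affine a r.
pose m : {measure set mR -> \bar R} :=
  mscale (NngNum (ltW r0)) (measure_function_pushforward__canonical__measure_function_Measure lam mphi).
move=> mA; have -> := lebesgue_measure_unique (mu := m) _ mA; first by [].
move=> _ [[u v]] _ <-; rewrite /m.
have pE : phi @^-1` `]u, v]%classic = `]((u - a) / r)%R, ((v - a) / r)%R]%classic.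
  apply/seteqP; split => x /=; rewrite !in_itv /= /phi;
    by rewrite ltr_pdivrMr// ler_pdivlMr// ltrBlDl lerBrDl [(x * r)%R]mulrC.
transitivity (r%:E * lam (phi @^-1` `]u, v]%classic)); last by [].
rewrite pE !lebesgue_measure_itv /= !lte_fin ltr_pM2r ?invr_gt0// ltrD2r.
case: ifPn => _; last by rewrite mule0.
rewrite -!EFinD -EFinM; congr EFin.
by rewrite -mulrBl mulrC divfK ?gt_eqF//; lra.
Qed.

Lemma ge0_integral_affine (a r : R) (r0 : (0 < r)%R) (G : mR -> \bar R) :
  measurable_fun [set: mR] G -> (forall x, 0 <= G x) ->
  \int[lam]_x G x = r%:E * \int[lam]_x G (a + r * x)%R.
Proof.
move=> mG G0; pose phi : mR -> mR := fun x => (a + r * x)%R.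
have mphi : measurable_fun [set: mR] phi := measurable_affine a r.
pose p : {measure set mR -> \bar R} :=
  measure_function_pushforward__canonical__measure_function_Measure lam mphi.
transitivity (\int[mscale (NngNum (ltW r0)) p]_x G x).
  apply: eq_measure_integral => A mA _.
  exact (lebesgue_measure_affine a r0 mA).
rewrite ge0_integral_mscale//; congr (_ * _).
by rewrite ge0_integral_pushforward// preimage_setT.
Qed.

Definition tuple_affine n (a : 'I_n -> R) (r : R) (t : n.-tuple mR) : n.-tuple mR :=
  [tuple (a i + r * tnth t i)%R | i < n].

Lemma measurable_tuple_affine n (a : 'I_n -> R) r :
  measurable_fun [set: n.-tuple mR] (tuple_affine a r).
Proof.
apply/measurable_fun_tnthP => i.
rewrite (_ : _ \o _ = (fun x : mR => a i + r * x)%R \o (fun t => tnth t i)).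
  exact: (measurableT_comp (measurable_affine (a i) r) (measurable_tnth i)).
by apply/funext => t; rewrite /= tnth_mktuple.
Qed.

Lemma ge0_integral_tuple_affine n (a : 'I_n -> R) (r : R) (G : n.-tuple mR -> \bar R) :
  (0 < r)%R -> measurable_fun [set: n.-tuple mR] G -> (forall t, 0 <= G t) ->
  \int[mu n]_t G t = (r ^+ n)%:E * \int[mu n]_t G (tuple_affine a r t).
Proof.
move=> r0; elim: n a G => [|n IH] a G mG G0.
  rewrite expr0 mul1e; apply: eq_integral => t _; congr G.
  by rewrite (tuple0 t) (tuple0 (tuple_affine _ _ _)).
have mGt : measurable_fun [set: n.+1.-tuple mR] (G \o tuple_affine a r).
  by apply: measurableT_comp => //; exact: measurable_tuple_affine.
rewrite tonelli_tuple// [in RHS](tonelli_tuple mGt (fun t => G0 (tuple_affine a r t))).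
pose H (t : n.-tuple mR) := \int[lam]_x G [tuple of x :: t].
have mH : measurable_fun [set: n.-tuple mR] H by exact: measurable_tuple_section.
have H0 (t : n.-tuple mR) : 0 <= H t by exact: integral_ge0.
rewrite -/(H _) (IH (fun i => a (lift ord0 i)) H mH H0).
rewrite exprSr EFinM -muleA; congr (_ * _).
have tE (t : n.-tuple mR) x : tuple_affine a r [tuple of x :: t] =
    [tuple of (a ord0 + r * x)%R :: tuple_affine (fun i => a (lift ord0 i)) r t].
  apply: eq_from_tnth => i; rewrite tnth_mktuple.
  by case: (unliftP ord0 i) => [k|] ->; rewrite ?tnthS ?tnth_mktuple ?tnth0.
have r0' : 0 <= r%:E by rewrite lee_fin ltW.
have mS := @measurable_tuple_section R n _ mGt (fun t => G0 (tuple_affine a r t)).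
have S0 (t : n.-tuple mR) : setT t -> 0 <= \int[lam]_x (G \o tuple_affine a r) [tuple of x :: t].
  by move=> _; apply: integral_ge0 => x _; exact: G0.
rewrite -(ge0_integralZl (mu n) measurableT mS S0 r0').
apply: eq_integral => t _ /=; rewrite /H.
have mGx : measurable_fun [set: mR]
    (fun x : mR => G [tuple of x :: tuple_affine (fun i => a (lift ord0 i)) r t]).
  by apply: measurableT_comp => //; exact: measurable_cons.
rewrite (ge0_integral_affine (a ord0) r0 mGx (fun x => G0 _)).
by congr (_ * _); apply: eq_integral => x _; rewrite tE.
Qed.

End Affine.

Section CompactIntegral.
Variable R : realType.
Local Notation mR := (measurableTypeR R).
Local Notation mu n := (lebesgue_tuple R n).
Local Notation lam := (@lebesgue_measure R).

Definition rowt n (t : n.-tuple mR) : 'rV[R]_n := \row_i tnth t i.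

Lemma norm_rowt n (t : n.-tuple mR) (j : R) : 0 <= j -> `|rowt t| <= j -> cube n j t.
Proof. by move=> j0 h i; have := le_trans (coord_norm _ i) h; rewrite mxE. Qed.

(** Connects the topology of row vectors with the product sigma-algebra of tuples: an open set is a
    countable union of boxes with rational centres and half-width 1/(N+1). *)
Lemma measurable_rowt_open n (U : set 'rV[R]_n) :
  open U -> measurable (@rowt n @^-1` U).
Proof.
move=> oU.
pose rad (N : nat) : R := N.+1%:R^-1.
have rad0 N : 0 < rad N by rewrite invr_gt0.
pose box (qN : {ffun 'I_n -> rat} * nat) : set 'rV[R]_n :=
  [set v | forall i, `|v 0 i - ratr (qN.1 i)| < rad qN.2].
rewrite (_ : _ @^-1` U = \bigcup_(qN in [set qN | box qN `<=` U])
   \bigcap_i ((fun t : n.-tuple mR => tnth t i) @^-1`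
      [set x | `|x - ratr (qN.1 i)| < rad qN.2])).
  apply: countable_bigcup_measurable; first exact: countableP.
  move=> [q N] _; apply: countable_bigcap_measurable; first exact: countableP.
  move=> i _; rewrite -[X in measurable X]setTI; apply: (measurable_tnth i) => //.
  rewrite (_ : [set x | _] = `]ratr (q i) - rad N, ratr (q i) + rad N[%classic).
    exact: measurable_itv.
  by apply/seteqP; split=> x /=; rewrite in_itv /= ltr_distl.
apply/seteqP; split => [t Ut|t [[q N] /= bU ht]]; last first.
  by apply: bU => i; rewrite mxE; exact: ht.
have /nbhs_ballP[e /= e0 eU] : nbhs (rowt t) U by exact: open_nbhs_nbhs.
have [N /(_ N (leqnn _)) hN] := invS_le (divr_gt0 e0 (ltr0n R 2)).
have /choice[q hq] : forall i, exists q : rat, `|rowt t 0 i - ratr q| < rad N.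
  move=> i; have [|q] := @rat_in_itvoo R (rowt t 0 i - rad N) (rowt t 0 i + rad N).
    by have := rad0 N; lra.
  by rewrite in_itv /= -ltr_distl distrC; exists q.
exists ([ffun i => q i], N); last first.
  by move=> i _ /=; rewrite ffunE; have := hq i; rewrite mxE.
move=> w /= hw; apply: eU; rewrite -ball_normE /=; apply: norm_row_lt => // i.
have := hw i; rewrite ffunE => h1; have h2 := hq i.
rewrite [(_ - w) 0 i]mxE [(- w) 0 i]mxE.
have := ler_distD (ratr (q i)) (rowt t 0 i) (w 0 i).
by rewrite (distrC (ratr _) (w 0 i)); rewrite -/(rad N) in hN; lra.
Qed.

Lemma measurable_rowt n (g : 'rV[R]_n -> R) : continuous g ->
  measurable_fun [set: n.-tuple mR] (g \o @rowt n).
Proof.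
move=> cg; apply: (measurability _ (RGenOpens.measurableE R)).
move=> _ [_ [a [b ->]] <-]; rewrite setTI comp_preimage.
by apply: measurable_rowt_open; apply: open_comp => [x _|]; [exact: cg|exact: interval_open].
Qed.

Lemma integrable_bounded_restrict d (T : measurableType d) (m : {measure set T -> \bar R})
    (A : set T) (f : T -> R) (M : R) :
  measurable A -> (m A < +oo)%E -> measurable_fun setT f ->
  (forall t, `|f t| <= M) -> (forall t, ~ A t -> f t = 0) ->
  m.-integrable setT (EFin \o f).
Proof.
move=> mA mA_fin mf fM fA.
have -> : EFin \o f = (EFin \o f) \_ A.
  apply/funext => t; rewrite /patch; case: ifPn => // /negP tA.
  by rewrite /= fA// => At; apply: tA; rewrite inE.
apply/(integrable_mkcond _ mA); apply: measurable_bounded_integrable => //.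
  exact: measurable_funTS.
exists M; split; first exact: num_real.
by move=> M' MM' t _; exact: le_trans (fM t) (ltW MM').
Qed.

Lemma integrable_rowt n j (g : 'rV[R]_n -> R) : continuous g -> vanish j g ->
  (mu n).-integrable setT (EFin \o (g \o @rowt n)).
Proof.
move=> cg Zg; have [M M0 gM] := vanish_bounded cg Zg.
apply: (@integrable_bounded_restrict _ _ _ (cube n `|j|) _ M) => //.
- exact: measurable_cube.
- exact: lebesgue_tuple_cube_lty.
- exact: measurable_rowt.
- by move=> t; exact: gM.
- move=> t nt; apply: Zg; rewrite ltNge; apply/negP => tj; apply: nt.
  by apply: norm_rowt => //; rewrite (le_trans tj)// ler_norm.
Qed.

Lemma integrable_line j (g : R -> R) : continuous g ->
  (forall x, j < `|x| -> g x = 0) -> lam.-integrable setT (EFin \o g).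
Proof.
move=> cg Zg.
have [M gM] : exists M, forall x, `|g x| <= M.
  have : compact (g @` [set` `[- j, j]]).
    apply: continuous_compact; last exact: segment_compact.
    exact: continuous_subspaceT.
  move=> /compact_bounded[M [_ HM]]; exists (`|M| + 1) => x.
  have [xj|jx] := leP `|x| j; last by rewrite Zg// normr0 addr_ge0.
  apply: (HM (`|M| + 1)); last by exists x => //=; rewrite in_itv /= -ler_norml.
  by rewrite (le_lt_trans (ler_norm M))// ltrDl.
apply: (@integrable_bounded_restrict _ mR lam [set x | (`|x| <= j)%R] g M) => //.
- exact: measurable_norm_le.
- exact: lebesgue_norm_le_lty.
- exact: continuous_measurable_fun.
- by move=> x /negP; rewrite -ltNge; exact: Zg.
Qed.

Local Open Scope ereal_scope.

Lemma fubini_tuple n (f : n.+1.-tuple mR -> R) :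
  (mu n.+1).-integrable setT (EFin \o f) ->
  \int[mu n.+1]_t (f t)%:E = \int[mu n]_t \int[lam]_x (f [tuple of x :: t])%:E.
Proof.
move=> intf; have mf : measurable_fun [set: n.+1.-tuple mR] (EFin \o f).
  exact: measurable_int intf.
have mg : measurable_fun [set: n.-tuple mR * mR] ((EFin \o f) \o @tcons R n).
  by apply: measurableT_comp => //; exact: measurable_tcons.
have intg : (@sigma_finite_mu R n \x lam).-integrable setT ((EFin \o f) \o @tcons R n).
  apply/integrableP; split => //.
  have /integrableP[_ oo] := intf; apply: le_lt_trans oo.
  have mf' : measurable_fun [set: n.+1.-tuple mR] (abse \o (EFin \o f)).
    exact: measurableT_comp.
  have E := ge0_integral_pushforward (@measurable_tcons R n)
    (@sigma_finite_mu R n \x lam) measurableT mf' (fun t _ => abse_ge0 _).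
  by rewrite preimage_setT in E; rewrite -E.
transitivity (\int[@sigma_finite_mu R n \x lam]_p (((EFin \o f) \o @tcons R n) p)).
  by rewrite [LHS]/= integral_pushforward//; exact: measurable_tcons.
by rewrite -(integral12_prod_meas1 intg).
Qed.

Local Close Scope ereal_scope.

Lemma continuous_prod (T : topologicalType) (I : Type) (r : seq I) (f : I -> T -> R) :
  (forall i, continuous (f i)) -> continuous (fun x => \prod_(i <- r) f i x).
Proof.
move=> cf; elim: r => [|i r IH] x.
  rewrite (_ : (fun _ => _) = cst 1); first exact: cst_continuous.
  by apply/funext => y; rewrite big_nil.
rewrite (_ : (fun _ => _) = (f i) * (fun x => \prod_(i <- r) f i x)).
  by apply: continuousM; [exact: cf|exact: IH].
by apply/funext => y; rewrite big_cons.
Qed.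

Lemma integral_prod_coord n (j : R) (F : 'I_n -> R -> R) :
  (forall i, continuous (F i)) -> (forall i x, j < `|x| -> F i x = 0) ->
  (\int[mu n]_t (\prod_i F i (tnth t i))%:E)%E = (\prod_i \int[lam]_x F i x)%:E.
Proof.
elim: n F => [|n IH] F cF ZF.
  rewrite (eq_integral (cst 1%E)) => [|t _]; last by rewrite big_ord0.
  by rewrite big_ord0 integral_cst//= /dirac indicE mem_set// mule1.
have iF i : lam.-integrable setT (EFin \o F i) := integrable_line (cF i) (ZF i).
have main m (H : 'I_m -> R -> R) : (0 < m)%N -> (forall i, continuous (H i)) ->
    (forall i x, j < `|x| -> H i x = 0) ->
    continuous (fun v : 'rV[R]_m => \prod_i H i (v 0 i)) /\
    vanish `|j| (fun v : 'rV[R]_m => \prod_i H i (v 0 i)).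
  move=> m0 cH ZH; split.
    apply: continuous_prod => i x.
    by apply: continuous_comp; [exact: coord_continuous|exact: cH].
  move=> v jv; apply/eqP; rewrite prodf_seq_eq0.
  apply/negPn/negP => /hasPn H0; move: jv; apply/negP; rewrite -leNgt.
  apply: norm_row_le => // i; rewrite leNgt; apply/negP => jv.
  have := H0 i (mem_index_enum i); rewrite ZH ?eqxx//.
  by rewrite (le_lt_trans (ler_norm j)).
have [cg Zg] := main n.+1 F isT cF ZF.
have ig := integrable_rowt cg Zg.
set g := (fun v => _) in cg Zg ig.
have gE t : g (rowt t) = \prod_i F i (tnth t i).
  by apply: eq_bigr => i _; rewrite mxE.
rewrite (eq_integral (fun t => (g (rowt t))%:E)) => [|t _]; last by rewrite gE.
rewrite fubini_tuple//.
pose F' (i : 'I_n) := F (lift ord0 i).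
transitivity (\int[mu n]_t ((\int[lam]_x F ord0 x)%:E * (\prod_i F' i (tnth t i))%:E))%E.
  apply: eq_integral => t _.
  transitivity (\int[lam]_x ((\prod_i F' i (tnth t i))%:E * (F ord0 x)%:E))%E.
    apply: eq_integral => x _; rewrite gE big_ord_recl tnth0 -EFinM mulrC.
    by congr ((_ * _)%:E); apply: eq_bigr => i _; rewrite tnthS.
  rewrite (integralZl measurableT (iF ord0)) muleC; congr (_ * _)%E.
  by rewrite /Rintegral fineK//; exact: (integrable_fin_num measurableT (iF ord0)).
have iQ : (mu n).-integrable setT (fun t => (\prod_i F' i (tnth t i))%:E).
  have [n0|n0] := posnP n; last first.
    have [cg' Zg'] := main n F' n0 (fun i => cF _) (fun i => ZF _).
    have := integrable_rowt cg' Zg'; apply: eq_integrable => // t _ /=.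
    by congr EFin; apply: eq_bigr => i _; rewrite mxE.
  have nI (i : 'I_n) : False by case: i => i; rewrite n0.
  have Q1 (t : n.-tuple mR) : \prod_i F' i (tnth t i) = 1.
    by apply: big1 => i _; case: (nI i).
  rewrite (_ : (fun t => _) = EFin \o cst 1); last first.
    by apply/funext => t; rewrite Q1.
  apply: (@integrable_bounded_restrict _ _ _ (cube n 0) _ 1) => //.
  - exact: measurable_cube.
  - exact: lebesgue_tuple_cube_lty.
  - by move=> t; rewrite normr1.
  - by move=> t; case=> i; case: (nI i).
rewrite (integralZl measurableT iQ).
by rewrite (IH F' (fun i => cF _) (fun i => ZF _)) big_ord_recl EFinM.
Qed.

End CompactIntegral.

(** * Functionals on Y and integrals of Y-valued functions *)

Section DualBasics.
Variables (R : realType) (Y : normedModType R).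

Lemma dual_bounded_by (c : dual Y) : exists2 K, 0 <= K & forall y, `|c y| <= K * `|y|.
Proof.
pose h : {linear Y -> R^o} :=
  HB.pack (c : Y -> R^o) (GRing.isLinear.Build R Y R^o _ c (dual_linear c)).
have ch : continuous h by exact: dual_continuous.
have [K K0 hK] := linear_lipschitz ch.
by exists K; [exact: ltW|exact: hK].
Qed.

Lemma dual0 (c : dual Y) : c 0 = 0.
Proof.
have := dual_linear c 1 0 0; rewrite !scale1r addr0 => /esym/eqP.
by rewrite -subr_eq0 addrK => /eqP.
Qed.

Lemma dual_scale (c : dual Y) a x : c (a *: x) = a * c x.
Proof. by have := dual_linear c a x 0; rewrite dual0 !addr0. Qed.

Lemma dual_add (c : dual Y) x y : c (x + y) = c x + c y.
Proof. by have := dual_linear c 1 x y; rewrite !scale1r. Qed.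

Lemma dual_sub (c : dual Y) x y : c (x - y) = c x - c y.
Proof. by rewrite -scaleN1r dual_add dual_scale mulN1r. Qed.

Lemma dual_sum (c : dual Y) (I : Type) (r : seq I) (f : I -> Y) :
  c (\sum_(i <- r) f i) = \sum_(i <- r) c (f i).
Proof.
elim: r => [|i r IH]; first by rewrite !big_nil dual0.
by rewrite !big_cons dual_add IH.
Qed.

End DualBasics.

Section FiniteRange.
Variables (R : realType) (d : measure_display) (T : measurableType d).
Variable (m : {measure set T -> \bar R}) (A : set T).
Hypotheses (mA : measurable A) (A_fin : (m A < +oo)%E).

Lemma fin_mass (B : set T) : measurable B -> (m (A `&` B) < +oo)%E.
Proof.
move=> mB; apply: le_lt_trans A_fin; apply: le_measure; rewrite ?inE//.
exact: measurableI.
Qed.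

Lemma integrable_bounded_on (f : T -> R) (M : R) : measurable_fun A f ->
  (forall t, A t -> `|f t| <= M) -> m.-integrable A (EFin \o f).
Proof.
move=> mf fM; apply: measurable_bounded_integrable => //.
exists M; split; first exact: num_real.
by move=> M' MM' t At; exact: le_trans (fM t At) (ltW MM').
Qed.

Lemma Rintegral_bound (f : T -> R) (M : R) : measurable_fun A f ->
  (forall t, A t -> `|f t| <= M) -> `|\int[m]_(t in A) f t| <= M * fine (m A).
Proof.
move=> mf fM; have intf := integrable_bounded_on mf fM.
rewrite (le_trans (le_normr_Rintegral mA intf))// -Rintegral_cst//.
apply: le_Rintegral => //.
- by apply: (integrable_bounded_on (M := M)) => [|t At]; [exact: measurableT_comp|rewrite normr_id fM].
- by apply: (integrable_bounded_on (M := `|M|)) => [|t At].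
Qed.

Variables (C : finType) (kappa : T -> C).
Hypothesis mkappa : forall c, measurable (A `&` kappa @^-1` [set c]).

Lemma measurable_finite_range (h : C -> R) :
  measurable_fun A (h \o kappa).
Proof.
move=> _ B mB; rewrite (_ : _ `&` _ =
    \bigcup_(c in [set c | B (h c)]) (A `&` kappa @^-1` [set c])).
  by apply: countable_bigcup_measurable => //; exact: countableP.
apply/seteqP; split => [t [At Bt]|t [c Bc [At tc]]]; first by exists (kappa t).
by split => //=; rewrite (tc : kappa t = c).
Qed.

Lemma Rintegral_finite_range (h : C -> R) :
  \int[m]_(t in A) h (kappa t) =
  \sum_c h c * fine (m (A `&` kappa @^-1` [set c])).
Proof.
pose f c t : \bar R := ((h c)%:E * (\1_(A `&` kappa @^-1` [set c]) t)%:E)%E.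
have intI c : m.-integrable A (EFin \o \1_(A `&` kappa @^-1` [set c])).
  apply: (integrable_bounded_on (M := 1)); first exact: measurable_indic.
  by move=> t _; rewrite indicE; case: (_ \in _); rewrite ?normr1 ?normr0.
have intf c : m.-integrable A (f c) by exact: (integrableZl mA (h c) (intI c)).
rewrite /Rintegral (eq_integral (fun t => \sum_c f c t)%E); last first.
  move=> t; rewrite inE => At; rewrite (bigD1 (kappa t))//= big1 ?adde0.
    by rewrite /f indicE mem_set// mule1.
  move=> c ct; rewrite /f indicE memNset ?mule0// => -[_ /= tc].
  by rewrite tc eqxx in ct.
rewrite integral_sum//.
have E c : (\int[m]_(t in A) f c t = (h c * fine (m (A `&` kappa @^-1` [set c])))%:E)%E.
  rewrite (integralZl mA (intI c)) EFinM; congr (_ * _)%E.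
  rewrite integral_indic// [X in m X](_ : _ = A `&` kappa @^-1` [set c]); last first.
    by apply/seteqP; split => t; [case|move=> [At kt]].
  rewrite fineK// ge0_fin_numE//; apply: le_lt_trans A_fin.
  by apply: le_measure; rewrite ?inE// => t [].
by rewrite (eq_bigr _ (fun c _ => E c)) sumEFin.
Qed.

End FiniteRange.

Section rv_integral.
Variables (R : realType) (n : nat).
Local Notation mR := (measurableTypeR R).
Local Notation mu := (lebesgue_tuple R n).
Local Notation V := 'rV[R]_n.
Implicit Types g h : V -> R.

Definition rv_integral g : R := \int[mu]_t g (rowt t).

Definition cube_mass (j : R) : R := fine (mu (cube n `|j|)).

Lemma cube_mass_ge0 j : 0 <= cube_mass j.
Proof. exact: fine_ge0. Qed.

Lemma rv_integral_ext g h : (forall x, g x = h x) -> rv_integral g = rv_integral h.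
Proof. by move=> gh; congr rv_integral; apply/funext. Qed.

Lemma vanish_cube j g t : vanish j g -> ~ cube n `|j| t -> g (rowt t) = 0.
Proof.
move=> Zg nt; apply: Zg; rewrite ltNge; apply/negP => tj; apply: nt.
by apply: norm_rowt => //; rewrite (le_trans tj)// ler_norm.
Qed.

Lemma rv_integral_cube j g : vanish j g -> rv_integral g = \int[mu]_(t in cube n `|j|) g (rowt t).
Proof.
move=> Zg; rewrite Rintegral_mkcond /rv_integral; congr Rintegral.
apply/funext => t; rewrite /patch; case: ifPn => // /negP tc.
by rewrite (vanish_cube Zg)// => ct; apply: tc; rewrite inE.
Qed.

Lemma rv_integral_lin j a g h : continuous g -> continuous h -> vanish j g -> vanish j h ->
  rv_integral (fun x => a * g x + h x) = a * rv_integral g + rv_integral h.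
Proof.
move=> cg ch Zg Zh; have ig := integrable_rowt cg Zg; have ih := integrable_rowt ch Zh.
rewrite /rv_integral RintegralD ?RintegralZl//.
exact: (integrableZl measurableT a ig).
Qed.

Lemma rv_integral_bound j g M : continuous g -> vanish j g -> (forall x, `|g x| <= M) ->
  `|rv_integral g| <= M * cube_mass j.
Proof.
move=> cg Zg gM; rewrite (rv_integral_cube Zg).
have mc := @measurable_cube R n `|j|; have cf := @lebesgue_tuple_cube_lty R n `|j|.
apply: (Rintegral_bound mc cf (f := g \o @rowt R n)).
- by apply: measurable_funTS; exact: measurable_rowt.
- by move=> t _; exact: gM.
Qed.

Lemma rv_integral_affine j (a : V) (r : R) g : 0 < r -> continuous g -> vanish j g ->
  rv_integral g = r ^+ n * rv_integral (fun x => g (a + r *: x)).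
Proof.
move=> r0 cg Zg; pose phi (x : V) := a + r *: x; pose a' i := a 0 i.
have cphi : continuous phi.
  move=> x; apply: continuousD; first exact: cst_continuous.
  exact: scaler_continuous.
have cgp : continuous (g \o phi) by move=> x; apply: continuous_comp; [exact: cphi|exact: cg].
have Zgp : vanish ((j + `|a|) / r) (g \o phi).
  move=> x; rewrite ltr_pdivrMr// => jx; apply: Zg.
  have : `|r *: x| <= `|phi x| + `|a|.
    have -> : r *: x = phi x - a by rewrite /phi addrAC subrr add0r.
    exact: ler_normB.
  by rewrite normrZ gtr0_norm// mulrC; lra.
have ig := integrable_rowt cg Zg; have igp := integrable_rowt cgp Zgp.
have tE t : rowt (tuple_affine a' r t) = phi (rowt t).
  by apply/rowP => i; rewrite !mxE tnth_mktuple.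
have mg : measurable_fun [set: n.-tuple mR] (EFin \o (g \o @rowt R n)).
  exact: measurable_int ig.
rewrite /rv_integral /Rintegral.
rewrite [X in fine X = _]integralE [X in _ = _ * fine X]integralE.
rewrite (ge0_integral_tuple_affine a' r0 (measurable_funepos mg))//.
rewrite (ge0_integral_tuple_affine a' r0 (measurable_funeneg mg))//.
have e1 : (\int[mu]_t ((EFin \o (g \o @rowt R n))^\+ (tuple_affine a' r t)) =
  \int[mu]_t ((EFin \o ((g \o phi) \o @rowt R n))^\+ t))%E.
  by apply: eq_integral => t _; rewrite !funeposE /= tE.
have e2 : (\int[mu]_t ((EFin \o (g \o @rowt R n))^\- (tuple_affine a' r t)) =
  \int[mu]_t ((EFin \o ((g \o phi) \o @rowt R n))^\- t))%E.
  by apply: eq_integral => t _; rewrite !funenegE /= tE.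
rewrite e1 e2.
have f1 := integrable_pos_fin_num measurableT igp.
have f2 := integrable_neg_fin_num measurableT igp.
by rewrite -muleBr ?fin_num_adde_defl ?fin_numN// fineM// fin_numB f1 f2.
Qed.

Variable Y : completeNormedModType R.

Lemma compact_net j (F : V -> Y) (d : nat -> Y) (e : R) : dense_seq d -> 0 < e ->
  continuous F -> exists N : nat, forall x, `|x| <= j ->
    exists2 k : 'I_N, true & `|F x - d k| < e.
Proof.
move=> dd e0 cF.
have := @compact_norm_ball R n j; rewrite compact_cover => /(_ nat setT (fun k => F @^-1` ball (d k) e)).
case=> [k _|x _|D _ Dc].
- by apply: open_comp => [x _|]; [exact: cF|exact: ball_open].
- have [k hk] := dd (F x) e e0; exists k => //=.
  by rewrite -ball_normE /= distrC.
exists (\max_(k <- finmap.enum_fset D) k).+1 => x xj; have [k kD] := Dc x xj.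
rewrite /= -ball_normE /= distrC => hk.
have kN : (k < (\max_(k <- finmap.enum_fset D) k).+1)%N.
  by rewrite ltnS; apply: leq_bigmax_seq.
by exists (Ordinal kN).
Qed.

(** A simple function [w \o kappa] within e of F on the cube. In [exists_net] the code [kappa t]
    records, for each of N points of the dense sequence, whether it is close to F; the whole pattern
    is kept, and not one chosen point, so that the level sets are visibly measurable. *)
Record net (j : R) (F : V -> Y) (e : R) (N : nat) (kappa : n.-tuple mR -> {ffun 'I_N -> bool})
    (w : {ffun 'I_N -> bool} -> Y) : Prop := Net {
  net_meas : forall b, measurable (cube n `|j| `&` kappa @^-1` [set b]);
  net_approx : forall t, cube n `|j| t -> `|F (rowt t) - w (kappa t)| <= e }.

Lemma exists_net j (F : V -> Y) (d : nat -> Y) (e : R) : dense_seq d -> 0 < e ->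
  continuous F -> exists N kappa w, @net j F e N kappa w.
Proof.
move=> dd e0 cF; have [N hN] := compact_net `|j| dd e0 cF.
pose kappa (t : n.-tuple mR) := [ffun k : 'I_N => `|F (rowt t) - d k| < e].
pose w (b : {ffun 'I_N -> bool}) := if [pick k | b k] is Some k then d k else 0.
exists N, kappa, w; split => [b|t ct].
  rewrite (_ : _ @^-1` _ = \bigcap_(k : 'I_N)
     [set t | (`|F (rowt t) - d k| < e) = b k]).
    apply: measurableI; first exact: measurable_cube.
    apply: countable_bigcap_measurable => [|k _]; first exact: countableP.
    have m1 : measurable [set t : n.-tuple mR | `|F (rowt t) - d k| < e].
      apply: (@measurable_rowt_open R n [set x | `|F x - d k| < e]).
      apply: (@open_comp _ _ (fun x => `|F x - d k|) [set r | r < e]); last exact: open_lt.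
      move=> x _; have cFk : {for x, continuous (F - cst (d k))}.
        by apply: continuousB; [exact: cF|exact: cst_continuous].
      exact: (cvg_norm cFk).
    case: (b k).
      by rewrite (_ : [set t | _] = [set t : n.-tuple mR | `|F (rowt t) - d k| < e]).
    rewrite (_ : [set t | _] = ~` [set t : n.-tuple mR | `|F (rowt t) - d k| < e]).
      exact: measurableC.
    by apply/seteqP; split => t /=; [move=> ->|move=> /negP/negbTE].
  apply/seteqP; split => t /= => [<- k _ /=|h]; first by rewrite ffunE.
  by apply/ffunP => k; rewrite ffunE; exact: h.
rewrite /w; case: pickP => [k|nk]; first by rewrite ffunE => /ltW.
have [|k _ hk] := hN (rowt t).
  by apply: norm_row_le => // i; rewrite mxE; exact: ct.
by have := nk k; rewrite ffunE hk.
Qed.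

(* The integral of F as an element of Y: the limit of the integrals of simple
   functions with values among the [d k] that approximate F uniformly. *)
Lemma weak_integral j (F : V -> Y) (d : nat -> Y) : dense_seq d ->
  continuous F -> vanish j F ->
  exists y, forall c : dual Y, c y = rv_integral (fun x => c (F x)).
Proof.
move=> dd cF ZF.
pose A := cube (R := R) n `|j|.
have mA : measurable A by exact: measurable_cube.
have Afin : (mu A < +oo)%E by exact: lebesgue_tuple_cube_lty.
pose m (B : set (n.-tuple mR)) : R := fine (mu (A `&` B)).
pose ep (p : nat) : R := p.+1%:R^-1.
have ep0 p : 0 < ep p by rewrite invr_gt0.
have /choice[D hD] : forall p : nat, exists D :
    {N : nat & (n.-tuple mR -> {ffun 'I_N -> bool}) * ({ffun 'I_N -> bool} -> Y)}%type,
    net j F (ep p) (projT2 D).1 (projT2 D).2.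
  move=> p; have [N [ka [w h]]] := exists_net j dd (ep0 p) cF.
  by exists (existT _ N (ka, w)).
pose ka p := (projT2 (D p)).1; pose w p := (projT2 (D p)).2.
pose y p := \sum_b m (ka p @^-1` [set b]) *: w p b.
have K0 : 0 <= cube_mass j := cube_mass_ge0 j.
have mm p q b b' : measurable (A `&` ka p @^-1` [set b] `&` ka q @^-1` [set b']).
  rewrite -[A](setIid A) -setIA setIACA.
  by apply: measurableI; [exact: (net_meas (hD p))|exact: (net_meas (hD q))].
(* Masses of the common refinement of two partitions. On a nonempty cell both simple functions are
   close to the same value of F; an empty cell has mass 0. *)
pose m2 p q b b' : R := fine (mu (A `&` ka p @^-1` [set b] `&` ka q @^-1` [set b'])).
have m20 p q b b' : 0 <= m2 p q b b' by exact: fine_ge0.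
have msum p q b : m (ka p @^-1` [set b]) = \sum_b' m2 p q b b'.
  have mB : measurable (A `&` ka p @^-1` [set b]) := net_meas (hD p) b.
  have Bfin : (mu (A `&` ka p @^-1` [set b]) < +oo)%E.
    by have := fin_mass mA Afin mB; rewrite setIA setIid.
  have := Rintegral_finite_range mB Bfin (mm p q b) (fun=> 1).
  rewrite Rintegral_cst// mul1r /m => ->.
  by apply: eq_bigr => b' _; rewrite mul1r.
have m2C p q b b' : m2 p q b b' = m2 q p b' b by rewrite /m2 setIAC.
have mtot p : \sum_b m (ka p @^-1` [set b]) = cube_mass j.
  have := Rintegral_finite_range mA Afin (net_meas (hD p)) (fun=> 1).
  rewrite Rintegral_cst// mul1r /cube_mass -/A => ->.
  by apply: eq_bigr => b _; rewrite mul1r.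
have yB p q : `|y p - y q| <= (ep p + ep q) * cube_mass j.
  have -> : y p - y q = \sum_b \sum_b' m2 p q b b' *: (w p b - w q b').
    have -> : y q = \sum_b \sum_b' m2 p q b b' *: w q b'.
      rewrite exchange_big /=; apply: eq_bigr => b' _.
      by rewrite (msum q p) scaler_suml; apply: eq_bigr => b _; rewrite m2C.
    rewrite /y -sumrB; apply: eq_bigr => b _.
    rewrite (msum p q) scaler_suml -sumrB; apply: eq_bigr => b' _.
    by rewrite scalerBr.
  rewrite (le_trans (ler_norm_sum _ _ _))//.
  rewrite -(mtot p) mulr_sumr; apply: ler_sum => b _.
  rewrite (le_trans (ler_norm_sum _ _ _))//.
  rewrite (msum p q) mulr_sumr; apply: ler_sum => b' _.
  rewrite normrZ ger0_norm// mulrC /m2.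
  have [->|/set0P[t [[At tb] tb']]] :=
    eqVneq (A `&` ka p @^-1` [set b] `&` ka q @^-1` [set b']) set0.
    by rewrite measure0 !mulr0.
  rewrite ler_wpM2r ?fine_ge0//.
  have h1 := net_approx (hD p) At; have h2 := net_approx (hD q) At.
  rewrite -/(ka p) -/(w p) -/(ka q) -/(w q) in h1 h2.
  rewrite (tb : ka p t = b) in h1; rewrite (tb' : ka q t = b') in h2.
  by have := ler_distD (F (rowt t)) (w p b) (w q b'); rewrite (distrC (w p b) (F _)); lra.
have [|l hl] := @complete_eps R Y y.
  move=> e e0.
  have k0 : 0 < cube_mass j + 1 by rewrite ltr_wpDl.
  have [N hN] := invS_le (divr_gt0 (divr_gt0 e0 k0) (ltr0n R 2)).
  exists N => p q Np Nq; rewrite (le_trans (yB p q))//.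
  have hp := hN p Np; have hq := hN q Nq; rewrite -/(ep p) -/(ep q) in hp hq.
  apply: (@le_trans _ _ (e / (cube_mass j + 1) * cube_mass j)).
    by rewrite ler_wpM2r//; lra.
  by rewrite mulrAC ler_pdivrMr// ler_pM2l// lerDl.
exists l => c; have [K Kge0 hK] := dual_bounded_by c.
apply/eqP; rewrite -subr_eq0 -normr_eq0 eq_le normr_ge0 andbT.
apply/ler_addgt0Pr => e e0; rewrite add0r.
have q0 : 0 < K * (1 + cube_mass j) + 1.
  by rewrite ltr_wpDl// mulr_ge0// addr_ge0.
pose e' := e / (K * (1 + cube_mass j) + 1).
have e'0 : 0 < e' by rewrite divr_gt0.
have [N1 hN1] := hl _ e'0; have [N2 hN2] := invS_le e'0.
pose p := maxn N1 N2.
have h1 := hN1 p (leq_maxl _ _); have h2 : ep p <= e' := hN2 p (leq_maxr _ _).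
have mcF : measurable_fun A (fun t => c (F (rowt t))).
  apply: measurable_funTS; apply: (@measurable_rowt R n (fun x => c (F x))).
  by move=> x; apply: continuous_comp; [exact: cF|exact: dual_continuous].
have mcw : measurable_fun A (fun t => c (w p (ka p t))).
  exact: (measurable_finite_range (net_meas (hD p)) (fun b => c (w p b))).
have [MF MF0 hMF] := vanish_bounded cF ZF.
have icF : mu.-integrable A (EFin \o (fun t => c (F (rowt t)))).
  apply: (integrable_bounded_on mA Afin (M := K * MF)) => // t _.
  by rewrite (le_trans (hK _))// ler_wpM2l.
have icw : mu.-integrable A (EFin \o (fun t => c (w p (ka p t)))).
  apply: (integrable_bounded_on mA Afin (M := K * (MF + ep p))) => // t At.
  rewrite (le_trans (hK _))// ler_wpM2l//.
  have h := net_approx (hD p) At.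
  have -> : w p (ka p t) = F (rowt t) - (F (rowt t) - w p (ka p t)) by rewrite subKr.
  by rewrite (le_trans (ler_normB _ _))// lerD.
have cyp : c (y p) = \int[mu]_(t in A) c (w p (ka p t)).
  rewrite (Rintegral_finite_range mA Afin (net_meas (hD p)) (fun b => c (w p b))).
  by rewrite dual_sum; apply: eq_bigr => b _; rewrite dual_scale mulrC.
have ZcF : vanish j (fun x => c (F x)) by move=> x jx; rewrite ZF// dual0.
have h3 : `|c (y p) - rv_integral (fun x => c (F x))| <= K * ep p * cube_mass j.
  rewrite cyp (rv_integral_cube ZcF) -RintegralB//.
  apply: Rintegral_bound => //; first exact: measurable_funB.
  move=> t At; rewrite -dual_sub (le_trans (hK _))// ler_wpM2l// distrC.
  exact: (net_approx (hD p) At).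
have h4 : `|c l - c (y p)| <= K * e'.
  by rewrite -dual_sub (le_trans (hK _))// ler_wpM2l.
have h5 : K * ep p * cube_mass j <= K * e' * cube_mass j.
  by rewrite ler_wpM2r// ler_wpM2l.
have h6 : K * e' + K * e' * cube_mass j <= e.
  rewrite (_ : _ + _ = e' * (K * (1 + cube_mass j))); last by ring.
  by rewrite /e' mulrAC ler_pdivrMr// ler_pM2l// lerDl.
by have := ler_distD (c (y p)) (c l) (rv_integral (fun x => c (F x))); lra.
Qed.

End rv_integral.

(** * Functions biorthogonal to the monomials *)

Section Flat.
Variable R : realType.
Implicit Types (q : {poly R}) (x t : R).

(** The classical smooth function e^(-1/x), with a polynomial factor in 1/x that makes the family
    closed under differentiation: for x > 0 the derivative is (q(1/x) - q'(1/x)) x^-2 e^(-1/x),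
    whence [flat_deriv]. *)
Definition flat q x : R := if 0 < x then q.[x^-1] * expR (- x^-1) else 0.

Definition flat_deriv q : {poly R} := (q - q^`()) * 'X^2.

Lemma horner_growth q : exists2 B, 0 <= B &
  forall t, 1 <= t -> `|q.[t]| <= B * t ^+ size q.
Proof.
exists (\sum_(i < size q) `|q`_i|); first exact: sumr_ge0.
move=> t t1; rewrite horner_coef (le_trans (ler_norm_sum _ _ _))// mulr_suml.
apply: ler_sum => i _; rewrite normrM ler_wpM2l// ger0_norm.
  by rewrite ler_weXn2l// ltnW.
by rewrite exprn_ge0// (le_trans ler01).
Qed.

Lemma flat_sqr q : exists2 B, 0 <= B &
  forall x, `|x| <= 1 -> `|flat q x| <= B * x ^+ 2.
Proof.
have [B B0 hB] := horner_growth q.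
(* With t = 1/x, q(t) grows at most like t^(size q), while e^t dominates t^(size q + 2); the two
   extra powers leave the factor x^2. *)
pose m := (size q).+1.
exists (B * m.+1`!%:R) => [|x]; first by rewrite mulr_ge0.
rewrite ler_norml => /andP[_ x1]; rewrite /flat.
case: ifPn => [x0|_]; last by rewrite normr0; apply: mulr_ge0; [exact: mulr_ge0|exact: sqr_ge0].
have t1 : 1 <= x^-1 by rewrite invf_ge1.
have t0 : 0 < x^-1 := lt_le_trans ltr01 t1.
rewrite normrM [`|expR _|]ger0_norm ?expR_ge0// expRN.
have h := expR_ge1Dxn m (ltW t0).
have E0 : 0 < expR x^-1 by exact: expR_gt0.
rewrite ler_pdivrMr// (le_trans (hB _ t1))//.
have F0 : 0 < m.+1`!%:R :> R by rewrite ltr0n fact_gt0.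
have h2 : x^-1 ^+ m.+1 <= m.+1`!%:R * expR x^-1.
  by rewrite mulrC -ler_pdivrMr//; lra.
have -> : x^-1 ^+ size q = x ^+ 2 * x^-1 ^+ m.+1.
  by rewrite /m !exprS !mulrA expr0 mulr1 mulfK ?gt_eqF// mulfV ?gt_eqF// mul1r.
have Bx : 0 <= B * x ^+ 2 by rewrite mulr_ge0 ?sqr_ge0.
rewrite mulrA; apply: (le_trans (ler_wpM2l Bx h2)).
by rewrite le_eqVlt; apply/orP; left; apply/eqP; ring.
Qed.

Lemma is_derive_flat q x : is_derive x 1 (flat q) (flat (flat_deriv q) x).
Proof.
have [x0|x0|<-] := ltgtP 0 x.
- pose g (y : R) := q.[y^-1] * expR (- y^-1).
  have nx : \near x, g x = flat q x.
    near=> y; rewrite /g /flat; suff -> : 0 < y by [].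
    by near: y; exact: lt_nbhsr.
  have dV : is_derive x 1 (fun y : R => y^-1) (- x ^- 2).
    have dV0 := @is_deriveV R id x 1 1 (lt0r_neq0 x0) (is_derive_id _ _).
    by apply: (is_derive_eq dV0); rewrite /GRing.scale /= mulr1.
  have d1 : is_derive x 1 (horner q \o (fun y : R => y^-1)) (q^`().[x^-1] * (- x ^- 2)).
    exact: is_derive1_comp.
  have dN : is_derive x 1 (fun y : R => - y^-1) (x ^- 2).
    by apply: (is_derive_eq (is_deriveN dV)); rewrite opprK.
  have d2 : is_derive x 1 (expR \o (fun y : R => - y^-1)) (expR (- x^-1) * x ^- 2).
    exact: is_derive1_comp.
  have dg := is_deriveM d1 d2.
  apply: (near_eq_is_derive nx).
  have -> : flat (flat_deriv q) x = (horner q \o (fun y : R => y^-1)) x *: (expR (- x^-1) * x ^- 2) +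
     (expR \o (fun y : R => - y^-1)) x *: (q^`().[x^-1] * (- x ^- 2)).
    rewrite /flat x0 /flat_deriv !hornerE /GRing.scale /= -exprVn; ring.
  exact: dg.
- have nx : \near x, cst 0 x = flat q x.
    near=> y; rewrite /flat /=; suff -> : 0 < y = false by [].
    apply/negbTE; rewrite -leNgt; apply: ltW.
    by near: y; exact: lt_nbhsl.
  apply: (near_eq_is_derive nx).
  rewrite /flat; suff -> : 0 < x = false by exact: is_derive_cst.
  by apply/negbTE; rewrite -leNgt ltW.
have f0 p : flat p 0 = 0 by rewrite /flat ltxx.
(* At 0 the difference quotient is bounded by B |h|, so the derivative is 0, the value of every
   [flat] there. *)
have [B B0 hB] := flat_sqr q.
have H : (fun h => h^-1 *: ((flat q \o shift (0 : R)) (h *: (1 : R)) - flat q 0)) @ (0 : R)^' --> (0 : R).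
  apply/cvgrPdist_le => e e0; rewrite !nearE; apply/nbhs_ballP.
  have B1 : 0 < B + 1 by rewrite ltr_wpDl.
  exists (Num.min 1 (e / (B + 1))).
    by rewrite /= lt_min ltr01 divr_gt0.
  move=> h; rewrite /ball /= sub0r normrN lt_min => /andP[h1 he] h0.
  rewrite sub0r normrN addr0 /GRing.scale /= mulr1 f0 subr0 normrM normfV.
  rewrite ler_pdivrMl ?normr_gt0// (le_trans (hB _ (ltW h1)))//.
  rewrite -real_normK ?num_real// expr2 mulrCA ler_wpM2l//.
  rewrite ltr_pdivlMr// in he; have := normr_ge0 h; nra.
rewrite f0; apply: DeriveDef; first by apply/cvg_ex; exists 0.
exact: cvg_lim H.
Unshelve. all: by end_near. Qed.

Lemma flat_derivable q x : derivable (flat q) x 1.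
Proof. by have [] := is_derive_flat q x. Qed.

Lemma flat_differentiable q x : differentiable (flat q) x.
Proof. exact/derivable1_diffP/flat_derivable. Qed.

Lemma flat_continuous q : continuous (flat q).
Proof. by move=> x; exact/differentiable_continuous/flat_differentiable. Qed.

Lemma diff_flat q x (h : R) : 'd (flat q) x h = h * flat (flat_deriv q) x.
Proof.
have [_ D] := is_derive_flat q x; have df := flat_differentiable q x.
rewrite -D (deriveE _ df).
have E : 'd (flat q) x (h *: (1 : R^o)) = h *: ('d (flat q) x 1 : R^o) by rewrite linearZ.
by move: E; rewrite /GRing.scale /= mulr1.
Qed.

End Flat.

Section SmoothClass.
Variables (R : realType) (n : nat).
Local Notation V := 'rV[R]_n.

(* The ring of functions generated by the coordinates x_i and the flat functions
   of 1 - x_i^2; it is stable under differentiation. *)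
Inductive flat_ring : (V -> R) -> Prop :=
| flat_ring_cst c : flat_ring (cst c)
| flat_ring_coord i : flat_ring (fun x => x 0 i)
| flat_ring_flat q i : flat_ring (fun x => flat q (1 - x 0 i ^+ 2))
| flat_ring_add f g : flat_ring f -> flat_ring g -> flat_ring (f + g)
| flat_ring_mul f g : flat_ring f -> flat_ring g -> flat_ring (f * g).

Let bump_arg i : V -> R := cst 1 - ((fun x : V => x 0 i) * (fun x : V => x 0 i)).

Let bump_argE i x : bump_arg i x = 1 - x 0 i ^+ 2.
Proof. by rewrite /bump_arg !fctE expr2. Qed.

Let bump_arg_diff i x : differentiable (bump_arg i) x.
Proof.
apply: differentiableB; first exact: differentiable_cst.
by apply: differentiableM; exact: differentiable_coord.
Qed.

Let flatE q i : (fun x : V => flat q (1 - x 0 i ^+ 2)) = flat q \o bump_arg i.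
Proof. by apply/funext => x; rewrite /= bump_argE. Qed.

Lemma flat_ring_diff f x : flat_ring f -> differentiable f x.
Proof.
elim=> {f} [c|i|q i|f g _ df _ dg|f g _ df _ dg].
- exact: differentiable_cst.
- exact: differentiable_coord.
- rewrite flatE; apply: differentiable_comp; first exact: bump_arg_diff.
  exact: flat_differentiable.
- exact: differentiableD.
- exact: differentiableM.
Qed.

Lemma flat_ring_spoly f : spoly f -> flat_ring f.
Proof. by elim=> {f}; [exact: flat_ring_cst|exact: flat_ring_coord|move=> *; exact: flat_ring_add|move=> *; exact: flat_ring_mul]. Qed.

Lemma flat_ring_derive f v : flat_ring f -> flat_ring ('D_v f).
Proof.
elim=> {f} [c|i|q i|f g pf df pg dg|f g pf df pg dg].
- by rewrite (sderive_cst c v); exact: flat_ring_cst.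
- by rewrite (sderive_coord i v); exact: flat_ring_cst.
- have -> : 'D_v (fun x : V => flat q (1 - x 0 i ^+ 2)) =
     'D_v (bump_arg i) * (fun x => flat (flat_deriv q) (1 - x 0 i ^+ 2)).
    apply/funext => x; rewrite flatE.
    transitivity ('D_v (bump_arg i) x * flat (flat_deriv q) (1 - x 0 i ^+ 2)); last by [].
    have d1 := bump_arg_diff i x; have d2 := flat_differentiable q (bump_arg i x).
    rewrite (deriveE v (differentiable_comp d1 d2)) (diff_comp d1 d2) /= diff_flat.
    by rewrite -(deriveE v d1) -bump_argE.
  apply: flat_ring_mul; last exact: flat_ring_flat.
  apply: flat_ring_spoly; apply: spoly_derive.
  rewrite (_ : bump_arg i = cst 1 + cst (-1) * ((fun x : V => x 0 i) * (fun x : V => x 0 i))).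
    by do ![constructor].
  by apply/funext => x; rewrite /bump_arg !fctE mulN1r.
- have -> : 'D_v (f + g) = 'D_v f + 'D_v g.
    apply/funext => x.
    have E := deriveD (diff_derivable (v := v) (flat_ring_diff x pf)) (diff_derivable (v := v) (flat_ring_diff x pg)).
    by rewrite E.
  exact: flat_ring_add.
- have -> : 'D_v (f * g) = f * 'D_v g + 'D_v f * g.
    apply/funext => x.
    have E := deriveM (diff_derivable (v := v) (flat_ring_diff x pf)) (diff_derivable (v := v) (flat_ring_diff x pg)).
    by rewrite E /GRing.scale /= (mulrC (g x)).
  by apply: flat_ring_add; exact: flat_ring_mul.
Qed.

Lemma flat_ring_smooth f : flat_ring f -> smooth f.
Proof.
move=> cf m; elim: m f cf => [|m IH] f cf /=.
  by move=> x; exact/differentiable_continuous/flat_ring_diff.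
by split=> [x|v]; [exact: flat_ring_diff|apply: IH; exact: flat_ring_derive].
Qed.

Lemma smooth_scaler (W : normedModType R) (f : V -> R) (w : W) :
  smooth f -> smooth (fun x => f x *: w).
Proof.
move=> sf m; move: {sf}(sf m) => sf; elim: m f sf => [|m IH] f /=.
  by move=> cf x; apply: continuousZl; exact: cf.
move=> [df Df]; split=> [x|v]; first exact: differentiableZl.
rewrite (_ : 'D_v _ = fun x => 'D_v f x *: w); first exact: IH.
apply/funext => x; have dfc : differentiable (fun x => f x *: w) x by exact: differentiableZl.
by rewrite (deriveE v dfc) (deriveE v (df x)) (diffZl _ (df x)).
Qed.

Lemma flat_ring_prod (I : Type) (r : seq I) (f : I -> V -> R) :
  (forall i, flat_ring (f i)) -> flat_ring (fun x => \prod_(i <- r) f i x).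
Proof.
move=> cf; elim: r => [|i r IH].
  rewrite (_ : (fun _ => _) = cst 1); first exact: flat_ring_cst.
  by apply/funext => x; rewrite big_nil.
rewrite (_ : (fun _ => _) = f i * (fun x => \prod_(i <- r) f i x)); first exact: flat_ring_mul.
by apply/funext => x; rewrite big_cons.
Qed.

Lemma flat_ring_sum (I : Type) (r : seq I) (f : I -> V -> R) :
  (forall i, flat_ring (f i)) -> flat_ring (fun x => \sum_(i <- r) f i x).
Proof.
move=> cf; elim: r => [|i r IH].
  rewrite (_ : (fun _ => _) = cst 0); first exact: flat_ring_cst.
  by apply/funext => x; rewrite big_nil.
rewrite (_ : (fun _ => _) = f i + (fun x => \sum_(i <- r) f i x)); first exact: flat_ring_add.
by apply/funext => x; rewrite big_cons.
Qed.

Lemma flat_ring_coordX i m : flat_ring (fun x => x 0 i ^+ m).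
Proof.
elim: m => [|m IH]; first exact: (flat_ring_cst 1).
rewrite (_ : (fun _ => _) = (fun x : V => x 0 i) * (fun x : V => x 0 i ^+ m)).
  by apply: flat_ring_mul => //; exact: flat_ring_coord.
by apply/funext => x; rewrite exprS.
Qed.

End SmoothClass.

Section LineIntegral.
Variable R : realType.
Local Notation lam := (@lebesgue_measure R).
Implicit Types g h : R -> R.

Definition line_integral g : R := \int[lam]_x g x.

Definition unit_supp g := continuous g /\ forall x, 1 < `|x| -> g x = 0.

Lemma unit_supp_integrable g : unit_supp g -> lam.-integrable setT (EFin \o g).
Proof. by case=> cg Zg; exact: integrable_line cg Zg. Qed.

Lemma unit_supp_lin a g h : unit_supp g -> unit_supp h ->
  unit_supp (fun x => a * g x + h x).
Proof.
move=> [cg Zg] [ch Zh]; split=> x; last by move=> x1; rewrite Zg// Zh// mulr0 addr0.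
by apply: cvgD; [apply: cvgM; [exact: cvg_cst|exact: cg]|exact: ch].
Qed.

Lemma line_integral_lin a g h : unit_supp g -> unit_supp h ->
  line_integral (fun x => a * g x + h x) = a * line_integral g + line_integral h.
Proof.
move=> /unit_supp_integrable ig /unit_supp_integrable ih.
rewrite /line_integral RintegralD ?RintegralZl//.
exact: (integrableZl measurableT a ig).
Qed.

Lemma unit_supp_sum (I : Type) (r : seq I) (a : I -> R) (g : I -> R -> R) :
  (forall i, unit_supp (g i)) -> unit_supp (fun x => \sum_(i <- r) a i * g i x).
Proof.
move=> ug; elim: r => [|i r IH].
  rewrite (_ : (fun _ => _) = cst 0); first by split => // x; exact: cst_continuous.
  by apply/funext => x; rewrite big_nil.
rewrite (_ : (fun _ => _) = (fun x => a i * g i x + \sum_(i <- r) a i * g i x)).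
  exact: unit_supp_lin.
by apply/funext => x; rewrite big_cons.
Qed.

Lemma line_integral_sum (I : Type) (r : seq I) (a : I -> R) (g : I -> R -> R) :
  (forall i, unit_supp (g i)) ->
  line_integral (fun x => \sum_(i <- r) a i * g i x) = \sum_(i <- r) a i * line_integral (g i).
Proof.
move=> ug; elim: r => [|i r IH].
  rewrite big_nil (_ : (fun _ => _) = cst 0); first by rewrite /line_integral Rintegral_cst// mul0r.
  by apply/funext => x; rewrite big_nil.
rewrite (_ : (fun _ => _) = (fun x => a i * g i x + \sum_(i <- r) a i * g i x)).
  by rewrite line_integral_lin//; [rewrite IH big_cons|exact: unit_supp_sum].
by apply/funext => x; rewrite big_cons.
Qed.

Lemma line_integral_gt0 g x0 : unit_supp g -> (forall x, 0 <= g x) -> 0 < g x0 -> 0 < line_integral g.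
Proof.
move=> ug g0 gx0; have [cg _] := ug.
have g2 : 0 < g x0 / 2 by rewrite divr_gt0.
have /cvgrPdist_lt/(_ _ g2) := cg x0; rewrite nearE => /nbhs_ballP[d /= d0 hd].
pose I := [set` `[x0 - d / 2, x0 + d / 2]] : set R.
have lI : lam I = d%:E.
  rewrite /I lebesgue_measure_itv /= lte_fin ifT; last by lra.
  by rewrite -EFinD; congr EFin; lra.
have lIf : (lam I < +oo)%E by rewrite lI ltry.
have mI : measurable I by exact: measurable_itv.
apply: (@lt_le_trans _ _ (\int[lam]_x ((cst (g x0 / 2)) \_ I) x)).
  rewrite -Rintegral_mkcond Rintegral_cst// [X in fine X]lI /=.
  exact: mulr_gt0.
apply: le_Rintegral => //; last 2 first.
- exact: unit_supp_integrable.
- move=> x _; rewrite /patch; case: ifPn => [|_]; last exact: g0.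
  rewrite inE /I /= in_itv /= => /andP[h1 h2].
  have : `|g x0 - g x| < g x0 / 2.
    by apply: hd; rewrite /ball /= ltr_norml; apply/andP; split; lra.
  by rewrite ltr_norml => /andP[_]; lra.
apply: (@integrable_bounded_restrict R _ _ lam I _ (g x0 / 2)) => //.
- by apply/(measurable_restrictT _ mI).
- move=> x; rewrite /patch; case: ifP => _ /=; first by rewrite gtr0_norm.
  by rewrite normr0 ltW.
- by move=> x nx; rewrite /patch ifF//; apply/negP; rewrite inE.
Qed.

(** The standard bump function exp(-1/(1 - t^2)) for |t| < 1, and 0 elsewhere. *)
Definition bump (t : R) : R := flat 1 (1 - t ^+ 2).

Lemma bump_ge0 t : 0 <= bump t.
Proof. by rewrite /bump /flat; case: ifP => // _; rewrite hornerE mul1r expR_ge0. Qed.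

Lemma bump_gt0 t : `|t| < 1 -> 0 < bump t.
Proof.
move=> t1; rewrite /bump /flat ifT ?hornerE ?mul1r ?expR_gt0//.
by rewrite subr_gt0 -real_normK ?num_real// expr_lt1.
Qed.

Lemma bump_continuous : continuous bump.
Proof.
move=> t; apply: (@continuous_comp _ _ _ (fun t : R => 1 - t ^+ 2) (flat 1)).
  by apply: cvgB; [exact: cvg_cst|exact: exprn_continuous].
exact: flat_continuous.
Qed.

Lemma unit_supp_bump i : unit_supp (fun t => t ^+ i * bump t).
Proof.
split=> t.
  by apply: cvgM; [exact: exprn_continuous|exact: bump_continuous].
move=> t1; rewrite /bump /flat ifF ?mulr0//; apply/negbTE.
rewrite -leNgt subr_le0 -real_normK ?num_real// expr_ge1//.
by rewrite ltW.
Qed.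

Variable k : nat.

(* The Gram matrix of 1, t, ..., t^k for the inner product with weight [bump];
   its inverse yields the functions [psi1 j] biorthogonal to the monomials. *)
Definition hankel : 'M[R]_k.+1 := \matrix_(i, l) line_integral (fun t => t ^+ (i + l) * bump t).

(** If p is the polynomial with coefficients v, the quadratic form of [hankel] at v is the integral
    of p^2 times [bump], which is positive unless p = 0. *)
Lemma hankel_inj (v : 'rV[R]_k.+1) : v *m hankel = 0 -> v = 0.
Proof.
move=> vH; pose p := \poly_(i < k.+1) v 0 (inord i).
have pE t : p.[t] = \sum_(i < k.+1) v 0 i * t ^+ i.
  by rewrite horner_poly; apply: eq_bigr => i _; rewrite inord_val.
have q0 : line_integral (fun t => p.[t] ^+ 2 * bump t) = 0.
  transitivity (line_integral (fun t => \sum_(i < k.+1) v 0 i *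
     (\sum_(l < k.+1) v 0 l * (t ^+ (i + l) * bump t)))).
    congr line_integral; apply/funext => t; rewrite expr2 -mulrA {1}pE mulr_suml.
    apply: eq_bigr => i _; rewrite -mulrA; congr (_ * _).
    rewrite pE mulr_suml mulr_sumr; apply: eq_bigr => l _.
    by rewrite exprD; ring.
  rewrite line_integral_sum; last by move=> i; apply: unit_supp_sum => l; exact: unit_supp_bump.
  under eq_bigr => i _.
    rewrite line_integral_sum; last by move=> l; exact: unit_supp_bump.
    rewrite mulr_sumr.
    over.
  rewrite exchange_big big1// => l _.
  have := congr1 (fun M : 'rV_k.+1 => M 0 l) vH; rewrite !mxE => E.
  transitivity (v 0 l * \sum_j v 0 j * hankel j l); last by rewrite E mulr0.
  by rewrite mulr_sumr; apply: eq_bigr => i _; rewrite mxE; ring.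
have up : unit_supp (fun t => p.[t] ^+ 2 * bump t).
  have [_ Zb] := unit_supp_bump 0; split=> t.
    apply: cvgM; last exact: bump_continuous.
    by apply: cvgM; exact: continuous_horner.
  by move=> /Zb; rewrite mul1r => ->; rewrite mulr0.
have p0 : p = 0.
  apply/eqP; apply: contraT => pn0.
  (* A nonzero p has fewer than [size p] roots, so it is nonzero at one of the points 1/2, 1/3, ...,
     where [bump] is positive. *)
  pose rs := [seq (i.+2%:R^-1 : R) | i <- iota 0 (size p)].
  have urs : uniq rs.
    rewrite map_inj_uniq ?iota_uniq// => i j /invr_inj/eqP.
    by rewrite eqr_nat => /eqP[].
  have : ~~ all (root p) rs.
    apply/negP => ar; have := max_poly_roots pn0 ar urs.
    by rewrite size_map size_iota ltnn.
  move=> /allPn[x /mapP[i _ xi] npx].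
  have x1 : `|x| < 1.
    by rewrite xi normfV ger0_norm// invf_lt1// ltr1n.
  have : 0 < line_integral (fun t => p.[t] ^+ 2 * bump t).
    apply: (@line_integral_gt0 _ x) => // [t|].
      by rewrite mulr_ge0 ?sqr_ge0 ?bump_ge0.
    rewrite mulr_gt0 ?bump_gt0// lt0r sqr_ge0 andbT sqrf_eq0.
    exact: npx.
  by rewrite q0 ltxx.
apply/rowP => i; rewrite mxE.
have := congr1 (fun q : {poly R} => q`_i) p0.
by rewrite coef_poly ltn_ord inord_val coef0.
Qed.

Lemma hankel_unit : hankel \in unitmx.
Proof.
rewrite -row_free_unit -kermx_eq0; apply/eqP/row_matrixP => i.
rewrite row0; apply: hankel_inj.
by rewrite -row_mul mulmx_ker row0.
Qed.

Definition psi1 (j : 'I_k.+1) (t : R) : R :=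
  \sum_(l < k.+1) invmx hankel j l * (t ^+ l * bump t).

Lemma unit_supp_psi1 j : unit_supp (psi1 j).
Proof. by apply: unit_supp_sum => l; exact: unit_supp_bump. Qed.

Lemma unit_supp_mono_psi1 i j : unit_supp (fun t => t ^+ i * psi1 j t).
Proof.
have [cp Zp] := unit_supp_psi1 j; split=> t.
  by apply: cvgM; [exact: exprn_continuous|exact: cp].
by move=> /Zp ->; rewrite mulr0.
Qed.

Lemma line_integral_psi1 (i j : 'I_k.+1) :
  line_integral (fun t => t ^+ i * psi1 j t) = (i == j)%:R.
Proof.
transitivity (line_integral (fun t => \sum_(l < k.+1) invmx hankel j l * (t ^+ (l + i) * bump t))).
  congr line_integral; apply/funext => t; rewrite mulr_sumr; apply: eq_bigr => l _.
  by rewrite exprD; ring.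
rewrite line_integral_sum; last by move=> l; exact: unit_supp_bump.
have := congr1 (fun M : 'M[R]_k.+1 => M j i) (mulVmx hankel_unit).
rewrite !mxE eq_sym => <-; apply: eq_bigr => l _.
by rewrite [in RHS]mxE.
Qed.

End LineIntegral.

Section DualFunctions.
Variables (R : realType) (n k : nat).
Local Notation V := 'rV[R]_n.
Local Notation index := {ffun 'I_n -> 'I_k.+1}.

Definition mono (al : index) (x : V) : R := \prod_i x 0 i ^+ al i.

(** The product form yields biorthogonality to the monomials with all exponents up to k in each
    variable; the total degree is bounded by k separately, through [deg]. *)
Definition psi (be : index) (x : V) : R := \prod_i psi1 (be i) (x 0 i).

Lemma flat_ring_mono al : flat_ring (mono al).
Proof. by apply: flat_ring_prod => i; exact: flat_ring_coordX. Qed.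

Lemma flat_ring_psi be : flat_ring (psi be).
Proof.
apply: flat_ring_prod => i; apply: flat_ring_sum => l.
exact (flat_ring_mul (@flat_ring_cst R n (invmx (hankel R k) (be i) l)) (flat_ring_mul (@flat_ring_coordX R n i l) (@flat_ring_flat R n 1 i))).
Qed.

Lemma vanish_psi be : vanish 1 (psi be).
Proof.
move=> x x1; apply/eqP; rewrite prodf_seq_eq0; apply/negPn/negP => /hasPn H.
move: x1; apply/negP; rewrite -leNgt; apply: norm_row_le => // i.
rewrite leNgt; apply/negP => xi.
have := H i (mem_index_enum i); have [_ Z] := unit_supp_psi1 R (be i).
by rewrite Z// eqxx.
Qed.

Lemma rv_integral_mono_psi al be : rv_integral (fun x => mono al x * psi be x) = (al == be)%:R.
Proof.
pose F i t : R := t ^+ al i * psi1 (be i) t.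
transitivity (fine (\int[lebesgue_tuple R n]_t (\prod_i F i (tnth t i))%:E)%E).
  congr fine; apply: eq_integral => t _; congr EFin; rewrite /mono /psi -big_split /=.
  by apply: eq_bigr => i _; rewrite /F mxE.
rewrite (@integral_prod_coord R n 1 F) => [|i|i].
- rewrite /=; have E i : \int[lebesgue_measure]_x F i x = (al i == be i)%:R.
    exact: line_integral_psi1.
  under eq_bigr => i _ do rewrite E.
  have [->|ab] := eqVneq al be; first by rewrite big1// => i _; rewrite eqxx.
  have [i abi] : exists i, al i != be i.
    apply/existsP; apply: contraT; rewrite negb_exists => /forallP H.
    by move/eqP: ab; case; apply/ffunP => i; apply/eqP; have := H i; rewrite negbK.
  by rewrite (bigD1 i)//= (negbTE abi) mul0r.
- by have [] := unit_supp_mono_psi1 R (al i) (be i).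
- by have [] := unit_supp_mono_psi1 R (al i) (be i).
Qed.

End DualFunctions.

(** * Rescaled test functions *)

Section DistributionBound.
Variables (R : realType) (n : nat) (Y : normedModType R).
Local Notation V := 'rV[R]_n.
Local Notation X := (testfun n Y).
Implicit Types (f g : X) (a : V) (r : R).

Lemma supp_vanish (j : R) (f : V -> Y) : vanish j f -> supp f `<=` [set x : V | `|x| <= j].
Proof.
move=> Zf; rewrite /supp closureE => x; apply; split.
  by apply: compact_closed; [exact: norm_hausdorff|exact: compact_norm_ball].
move=> y /= fy0; rewrite leNgt; apply/negP => /Zf fy.
by rewrite fy eqxx in fy0.
Qed.

Variable T : {linear X -> R^o}.
Hypothesis T_cont : continuous T.

(** T has finite order on each ball: the neighbourhood of 0 where |T| < 1 contains the unit ball of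
    a multiple of one seminorm. Every later use of the continuity of T passes through this bound. *)
Lemma distribution_bound (j : R) : exists m (C : R), 0 <= C /\
  forall f e, 0 < e -> vanish j f -> deriv_le m e f -> `|T f| <= C * e.
Proof.
have T0 : T 0 = 0 by exact: linear0.
have : nbhs (0 : X) (T @^-1` [set t : R^o | `|t| < 1]).
  have := @T_cont 0; apply; rewrite T0.
  apply: open_nbhs_nbhs; split; last by rewrite /= normr0.
  apply: (@open_comp _ _ (fun x : R^o => `|x|) [set r | r < 1]); last exact: open_lt.
  by move=> x _; exact: norm_continuous.
rewrite nbhsE => -[B [oB B0] BU].
have tB : testfun_open B by [].
have [N [Nc NK NB]] := tB _ B0.
have [m [e [e0 H]]] := NK _ (@compact_norm_ball R n j).
exists m, e^-1; split; first by rewrite invr_ge0 ltW.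
move=> f e' e'0 Zf Df.
have k0 : 0 < e / e' by rewrite divr_gt0.
have : N ((e / e') *: f).
  apply: H.
    apply: supp_vanish => x jx; rewrite /= !fctE Zf// scaler0 //.
  apply/deriv_leP; rewrite -(addr0 (_ *: _)).
  have := deriv_le_lin (e / e') (testfun_smooth f) (@smooth0 R n Y) Df (e' := 0).
  rewrite gtr0_norm// divfK ?gt_eqF// addr0 !addr0; apply.
  by move=> s _ _ x; rewrite iterD0 normr0.
move=> /NB /BU /=; rewrite add0r linearZ /= normrM gtr0_norm//.
by rewrite -ltr_pdivlMl// mulr1 invf_div mulrC => /ltW.
Qed.

End DistributionBound.

Section Rescale.
Variables (R : realType) (n : nat) (Y : normedModType R).
Local Notation V := 'rV[R]_n.
Local Notation X := (testfun n Y).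
Implicit Types (f g : X) (a b : V) (r j : R).

Lemma rescale_lin (b : R) f g a r : r != 0 ->
  rescale (b *: f + g) a r = b *: rescale f a r + rescale g a r.
Proof.
by move=> r0; apply/val_inj/funext => x /=; rewrite !fctE /= !rescaleE.
Qed.

Lemma vanish_rescale f a r j j' : 0 < r -> vanish j f -> `|a| + r * j <= j' ->
  vanish j' (rescale f a r).
Proof.
move=> r0 Zf aj x jx; rewrite rescaleE ?gt_eqF//; apply: Zf.
rewrite normrZ gtr0_norm ?invr_gt0// ltr_pdivlMl//.
by have := ler_normD a (x - a); rewrite addrC subrK; lra.
Qed.

Lemma iterD_rescale s f a r x : r != 0 ->
  iterD s (rescale f a r) x = r^-1 ^+ size s *: iterD s f (r^-1 *: (x - a)).
Proof.
move=> r0; rewrite rescaleE// -/(f \o aff r^-1 a).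
have -> : iterD s (f \o aff r^-1 a) = r^-1 ^+ size s *: (iterD s f \o aff r^-1 a).
  elim: s => /= [|v s ->]; first by rewrite scale1r.
  have sf := smooth_iterD s (testfun_smooth f).
  have df z : differentiable (iterD s f) z := smooth_diff z sf.
  have dfa z : differentiable (iterD s f \o aff r^-1 a) z.
    by apply: differentiable_comp => //; exact: aff_diff.
  have E := @derive_lin R n Y (r^-1 ^+ size s) (iterD s f \o aff r^-1 a) 0 v dfa.
  have := E (fun x => differentiable_cst _ _); rewrite addr0 => ->.
  have -> : 'D_v (0 : V -> Y) = 0 by apply/funext => z; rewrite [LHS]derive_cst.
  rewrite addr0 derive_aff//; apply/funext => z.
  have /(congr1 (fun h => h (aff r^-1 a z))) /= dZ := deriveZv r^-1 v df.
  by rewrite !fctE /= dZ !fctE scalerA exprSr.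
by [].
Qed.

Lemma scale_exp_le r (i m : nat) : 0 < r -> (i <= m)%N ->
  r^-1 ^+ i <= (1 + r^-1) ^+ m.
Proof.
move=> r0 im; have ri : 0 < r^-1 by rewrite invr_gt0.
apply: (@le_trans _ _ ((1 + r^-1) ^+ i)).
  by rewrite lerXn2r ?nnegrE//; lra.
by rewrite ler_weXn2l//; lra.
Qed.

Lemma deriv_le_rescale m e f a r : 0 < r -> deriv_le m e f ->
  deriv_le m ((1 + r^-1) ^+ m * e) (rescale f a r).
Proof.
move=> r0 Df s sm s1 x; have ri : 0 <= r^-1 by rewrite invr_ge0 ltW.
rewrite iterD_rescale ?gt_eqF// normrZ ger0_norm ?exprn_ge0//.
by rewrite ler_pM// ?exprn_ge0// ?scale_exp_le//; exact: Df.
Qed.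

Lemma deriv_le_rescaleB m e f a b r : 0 < r -> deriv_le m.+1 e f ->
  deriv_le m ((1 + r^-1) ^+ m * (n.+1%:R * e * (r^-1 * `|a - b|)))
    (rescale f a r - rescale f b r).
Proof.
move=> r0 Df s sm s1 x; have ri : 0 <= r^-1 by rewrite invr_ge0 ltW.
have rn : r != 0 by rewrite gt_eqF.
rewrite iterDB; [|exact: testfun_smooth|exact: testfun_smooth].
rewrite !fctE /= !iterD_rescale// -scalerBr normrZ ger0_norm ?exprn_ge0//.
rewrite ler_pM// ?exprn_ge0// ?scale_exp_le//.
apply: le_trans (deriv_le_lipschitz _ _ (testfun_smooth f) Df sm s1) _.
rewrite -scalerBr normrZ ger0_norm// opprB addrC addrA subrK distrC //.
Qed.

Variable T : {linear X -> R^o}.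
Hypothesis T_cont : continuous T.

Lemma rescale_bound a j : exists m (C : R), 0 <= C /\
  forall f r e, 0 < r -> r <= 1 -> 0 < e -> vanish j f -> deriv_le m e f ->
  `|T (rescale f a r)| <= C * ((1 + r^-1) ^+ m * e).
Proof.
have [m [C [C0 H]]] := distribution_bound T_cont (`|a| + `|j|).
exists m, C; split=> // f r e r0 r1 e0 Zf Df; apply: H.
- by rewrite mulr_gt0// exprn_gt0// ltr_wpDl ?invr_gt0.
- apply: vanish_rescale Zf _ => //; rewrite lerD2l.
  rewrite (le_trans (ler_norm _))// normrM gtr0_norm// ler_piMl//.
- exact: deriv_le_rescale.
Qed.

(** Moving the centre from a to b changes the derivatives of the rescaled function by a multiple of
    |a - b|, at the price of one more derivative of f and powers of 1/r, with r fixed. *)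
Lemma continuous_rescale f r : 0 < r -> continuous (fun a => T (rescale f a r) : R).
Proof.
move=> r0 a; have [j Zf] := testfun_vanish f.
(* The summand 1 leaves room for the supports of the functions centred at b with |a - b| < 1. *)
have [m [C [C0 H]]] := distribution_bound T_cont (`|a| + 1 + r * j).
have [e' e'0 De'] := vanish_deriv_le m.+1 (testfun_smooth f) Zf.
pose e := e' + 1; have e0 : 0 < e by rewrite ltr_wpDl.
have De : deriv_le m.+1 e f by apply: deriv_le_le De'; rewrite lerDl.
have ri : 0 < r^-1 by rewrite invr_gt0.
pose K := (1 + r^-1) ^+ m * (n.+1%:R * e * r^-1).
have K0 : 0 < K by rewrite !mulr_gt0// exprn_gt0// ltr_wpDl.
apply/(@cvgrPdist_le R R^o V (nbhs a) (nbhs_filter a)) => t t0.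
have C1 : 0 < C + 1 by lra.
have d0 : 0 < Num.min 1 (t / ((C + 1) * K)) by rewrite lt_min ltr01 divr_gt0// mulr_gt0.
rewrite !nearE; apply/(@nbhs_normP R V); exists (Num.min 1 (t / ((C + 1) * K))) => // b /=.
rewrite lt_min => /andP[ab1 abt].
have [->|ab] := eqVneq a b; first by rewrite subrr normr0 ltW.
have ab0 : 0 < `|a - b| by rewrite normr_gt0 subr_eq0.
have := H (rescale f a r - rescale f b r) (K * `|a - b|).
rewrite linearB /= => h.
have {}h := h (mulr_gt0 K0 ab0).
apply: (@le_trans _ _ (C * (K * `|a - b|))); first apply: h.
- have Za : vanish (`|a| + 1 + r * j) (rescale f a r).
    by apply: vanish_rescale Zf _ => //; lra.
  have Zb : vanish (`|a| + 1 + r * j) (rescale f b r).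
    apply: vanish_rescale Zf _ => //.
    by have := ler_normD a (b - a); rewrite addrC subrK (distrC b a); lra.
  by move=> x jx; rewrite /= !fctE Za// Zb// subr0.
- have := deriv_le_rescaleB a b r0 De; congr (deriv_le m _ _).
  by rewrite /K !mulrA.
- apply: (@le_trans _ _ ((C + 1) * (K * `|a - b|))).
    by apply: ler_wpM2r; [exact: (ltW (mulr_gt0 K0 ab0))|rewrite lerDl].
  by rewrite mulrA mulrC -ler_pdivlMr; [exact: ltW|exact: mulr_gt0].
Qed.

End Rescale.

(** * Polynomials and moments *)

Section CentredPolynomials.
Variables (R : realType) (n k : nat).
Local Notation V := 'rV[R]_n.
Local Notation index := {ffun 'I_n -> 'I_k.+1}.
Implicit Types (al be : index) (a b : V).

Definition deg al : nat := (\sum_i al i)%N.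

Lemma mono_scale al r (x : V) : mono al (r *: x) = r ^+ deg al * mono al x.
Proof.
rewrite /mono /deg expr_sum -big_split /=; apply: eq_bigr => i _.
by rewrite mxE exprMn.
Qed.

Definition translation_coeff al be b : R :=
  \prod_i (b 0 i ^+ (al i - be i) *+ 'C(al i, be i)).

Lemma mono_translate al (x b : V) :
  mono al (x + b) = \sum_(be : index) mono be x * translation_coeff al be b.
Proof.
transitivity (\prod_i \sum_(m < k.+1)
   (x 0 i ^+ m * (b 0 i ^+ (al i - m) *+ 'C(al i, m)))).
  apply: eq_bigr => i _; rewrite mxE addrC exprDn.
  rewrite (big_ord_widen k.+1 (fun m => (b 0 i ^+ (al i - m) * x 0 i ^+ m) *+ 'C(al i, m)))//.
  rewrite big_mkcond; apply: eq_bigr => m _; case: ifPn => [_|].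
    by rewrite mulrnAr mulrC.
  by rewrite ltnS -ltnNge => h; rewrite bin_small// mulr0n mulr0.
rewrite bigA_distr_bigA; apply: eq_bigr => be _.
by rewrite -big_split.
Qed.

(** Some exponent of [be] exceeds that of [al], and its binomial coefficient is 0. This keeps the
    total degree at most k under translation. *)
Lemma translation_coeff0 al be b : (deg al < deg be)%N ->
  translation_coeff al be b = 0.
Proof.
move=> d; have [i ai] : exists i, (al i < be i)%N.
  apply/existsP; apply: contraT; rewrite negb_exists => /forallP H.
  suff : (deg be <= deg al)%N by rewrite leqNgt d.
  by apply: leq_sum => i _; rewrite leqNgt.
by rewrite /translation_coeff (bigD1 i)//= bin_small// mulr0n mul0r.
Qed.

Variable W : normedModType R.
Implicit Types (c : index -> W).

Definition cpoly c (z : V) : W := \sum_(al | (deg al <= k)%N) mono al z *: c al.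

Lemma cpoly_translate c b : exists c', forall z, cpoly c (z + b) = cpoly c' z.
Proof.
exists (fun be => \sum_(al | (deg al <= k)%N) translation_coeff al be b *: c al) => z.
rewrite /cpoly.
under eq_bigr => al _ do rewrite mono_translate scaler_suml.
under [RHS]eq_bigr => be _ do rewrite scaler_sumr.
rewrite [RHS]exchange_big /=; apply: eq_bigr => al ak.
rewrite [RHS]big_mkcond /=; apply: eq_bigr => be _.
case: ifPn => [_|]; first by rewrite scalerA.
by rewrite -ltnNge => kb; rewrite translation_coeff0 ?mulr0 ?scale0r// (leq_ltn_trans ak).
Qed.

Lemma polyfun_centred P a : polyfun k P -> exists c, forall z, P (a + z) = cpoly c z.
Proof.
move=> [c Pc]; have [c' hc'] := cpoly_translate c a; exists c' => z.
by rewrite -hc' Pc addrC.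
Qed.

Lemma centred_polyfun c a : polyfun k (fun x => cpoly c (x - a)).
Proof. by have [c' hc'] := cpoly_translate c (- a); exists c' => x; rewrite hc'. Qed.

End CentredPolynomials.

Lemma continuous_mulr (R : realType) (S : topologicalType) (g h : S -> R) :
  continuous g -> continuous h -> continuous (fun x => g x * h x).
Proof. by move=> cg ch x; apply: cvgM; [exact: cg|exact: ch]. Qed.

Lemma continuous_scaler (R : realType) (S : topologicalType) (W : normedModType R)
    (g : S -> R) (h : S -> W) :
  continuous g -> continuous h -> continuous (fun x => g x *: h x).
Proof. by move=> cg ch x; apply: cvgZ; [exact: cg|exact: ch]. Qed.

Lemma continuous_subr (R : realType) (S : topologicalType) (g h : S -> R) :
  continuous g -> continuous h -> continuous (fun x => g x - h x).
Proof. by move=> cg ch x; apply: cvgB; [exact: cg|exact: ch]. Qed.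

Lemma continuous_sum_mulr (R : realType) (S : topologicalType) (I : Type)
    (r : seq I) (P : pred I) (b : I -> R) (g : I -> S -> R) :
  (forall i, continuous (g i)) -> continuous (fun x => \sum_(i <- r | P i) b i * g i x).
Proof.
move=> cg; elim: r => [|i r IH] x.
  by under eq_fun do rewrite big_nil; exact: cvg_cst.
under eq_fun do rewrite big_cons.
case: ifPn => _; last exact: IH.
by apply: cvgD; [apply: cvgM; [exact: cvg_cst|exact: cg]|exact: IH].
Qed.

Section Moments.
Variables (R : realType) (n k : nat) (Y : normedModType R).
Local Notation V := 'rV[R]_n.
Local Notation X := (testfun n Y).
Local Notation index := {ffun 'I_n -> 'I_k.+1}.
Implicit Types (al be : index) (a b : V) (c : dual Y).

Definition moment al c (f : V -> Y) : R := rv_integral (fun z => mono al z * c (f z)).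

Lemma continuous_mono al : continuous (@mono R n k al).
Proof. exact/smooth_continuous/flat_ring_smooth/flat_ring_mono. Qed.

Lemma continuous_moment al c (f : V -> Y) : continuous f ->
  continuous (fun z => mono al z * c (f z) : R).
Proof.
move=> cf; apply: continuous_mulr; first exact: continuous_mono.
by move=> z; apply: continuous_comp; [exact: cf|exact: dual_continuous].
Qed.

Lemma vanish_moment j al c (f : V -> Y) : vanish j f ->
  vanish j (fun z => mono al z * c (f z)).
Proof. by move=> Zf z /Zf ->; rewrite dual0 mulr0. Qed.

Lemma moment_lin al c (b : R) (f g : X) :
  moment al c (b *: f + g) = b * moment al c f + moment al c g.
Proof.
have [jf Zf] := testfun_vanish f; have [jg Zg] := testfun_vanish g.
have Zf' : vanish (Num.max jf jg) f.
  by move=> x; rewrite gt_max => /andP[/Zf].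
have Zg' : vanish (Num.max jf jg) g.
  by move=> x; rewrite gt_max => /andP[_ /Zg].
have cf := smooth_continuous (testfun_smooth f).
have cg := smooth_continuous (testfun_smooth g).
rewrite /moment -(rv_integral_lin _ (@continuous_moment al c _ cf) (@continuous_moment al c _ cg)
  (@vanish_moment _ al c _ Zf') (@vanish_moment _ al c _ Zg')).
apply: rv_integral_ext => x; rewrite mulrCA -mulrDr; congr (_ * _).
by rewrite -dual_scale -dual_add.
Qed.

Lemma moment_bound j al c : exists C : R, forall (f : X) e,
  vanish j f -> deriv_le 0 e f -> `|moment al c f| <= C * e.
Proof.
have [K K0 hK] := dual_bounded_by c.
pose u (t : R) : R := t.
have [M M0 hM] : exists2 M, 0 <= M & forall x : V, `|x| <= j -> `|mono al x| <= M.
  exists (\prod_i `|j| ^+ al i) => [|x xj]; first by rewrite prodr_ge0// => i _; rewrite exprn_ge0.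
  rewrite /mono normr_prod; apply: ler_prod => i _.
  rewrite normr_ge0 normrX /= lerXn2r ?nnegrE//.
  by rewrite (le_trans (coord_norm _ _))// (le_trans xj)// ler_norm.
exists (M * K * cube_mass n j) => f e Zf De.
have fe x : `|f x| <= e by exact: (De [::]).
have e0 : 0 <= e := le_trans (normr_ge0 _) (fe 0).
have cf := smooth_continuous (testfun_smooth f).
rewrite mulrAC; apply: (rv_integral_bound (@continuous_moment al c _ cf) (@vanish_moment _ al c _ Zf)).
move=> x; have [xj|jx] := leP `|x| j; last first.
  by rewrite Zf// dual0 mulr0 normr0 !mulr_ge0.
rewrite normrM -mulrA ler_pM//; first exact: hM.
by rewrite (le_trans (hK _))// ler_wpM2l.
Qed.

Lemma rv_integral_sum (I : Type) (r : seq I) (P : pred I) j (g : I -> V -> R) (b : I -> R) :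
  (forall i, continuous (g i)) -> (forall i, vanish j (g i)) ->
  rv_integral (fun x => \sum_(i <- r | P i) b i * g i x) = \sum_(i <- r | P i) b i * rv_integral (g i).
Proof.
move=> cg Zg; elim: r => [|i r IH].
  have c0 : continuous (fun _ : V => 0 : R).
    exact: cst_continuous.
  have : `|rv_integral (fun _ : V => 0 : R)| <= 0 * cube_mass n 0.
    by apply: rv_integral_bound => // x; rewrite normr0.
  rewrite mul0r normr_le0 big_nil => /eqP E; rewrite -[RHS]E.
  by apply: rv_integral_ext => x; rewrite big_nil.
have cs := @continuous_sum_mulr R V I r P b g cg.
have Zs : vanish j (fun x => \sum_(i <- r | P i) b i * g i x).
  by move=> x jx; rewrite big1// => l _; rewrite Zg// mulr0.
rewrite big_cons -IH; case: ifPn => Pi.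
  rewrite -(rv_integral_lin _ (cg i) cs (Zg i) Zs); apply: rv_integral_ext => x.
  by rewrite big_cons Pi.
by apply: rv_integral_ext => x; rewrite big_cons (negbTE Pi).
Qed.

(** The substitution x = a + r z gives the factor r^n, and the homogeneity of the monomials the
    factors r^|al|. *)
Lemma poly_distribution_rescale (P : V -> dual Y) (c : index -> dual Y) a r (f : X) :
  0 < r -> (forall z, P (a + z) = cpoly c z) ->
  poly_distribution P (rescale f a r) =
  r ^+ n * \sum_(al | (deg al <= k)%N) r ^+ deg al * moment al (c al) f.
Proof.
move=> r0 Pc; have rn : r != 0 by rewrite gt_eqF.
have [j Zf] := testfun_vanish f.
have cf := smooth_continuous (testfun_smooth f).
pose G x := P x (rescale f a r x).
pose H z := \sum_(al | (deg al <= k)%N) r ^+ deg al * (mono al z * c al (f z)).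
have GH z : G (a + r *: z) = H z.
  rewrite /G /H Pc rescaleE// addrAC subrr add0r scalerA mulVf// scale1r.
  rewrite /cpoly; elim/big_rec2 : _ => [//|al u w _ <-].
  by rewrite mono_scale dualD dualZ mulrA.
have cH : continuous H.
  by apply: continuous_sum_mulr => al; exact: continuous_moment.
have GE x : G x = H (aff r^-1 a x).
  by rewrite -GH /aff scalerA mulfV// scale1r addrC subrK.
have cG : continuous G.
  move=> x; rewrite (_ : G = H \o aff r^-1 a); last exact/funext.
  apply: continuous_comp; last exact: cH.
  exact/differentiable_continuous/aff_diff.
have ZG : vanish (`|a| + r * j) G.
  by move=> x jx; rewrite /G (vanish_rescale r0 Zf (lexx _))// dual0.
transitivity (rv_integral G); first by [].
rewrite (rv_integral_affine a r0 cG ZG); congr (_ * _).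
rewrite (rv_integral_ext GH) /H.
rewrite (@rv_integral_sum _ _ _ j (fun al z => mono al z * c al (f z)))// => al.
  exact: continuous_moment.
exact: vanish_moment.
Qed.

End Moments.

Lemma deriv_scaler (R : realType) (n : nat) (W : normedModType R) (f : 'rV[R]_n -> R)
    (w : W) v : (forall x, differentiable f x) ->
  'D_v (fun x => f x *: w) = (fun x => 'D_v f x *: w).
Proof.
move=> df; apply/funext => x.
have dfc : differentiable (fun x => f x *: w) x by exact: differentiableZl.
have E1 := deriveE v dfc; have E2 := deriveE v (df x).
by rewrite E1 E2 (diffZl _ (df x)).
Qed.

Lemma iterD_scaler (R : realType) (n : nat) (W : normedModType R) (f : 'rV[R]_n -> R^o)
    (w : W) s : smooth f ->
  iterD s (fun x => f x *: w) = (fun x => iterD s f x *: w).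
Proof.
move=> sf; elim: s => //= v s ->; apply: deriv_scaler => x.
exact/smooth_diff/smooth_iterD.
Qed.

(** Convergence to 0 as r tends to 0+, with the thresholds 1/(i+1) that the decreasing index sets
    [pairs] and [radii] use; all radii considered are less than 1. *)
Definition small (R : realType) (g : R -> R) : Prop := forall e : R, 0 < e ->
  exists i, forall r, 0 < r -> r < i.+1%:R^-1 -> `|g r| <= e.

Section Small.
Variable R : realType.
Implicit Types g h : R -> R.

Lemma smallP g : small g <-> g r @[r --> 0^'+] --> (0 : R).
Proof.
split=> [sg|/(@cvgrPdist_le R R^o) cg e e0].
  apply/(@cvgrPdist_le R R^o) => e e0; have [i hi] := sg e e0.
  near=> r; rewrite sub0r normrN; apply: hi; near: r.
    exact: nbhs_right_gt.
  by apply: nbhs_right_lt; rewrite invr_gt0.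
have := cg e e0; rewrite near_withinE => /nbhs_ballP[d /= d0 hd].
have [i /(_ i (leqnn i)) hi] := invS_le d0.
exists i => r r0 ri; have := hd r; rewrite sub0r normrN; apply => //.
by rewrite /ball /= sub0r normrN gtr0_norm// (lt_le_trans ri).
Unshelve. all: by end_near. Qed.

Lemma small_ext g h : (forall r, 0 < r -> r < 1 -> g r = h r) -> small g -> small h.
Proof.
move=> gh sg e e0; have [i hi] := sg e e0; exists i => r r0 ri.
rewrite -gh//; first exact: hi.
by rewrite (lt_le_trans ri)// invf_le1// ler1n.
Qed.

Lemma small_add g h : small g -> small h -> small (fun r => g r + h r).
Proof.
move=> sg sh e e0; have [i hi] := sg _ (divr_gt0 e0 (ltr0n R 2)).
have [j hj] := sh _ (divr_gt0 e0 (ltr0n R 2)); exists (maxn i j) => r r0 rij.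
have le_inv p : (p <= maxn i j)%N -> r < p.+1%:R^-1.
  by move=> pi; rewrite (lt_le_trans rij)// lef_pV2 ?posrE// ler_nat.
have h1 := hi r r0 (le_inv _ (leq_maxl _ _)); have h2 := hj r r0 (le_inv _ (leq_maxr _ _)).
by rewrite (le_trans (ler_normD _ _))// (splitr e) lerD.
Qed.

Lemma small_scale a g : small g -> small (fun r => a * g r).
Proof.
move=> sg e e0; have a0 : 0 < `|a| + 1 by rewrite ltr_wpDl.
have [i hi] := sg _ (divr_gt0 e0 a0); exists i => r r0 ri.
rewrite normrM (@le_trans _ _ ((`|a| + 1) * `|g r|)) ?ler_wpM2r ?lerDl//.
by rewrite mulrC -ler_pdivlMr// hi.
Qed.

Lemma small0 : small (fun=> 0 : R).
Proof. by move=> e e0; exists 0%N => r _ _; rewrite normr0 ltW. Qed.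

Lemma small_sum (I : Type) (s : seq I) (P : pred I) (g : I -> R -> R) :
  (forall i, P i -> small (g i)) -> small (fun r => \sum_(i <- s | P i) g i r).
Proof.
move=> sg; elim: s => [|i s IH].
  by apply: small_ext small0 => r _ _; rewrite big_nil.
case Pi: (P i).
  by apply: small_ext (small_add (sg i Pi) IH) => r _ _; rewrite big_cons Pi.
by apply: small_ext IH => r _ _; rewrite big_cons Pi.
Qed.

Lemma small_cst (c : R) : small (fun=> c) -> c = 0.
Proof.
move=> sc; apply/eqP; rewrite -normr_eq0 eq_le normr_ge0 andbT.
apply/ler_addgt0Pr => e e0; rewrite add0r.
have [i hi] := sc e e0; apply: (hi (i.+2%:R^-1)); rewrite ?invr_gt0//.
by rewrite ltf_pV2 ?posrE// ltr_nat.
Qed.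

End Small.

Lemma dual_of_bounded (R : realType) (Y : normedModType R) (l : Y -> R) (C : R) :
  (forall b x y, l (b *: x + y) = b * l x + l y) ->
  (forall y, `|y| <= 1 -> `|l y| <= C) -> exists c : dual Y, forall y, c y = l y.
Proof.
move=> ll lC; suff p : dual_pred l by exists (Dual p).
apply/asboolP; split; first exact: ll.
pose h : {linear Y -> R^o} :=
  HB.pack (l : Y -> R^o) (GRing.isLinear.Build R Y R^o _ l ll).
suff : continuous h by [].
apply/bounded_linear_continuous/linear_boundedP.
exists `|C|; split; first exact: num_real.
move=> K CK y; have K0 : 0 <= K := le_trans (normr_ge0 C) (ltW CK).
have [->|y0] := eqVneq y 0; first by rewrite linear0 !normr0 mulr0.
have ny : 0 < `|y| by rewrite normr_gt0.
rewrite -ler_pdivrMr// -[_^-1]gtr0_norm ?invr_gt0// mulrC -normrZ -linearZ /=.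
apply: (le_trans (lC _ _)); last exact: (le_trans (ler_norm _) (ltW CK)).
by rewrite normrZ gtr0_norm ?invr_gt0// mulVf// gt_eqF.
Qed.

(** * Characterisation of pointwise differentiability *)

Section Coefficients.
Variables (R : realType) (n k : nat) (Y : completeNormedModType R).
Local Notation V := 'rV[R]_n.
Local Notation X := (testfun n Y).
Local Notation index := {ffun 'I_n -> 'I_k.+1}.
Implicit Types (f g : X) (al be : index) (a : V) (r : R) (y : Y).

Lemma dualtest_pred be y : testfun_pred (fun x : V => psi be x *: y).
Proof.
apply: (@testfunP R n Y 1); first by apply: smooth_scaler; exact/flat_ring_smooth/flat_ring_psi.
by move=> x /(vanish_psi be) ->; rewrite scale0r.
Qed.

Definition dualtest be y : X := TestFun (dualtest_pred be y).

Lemma dualtest_lin be (b : R) y y' :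
  dualtest be (b *: y + y') = b *: dualtest be y + dualtest be y'.
Proof.
apply/val_inj/funext => x /=; rewrite !fctE /=.
by rewrite scalerDr !scalerA mulrC.
Qed.

Lemma vanish_dualtest be y : vanish 1 (dualtest be y).
Proof. by move=> x /(vanish_psi be) x1; rewrite /= x1 scale0r. Qed.

Lemma moment_dualtest al be (c : dual Y) y :
  moment al c (dualtest be y) = (al == be)%:R * c y.
Proof.
have cmp : continuous (fun z => mono al z * psi be z : R).
  apply: continuous_mulr; first exact: continuous_mono.
  exact/(@smooth_continuous R n R^o)/flat_ring_smooth/flat_ring_psi.
have Zmp : vanish 1 (fun z : V => mono al z * psi be z).
  by move=> z z1; rewrite (@vanish_psi R n k be z z1) mulr0.
have := @rv_integral_sum R n unit [:: tt] xpredT 1 (fun _ (z : V) => mono al z * psi be z)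
  (fun=> c y) (fun=> cmp) (fun=> Zmp).
rewrite big_seq1 rv_integral_mono_psi mulrC => <-.
by apply: rv_integral_ext => z; rewrite big_seq1 /= dual_scale; ring.
Qed.

Lemma deriv_le_dualtest m be : exists2 M : R, 0 < M & forall y, `|y| <= 1 ->
  deriv_le m M (dualtest be y).
Proof.
have sp : smooth (@psi R n k be : V -> R^o) := flat_ring_smooth (flat_ring_psi R be).
have [M M0 HM] := @vanish_deriv_le R n R^o m 1 _ sp (vanish_psi be).
exists (M + 1); first by rewrite ltr_wpDl.
move=> y y1 s sm s1 x; rewrite (iterD_scaler y s sp) normrZ.
rewrite (le_trans (ler_piMr _ y1))// (le_trans (HM s sm s1 x))// lerDl//.
Qed.

Variable T : {linear X -> R^o}.
Hypothesis T_cont : continuous T.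

(* An approximation at scale r of the coefficient of index [be] of a jet of T at
   a, evaluated at y. *)
Definition coef be a r y : R :=
  r ^- (deg be + n) * T (rescale (dualtest be y) a r).

Lemma T_rescale_lin (b : R) f g a r : 0 < r ->
  T (rescale (b *: f + g) a r) = b * T (rescale f a r) + T (rescale g a r) :> R.
Proof. by move=> r0; rewrite rescale_lin ?gt_eqF// linearP. Qed.

Lemma coef_lin be a r (b : R) y y' : 0 < r ->
  coef be a r (b *: y + y') = b * coef be a r y + coef be a r y'.
Proof.
by move=> r0; rewrite /coef dualtest_lin T_rescale_lin// mulrDr mulrCA.
Qed.

Lemma coef_bound be a r : 0 < r -> r <= 1 ->
  exists C, forall y, `|y| <= 1 -> `|coef be a r y| <= C.
Proof.
move=> r0 r1; have [m [C [C0 H]]] := rescale_bound T_cont a 1.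
have [M M0 HM] := deriv_le_dualtest m be.
exists (`|r ^- (deg be + n)| * (C * ((1 + r^-1) ^+ m * M))) => y y1.
rewrite normrM ler_wpM2l//; apply: H => //; first exact: vanish_dualtest.
exact: HM.
Qed.

Lemma continuous_coef be r y : 0 < r -> continuous (fun a => coef be a r y).
Proof.
move=> r0; apply: continuous_mulr; first exact: cst_continuous.
exact: continuous_rescale.
Qed.

(* r^(-k-n) (T - S)(f((x - a) / r)), where S is given by the polynomial with
   coefficients c centred at a. *)
Definition jet_error (c : index -> dual Y) f a r : R := r ^- (k + n) *
  (T (rescale f a r) -
   r ^+ n * \sum_(al | (deg al <= k)%N) r ^+ deg al * moment al (c al) f).

Lemma pt_jet_error P c a : (forall z, P (a + z) = cpoly c z) ->
  pt_jet T k a P <-> forall f, small (jet_error c f a).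
Proof.
move=> Pc; have E f r : 0 < r -> r < 1 ->
    r ^- (k + n) * (T (rescale f a r) - poly_distribution P (rescale f a r)) =
    jet_error c f a r.
  by move=> r0 _; rewrite (poly_distribution_rescale _ r0 Pc).
split=> [[_ H] f|H]; first exact: small_ext (E f) ((smallP _).2 (H f)).
split=> [|f].
  rewrite (_ : P = fun x => cpoly c (x - a)); first exact: centred_polyfun.
  by apply/funext => x; rewrite -Pc addrC subrK.
apply/(@smallP R); apply: small_ext (H f) => r r0 r1.
by rewrite E.
Qed.

Lemma jet_error_lin c (b : R) f g a r : 0 < r ->
  jet_error c (b *: f + g) a r = b * jet_error c f a r + jet_error c g a r.
Proof.
move=> r0; rewrite /jet_error T_rescale_lin//.
have -> : \sum_(al | (deg al <= k)%N) r ^+ deg al * moment al (c al) (b *: f + g : X) =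
    b * (\sum_(al | (deg al <= k)%N) r ^+ deg al * moment al (c al) f) +
    \sum_(al | (deg al <= k)%N) r ^+ deg al * moment al (c al) g.
  rewrite mulr_sumr -big_split; apply: eq_bigr => al _ /=.
  by rewrite (moment_lin al (c al) b f g) mulrDr mulrCA.
ring.
Qed.

End Coefficients.

Section Characterisation.
Variables (R : realType) (n k : nat) (Y : completeNormedModType R).
Local Notation V := 'rV[R]_n.
Local Notation X := (testfun n Y).
Local Notation index := {ffun 'I_n -> 'I_k.+1}.
Implicit Types (f g : X) (al be : index) (a : V) (r : R) (y : Y).

Variable T : {linear X -> R^o}.
Hypothesis T_cont : continuous T.

(** Biorthogonality leaves a single moment. Hence on the functions psi_be y the jet condition says
    precisely that [coef] converges with error o(r^(k - |be|)). *)
Lemma jet_error_dualtest (c : index -> dual Y) be y a r : 0 < r -> (deg be <= k)%N ->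
  jet_error T c (dualtest be y) a r =
  r ^- (k - deg be) * (coef T be a r y - c be y).
Proof.
move=> r0 bk; rewrite /jet_error /coef (bigD1 be)//= big1 => [|al /andP[_ ab]]; last first.
  by rewrite moment_dualtest (negbTE ab) mul0r mulr0.
rewrite moment_dualtest eqxx mul1r addr0.
have -> : (k + n = (k - deg be) + (deg be + n))%N by rewrite addnA subnK.
have p0 m : r ^+ m != 0 by rewrite expf_neq0// gt_eqF.
rewrite exprD invfM -mulrA mulrBr; congr (_ * (_ - _)).
by rewrite mulrA -exprD addnC mulrA mulVf// mul1r.
Qed.

Lemma jet_error_moment0 (c : index -> dual Y) f a r :
  (forall al, (deg al <= k)%N -> moment al (c al) f = 0) ->
  jet_error T c f a r = r ^- (k + n) * T (rescale f a r).
Proof.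
by move=> mf; rewrite /jet_error big1 ?mulr0 ?subr0// => al /mf ->; rewrite mulr0.
Qed.

Lemma jet_error_sum (c : index -> dual Y) (I : Type) (s : seq I) (P : pred I)
    (g : I -> X) a r : 0 < r ->
  jet_error T c (\sum_(i <- s | P i) g i) a r =
  \sum_(i <- s | P i) jet_error T c (g i) a r.
Proof.
move=> r0; have E0 : jet_error T c 0 a r = 0.
  have := jet_error_lin T c 1 0 0 a r0.
  by rewrite scaler0 addr0 mul1r; lra.
apply: (big_morph (fun f => jet_error T c f a r)) => // f g'.
by have := jet_error_lin T c 1 f g' a r0; rewrite scale1r mul1r.
Qed.

Definition pairs (i : nat) : set (R * R) :=
  [set rs | [/\ 0 < rs.2, rs.2 <= rs.1 & rs.1 < i.+1%:R^-1]].

Definition radii (i : nat) : set R := [set r | 0 < r /\ r < i.+1%:R^-1].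

(** The weight is taken at the larger radius, so that the smaller one may tend to 0 while the other
    is fixed; this yields the error estimate for the limit. *)
Definition coef_diff be a (rs : R * R) y : R :=
  rs.1 ^- (k - deg be) * (coef T be a rs.1 y - coef T be a rs.2 y).

(* [coef] converges with error o(r^(k - |be|)); the Cauchy form does not mention
   the limit, so that it defines a Borel set of points a. *)
Definition coef_cauchy be a := forall y, setT y -> forall e : R, 0 < e ->
  exists i, forall rs, pairs i rs -> `|coef_diff be a rs y| <= e.

Definition null_moments : set (X -> R) :=
  [set l | exists al c, (deg al <= k)%N /\ l = (fun f => moment al c f)].

Definition remainder_small (j : nat) a := forall f, test_subspace j%:R null_moments f ->
  forall e : R, 0 < e -> exists i, forall r, radii i r ->
  `|r ^- (k + n) * T (rescale f a r)| <= e.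

Lemma pairs_decr i j : (i <= j)%N -> pairs j `<=` pairs i.
Proof.
move=> ij [r s] [/= s0 sr rj]; split=> //=.
by rewrite (lt_le_trans rj)// lef_pV2 ?posrE// ler_nat.
Qed.

Lemma radii_decr i j : (i <= j)%N -> radii j `<=` radii i.
Proof.
move=> ij r [r0 rj]; split=> //.
by rewrite (lt_le_trans rj)// lef_pV2 ?posrE// ler_nat.
Qed.

Lemma radii_lt1 i r : radii i r -> r < 1.
Proof. by move=> /(@radii_decr 0%N i (leq0n _))[_]; rewrite invr1. Qed.

Lemma coef_cauchy_of_jet (c : index -> dual Y) be a : (deg be <= k)%N ->
  (forall f, small (jet_error T c f a)) -> coef_cauchy be a.
Proof.
move=> bk jc y _ e e0.
have [i hi] := jc (dualtest be y) (e / 2) (divr_gt0 e0 (ltr0n R 2)).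
exists i => -[r s] [/= s0 sr ri].
have r0 : 0 < r := lt_le_trans s0 sr.
have := hi r r0 ri; have := hi s s0 (le_lt_trans sr ri).
rewrite !jet_error_dualtest// /coef_diff /=; set d := (k - deg be)%N => hs hr.
have rd : 0 < r ^+ d by rewrite exprn_gt0.
have sd : 0 < s ^+ d by rewrite exprn_gt0.
have sdrd : s ^+ d <= r ^+ d by rewrite lerXn2r ?nnegrE ?(ltW r0) ?(ltW s0).
(* As s <= r, the weight r^-d is at most s^-d. *)
have {}hs : `|r ^- d * (coef T be a s y - c be y)| <= e / 2.
  apply: le_trans hs; rewrite !normrM ler_wpM2r// !gtr0_norm ?invr_gt0//.
  by rewrite lef_pV2 ?posrE.
move: hs hr; move: (coef T be a r y) (coef T be a s y) (c be y) => u v w hs hr.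
have -> : u - v = (u - w) - (v - w) by rewrite opprB addrA subrK.
by rewrite mulrBr (le_trans (ler_normB _ _))// (splitr e) lerD.
Qed.

Lemma remainder_small_of_jet (c : index -> dual Y) j a :
  (forall f, small (jet_error T c f a)) -> remainder_small j a.
Proof.
move=> jc f [_ mf] e e0; have [i hi] := jc f e e0.
exists i => r [r0 ri]; rewrite -(@jet_error_moment0 c); first exact: hi.
by move=> al ak; apply: (mf (fun f => moment al (c al) f)); exists al, (c al).
Qed.

Lemma pow_inv_ge1 r m : 0 < r -> r < 1 -> 1 <= r ^- m.
Proof. by move=> r0 r1; rewrite invf_ge1 ?exprn_gt0// exprn_ile1 ?ltW. Qed.

Lemma coef_limit be a y : coef_cauchy be a -> exists l : R,
  small (fun r => r ^- (k - deg be) * (coef T be a r y - l)).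
Proof.
(* 1/(p+2) lies strictly below the threshold 1/(i+1) as soon as p >= i. *)
move=> /(_ y Logic.I) cc; pose u (p : nat) := coef T be a p.+2%:R^-1 y.
have u0 p : 0 < p.+2%:R^-1 :> R by rewrite invr_gt0.
have ui i p : (i <= p)%N -> p.+2%:R^-1 < i.+1%:R^-1 :> R.
  by move=> ip; rewrite ltf_pV2 ?posrE// ltr_nat !ltnS.
have key (e : R) : 0 < e -> exists i, forall r p, radii i r -> (i <= p)%N ->
    p.+2%:R^-1 <= r -> `|r ^- (k - deg be) * (coef T be a r y - u p)| <= e.
  move=> /cc[i hi]; exists i => r p [r0 ri] ip pr.
  have P : pairs i (r, p.+2%:R^-1) by split=> //=; exact: u0.
  exact: (hi _ P).
have [l hl] : exists l : R^o, forall e : R, 0 < e -> exists N, forall p,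
    (N <= p)%N -> `|l - u p| <= e.
  apply: (@complete_eps R R^o) => e e0; have [i hi] := key e e0.
  have H p q : (i <= p)%N -> (p <= q)%N -> `|u p - u q| <= e.
    move=> ip pq; have qp : q.+2%:R^-1 <= p.+2%:R^-1 :> R.
      by rewrite lef_pV2 ?posrE// ler_nat.
    apply: (le_trans _ (hi _ q (conj (u0 p) (ui i p ip)) (leq_trans ip pq) qp)).
    rewrite normrM -[leLHS]mul1r ler_wpM2r// (le_trans _ (ler_norm _))//.
    apply: pow_inv_ge1 => //; apply: radii_lt1 (conj (u0 p) (ui i p ip)).
  exists i => p q ip iq; have [pq|/ltnW qp] := leqP p q; first exact: H.
  by rewrite distrC; exact: H.
exists l => e e0; have e20 := divr_gt0 e0 (ltr0n R 2).
have [i hi] := key _ e20; exists i => r r0 ri.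
have rd : 0 < r ^+ (k - deg be) by rewrite exprn_gt0.
(* p is chosen after r, so close to the limit that the weight r^-(k - |be|) does no harm. *)
have [N hN] := hl _ (mulr_gt0 rd e20).
have [M hM] := invS_le r0.
pose p := maxn i (maxn N M).
have ip : (i <= p)%N by rewrite leq_max leqnn.
have Np : (N <= p)%N by rewrite /p !leq_max leqnn orbT.
have Mp : (M <= p)%N by rewrite /p !leq_max leqnn !orbT.
have pr : p.+2%:R^-1 <= r.
  by rewrite (le_trans _ (hM p Mp))// lef_pV2 ?posrE// ler_nat.
have h1 := hi r p (conj r0 ri) ip pr; have h2 := hN p Np.
have -> : coef T be a r y - l = (coef T be a r y - u p) - (l - u p).
  by rewrite opprB addrA subrK.
rewrite mulrBr (le_trans (ler_normB _ _))// (splitr e) lerD//.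
by rewrite normrM gtr0_norm ?invr_gt0// ler_pdivrMl.
Qed.

(* The limit is continuous in y by uniform boundedness. *)
Lemma coef_limit_dual be a : coef_cauchy be a -> exists c : dual Y,
  forall y, small (fun r => r ^- (k - deg be) * (coef T be a r y - c y)).
Proof.
move=> cc; have /choice[l hl] : forall y, exists l : R,
    small (fun r => r ^- (k - deg be) * (coef T be a r y - l)).
  by move=> y; exact: coef_limit.
have ll (b : R) x y : l (b *: x + y) = b * l x + l y.
  apply/eqP; rewrite -subr_eq0; apply/eqP; apply: small_cst.
  have sl z : small (fun r => coef T be a r z - l z).
    move=> e e0; have [i hi] := hl z e e0; exists i => r r0 ri.
    apply: (le_trans _ (hi r r0 ri)).
    rewrite normrM -[leLHS]mul1r ler_wpM2r// (le_trans _ (ler_norm _))//.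
    by apply: pow_inv_ge1 => //; exact: radii_lt1 (conj r0 ri).
  have := small_add (small_scale (-1) (sl (b *: x + y)))
    (small_add (small_scale b (sl x)) (sl y)).
  apply: small_ext => r r0 _; rewrite coef_lin//.
  by move: (coef T be a r x) (coef T be a r y) => u v; ring.
suff [C hC] : exists C, forall y, `|y| <= 1 -> `|l y| <= C.
  have [c hc] := dual_of_bounded ll hC; exists c => y.
  by rewrite hc.
have G := gauge_normed Y.
(* The principle is applied to the weighted differences, which tend to 0 as its hypothesis requires.
   At one fixed radius [coef] is bounded by the finite order of T, and the differences carry this
   bound to all smaller radii. *)
have [||||i hi] := @uniform_boundedness R Y setT (@norm_gauge R Y) G
    {rs | pairs 0 rs} (fun i => [set t | pairs i (sval t)])
    (fun t => coef_diff be a (sval t)) 0%N (@gauge_complete_normed R Y).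
- by move=> i j ij t; exact: pairs_decr.
- move=> [[r s] [/= s0 sr r1]] b x y; rewrite /coef_diff /=.
  rewrite !coef_lin ?(lt_le_trans s0)//.
  move: (coef T be a r x) (coef T be a r y) (coef T be a s x) (coef T be a s y).
  by move=> u v u' v'; ring.
- move=> [[r s] [/= s0 sr]]; rewrite invr1 => r1.
  have r0 := lt_le_trans s0 sr.
  have [C hC] := coef_bound T_cont be a r0 (ltW r1).
  have [C' hC'] := coef_bound T_cont be a s0 (le_trans sr (ltW r1)).
  exists (`|r ^- (k - deg be)| * (C + C')) => y _ y1; rewrite /coef_diff /= normrM.
  by rewrite ler_wpM2l// (le_trans (ler_normB _ _))// lerD ?hC ?hC'.
- move=> x _; have [|i hi] := cc x Logic.I 2^-1; first by lra.
  by exists i => t; exact: hi.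
pose r : R := i.+2%:R^-1.
have r0 : 0 < r by rewrite invr_gt0.
have ri : r < i.+1%:R^-1 by rewrite ltf_pV2 ?posrE// ltr_nat.
have r1 : r < 1 := radii_lt1 (conj r0 ri).
have [C hC] := coef_bound T_cont be a r0 (ltW r1).
(* C bounds [coef] at r, i its difference between r and s, whose weight is at least 1, and 1 the
   distance from [coef] at s to the limit; of the two radii only s depends on y. *)
exists (C + i%:R + 1) => y y1.
have [j hj] := hl y 1 ltr01.
pose s : R := (maxn i j).+2%:R^-1.
have s0 : 0 < s by rewrite invr_gt0.
have sr : s <= r by rewrite lef_pV2 ?posrE// ler_nat !ltnS leq_maxl.
have sj : s < j.+1%:R^-1 by rewrite ltf_pV2 ?posrE// ltr_nat !ltnS leq_maxr.
have P : pairs i (r, s) by [].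
have h1 : `|coef T be a s y - l y| <= 1.
  apply: (le_trans _ (hj s s0 sj)).
  rewrite normrM -[leLHS]mul1r ler_wpM2r// (le_trans _ (ler_norm _))//.
  by apply: pow_inv_ge1 => //; exact: radii_lt1 (conj s0 sj).
have h2 : `|coef T be a r y - coef T be a s y| <= i%:R.
  have := hi y Logic.I y1 (exist _ (r, s) (pairs_decr (leq0n i) P)) P.
  apply: le_trans; rewrite /coef_diff /=.
  rewrite normrM -[leLHS]mul1r ler_wpM2r// (le_trans _ (ler_norm _))//.
  exact: pow_inv_ge1.
have h3 := hC y y1.
move: h1 h2 h3; move: (coef T be a r y) (coef T be a s y) (l y) => u v w h1 h2 h3.
have := ler_distD u w 0; have := ler_distD v u w; rewrite !subr0 (distrC u w); lra.
Qed.

End Characterisation.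

Section Differentiability.
Variables (R : realType) (n k : nat) (Y : completeNormedModType R).
Variables (dd : nat -> Y) (dd_dense : dense_seq dd).
Local Notation V := 'rV[R]_n.
Local Notation X := (testfun n Y).
Local Notation index := {ffun 'I_n -> 'I_k.+1}.
Implicit Types (f g : X) (al be : index) (a : V) (r : R) (y : Y).

Variable T : {linear X -> R^o}.
Hypothesis T_cont : continuous T.

Local Notation null_moments := (@null_moments R n k Y).
Local Notation coef_cauchy be := (@coef_cauchy R n k Y T be).
Local Notation remainder_small j := (@remainder_small R n k Y T j).

(** The vector [y be] is the moment of f of index [be], a weak integral in Y; by biorthogonality,
    subtracting psi_be y_be cancels this moment and leaves the others unchanged. *)
Lemma null_moments_decomposition f : exists (y : index -> Y) (j : nat),
  test_subspace j%:R null_moments (f - \sum_(be | (deg be <= k)%N) dualtest be (y be)).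
Proof.
have [j0 Zf] := testfun_vanish f.
have cf := smooth_continuous (testfun_smooth f).
have /choice[y hy] : forall be, exists y, forall c : dual Y,
    c y = moment be c f.
  move=> be; have [||y hy] := @weak_integral R n Y j0 (fun z => mono be z *: f z) dd dd_dense.
  - exact: continuous_scaler (@continuous_mono R n k be) cf.
  - by move=> z jz; rewrite Zf// scaler0.
  - by exists y => c; rewrite hy; apply: rv_integral_ext => z; rewrite dual_scale.
(* N covers the support of f and, being at least 1, those of the psi_be; it is an integer so that
   countably many radii suffice. *)
have [N [jN N1]] : exists N : nat, j0 <= N%:R /\ 1 <= N%:R :> R.
  exists (Num.truncn `|j0|).+1; rewrite ler1n; split=> //.
  by rewrite (le_trans (ler_norm _))// ltW// truncnS_gt.
exists y, N; split=> [|_ [al [c [ak ->]]]].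
  set g := \sum_(be | _) _; suff Zg : vanish N%:R g.
    move=> x Nx; have Zfx : f x = 0 by apply: Zf; exact: le_lt_trans Nx.
    by rewrite /= !fctE Zfx Zg// subr0.
  apply: (big_ind (fun g : X => vanish N%:R g)) => [//|g1 g2 Z1 Z2 x Nx|be _ x Nx].
    by rewrite /= !fctE Z1// Z2// addr0.
  by apply: vanish_dualtest; exact: le_lt_trans Nx.
pose l (g : X) := moment al c g.
have lD g1 g2 : l (g1 + g2) = l g1 + l g2.
  by have := moment_lin al c 1 g1 g2; rewrite scale1r mul1r.
have l0 : l 0 = 0 by have := lD 0 0; rewrite addr0; move: (l 0) => u; lra.
have lN g1 : l (- g1) = - l g1.
  by have := moment_lin al c (-1) g1 0; rewrite scaleN1r mulN1r addr0 -/(l 0) l0 addr0.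
rewrite -/(l _) lD lN (big_morph l lD l0).
rewrite (bigD1 al)//= big1 => [|be /andP[_ ba]].
  by rewrite addr0 /l moment_dualtest eqxx mul1r hy subrr.
by rewrite /l moment_dualtest eq_sym (negbTE ba) mul0r.
Qed.

Lemma pt_differentiableP a : pt_differentiable T k a <->
  (forall be, (deg be <= k)%N -> coef_cauchy be a) /\
  (forall j, remainder_small j a).
Proof.
split=> [[P jP]|[cc rs]].
  have [c hc] := polyfun_centred a jP.1.
  have H := (pt_jet_error T hc).1 jP; split=> [be bk|j].
    exact: (coef_cauchy_of_jet bk H).
  exact: (remainder_small_of_jet H).
have /choice[c hc] : forall be, exists c : dual Y, (deg be <= k)%N ->
    forall y, small (fun r => r ^- (k - deg be) * (coef T be a r y - c y)).
  move=> be; case: (leqP (deg be) k) => [bk|_]; last by exists 0.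
  by have [c hc] := coef_limit_dual T_cont (cc be bk); exists c.
exists (fun x => cpoly c (x - a)).
apply/(@pt_jet_error R n k Y T _ c) => [z|f]; first by rewrite addrAC subrr add0r.
have [y [j hS]] := null_moments_decomposition f.
set g := \sum_(be | _) _ in hS.
have sr : small (jet_error T c (f - g) a).
  apply: (@small_ext R (fun r => r ^- (k + n) * T (rescale (f - g) a r))) => [r r0 _|e e0].
    rewrite jet_error_moment0// => al ak.
    by apply: (hS.2 (fun f => moment al (c al) f)); exists al, (c al).
  by have [i hi] := rs j _ hS e e0; exists i => r r0 ri; exact: hi.
have sg : small (fun r => \sum_(be | (deg be <= k)%N) jet_error T c (dualtest be (y be)) a r).
  apply: small_sum => be bk; apply: small_ext (hc be bk (y be)) => r r0 _.
  by rewrite jet_error_dualtest.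
apply: small_ext (small_add sr sg) => r r0 _.
rewrite -jet_error_sum// -/g.
by have := jet_error_lin T c 1 (f - g) g a r0; rewrite scale1r mul1r subrK.
Qed.

Lemma measurable_coef_cauchy be :
  measurable ([set a | coef_cauchy be a] : set (borel V)).
Proof.
apply: (@measurable_ptwise_cvg0 R V Y setT (@norm_gauge R Y)
  (gauge_normed Y) (R * R)%type (@pairs R) (fun a => coef_diff T be a)).
- exact: gauge_complete_normed.
- exact: gauge_separable_normed dd_dense.
- exact: pairs_decr.
- move=> a [r s] [/= s0 sr _] x y b; have r0 := lt_le_trans s0 sr.
  rewrite /coef_diff /= !coef_lin//.
  move: (coef T be a r x) (coef T be a r y) (coef T be a s x) (coef T be a s y).
  by move=> u v u' v'; ring.
- move=> a; exists 0%N => -[r s] [/= s0 sr]; rewrite invr1 => r1.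
  have r0 := lt_le_trans s0 sr.
  have [C hC] := coef_bound T_cont be a r0 (ltW r1).
  have [C' hC'] := coef_bound T_cont be a s0 (le_trans sr (ltW r1)).
  exists (`|r ^- (k - deg be)| * (C + C')) => y _ y1; rewrite /coef_diff /= normrM.
  by rewrite ler_wpM2l// (le_trans (ler_normB _ _))// lerD ?hC ?hC'.
- move=> [r s] y [/= s0 sr _] _; have r0 := lt_le_trans s0 sr.
  apply: continuous_mulr; first exact: cst_continuous.
  exact: (continuous_subr (continuous_coef T_cont r0) (continuous_coef T_cont s0)).
Qed.

Lemma measurable_remainder_small j :
  measurable ([set a | remainder_small j a] : set (borel V)).
Proof.
have ml l : null_moments l -> forall b f g, l (b *: f + g) = b * l f + l g.
  by move=> [al [c [_ ->]]] b f g; exact: moment_lin.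
have mb l : null_moments l -> exists C : R, forall f e,
    vanish j%:R f -> deriv_le 0 e f -> `|l f| <= C * e.
  by move=> [al [c [_ ->]]]; exact: moment_bound.
apply: (@measurable_ptwise_cvg0 R V X _ _ (gauge_test j%:R ml) R (@radii R)
  (fun a r f => r ^- (k + n) * T (rescale f a r))).
- exact: gauge_complete_test.
- exact: gauge_separable_test dd_dense.
- exact: radii_decr.
- by move=> a r [r0 _] f g b; rewrite T_rescale_lin// mulrDr mulrCA.
- move=> a; have [m [C [C0 H]]] := rescale_bound T_cont a j%:R.
  exists m => r [r0]; rewrite invr1 => r1.
  exists (`|r ^- (k + n)| * (C * ((1 + r^-1) ^+ m * 1))) => f [Zf _] Df.
  by rewrite normrM ler_wpM2l//; apply: H => //; exact: ltW.
- move=> r f [r0 _] _.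
  apply: continuous_mulr; first exact: cst_continuous.
  exact: continuous_rescale.
Qed.

Lemma measurable_pt_differentiable :
  measurable ([set a | pt_differentiable T k a] : set (borel V)).
Proof.
rewrite (_ : [set a | _] =
  (\bigcap_(be in [set be : index | (deg be <= k)%N]) [set a | coef_cauchy be a]) `&`
  \bigcap_j [set a | remainder_small j a]); last first.
  apply/seteqP; split=> a /=.
    by move=> /pt_differentiableP[h1 h2]; split=> [be /= /h1//|j _]; exact: h2.
  by move=> [h1 h2]; apply/pt_differentiableP; split=> [be /h1//|j]; exact: h2.
apply: measurableI.
  apply: countable_bigcap_measurable => [|be _]; first exact: countableP.
  exact: measurable_coef_cauchy.
by apply: bigcapT_measurable => j; exact: measurable_remainder_small.
Qed.

End Differentiability.

(** * The pointwise differential *)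

Section DualNorm.
Variables (R : realType) (Y : normedModType R).
Implicit Types (g : dual Y).

Lemma dual_norm_ge g y : `|g y| <= `|g| * `|y|.
Proof.
have [K K0 hK] := dual_bounded_by g.
have bg : bounded_on (Z := R^o) [set y : Y | `|y| <= 1] g.
  by exists K => z /= z1; rewrite (le_trans (hK z))// ler_piMr.
have [->|y0] := eqVneq y 0; first by rewrite dual0 !normr0 mulr0.
have ny : 0 < `|y| by rewrite normr_gt0.
have := @supnorm_ub R Y R^o _ _ (`|y|^-1 *: y) bg.
rewrite /= normrZ gtr0_norm ?invr_gt0// mulVf ?gt_eqF// => /(_ (lexx _)).
by rewrite dual_scale normrM gtr0_norm ?invr_gt0// ler_pdivrMl// mulrC.
Qed.

Lemma dual_norm_le g t : 0 <= t -> (forall y, `|g y| <= t * `|y|) -> `|g| <= t.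
Proof.
move=> t0 gt; apply: (@supnorm_le R Y R^o).
  by exists 0; rewrite /= normr0.
by move=> y /= y1; rewrite (le_trans (gt y))// ler_piMr.
Qed.

(** The bounds are homogeneous because the points of the dense sequence need not lie in the unit
    ball; the a priori finite norm of g controls the passage to an arbitrary y. *)
Lemma dual_norm_dense (d : nat -> Y) g t : dense_seq d -> 0 <= t ->
  (forall m, `|g (d m)| <= t * `|d m|) -> `|g| <= t.
Proof.
move=> dd t0 gd; apply: dual_norm_le => // y.
apply/ler_addgt0Pr => e e0.
have q0 : 0 < t + `|g| + 1 by rewrite ltr_wpDl// addr_ge0.
have [m hm] := dd y _ (divr_gt0 e0 q0).
have h1 : `|g y - g (d m)| <= `|g| * `|y - d m|.
  by rewrite -dual_sub; exact: dual_norm_ge.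
have h2 : `|d m| <= `|y| + `|y - d m|.
  by have := ler_normB y (y - d m); rewrite opprB addrC subrK.
have h3 : t * `|d m| <= t * (`|y| + `|y - d m|) by rewrite ler_wpM2l.
have h4 : (t + `|g|) * `|y - d m| <= e.
  apply: (@le_trans _ _ ((t + `|g| + 1) * `|y - d m|)).
    by rewrite ler_wpM2r// lerDl.
  by rewrite mulrC -ler_pdivlMr// ltW.
have h5 := ler_distD (g (d m)) (g y) 0; rewrite !subr0 in h5.
have h6 := gd m; rewrite mulrDr in h3; rewrite mulrDl in h4.
lra.
Qed.

End DualNorm.

Section SymmultiTensor.
Variables (R : realType) (n m : nat) (W : normedModType R).

(* Boundedness of f on the unit ball comes from the junk value [sup A = 0] for
   unbounded A: if [`|f|] is nonzero, the supremum is a genuine one. *)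
Lemma symmulti_norm_ge (Z : normedModType R) (f : symmulti n m Z) v :
  (forall j, enorm (v j) <= 1) -> `|f v| <= `|f|.
Proof.
move=> v1; have [f0|f0] := eqVneq `|f| 0.
  by move/normr0_eq0 : f0 => ->; rewrite !normr0.
pose B := [set v : 'I_m -> 'rV[R]_n | forall j, enorm (v j) <= 1].
have hs : has_sup [set `|f x| | x in B].
  have E : `|f| = sup [set `|f x| | x in B] by [].
  by apply: contrapT => /sup_out s0; move: f0; rewrite E s0 eqxx.
by apply: ub_le_sup; [case: hs|exists v].
Qed.

Lemma symmulti_norm_le (Z : normedModType R) (f : symmulti n m Z) t :
  (forall v, (forall j, enorm (v j) <= 1) -> `|f v| <= t) -> `|f| <= t.
Proof.
move=> ft; apply: supnorm_le; last exact: ft.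
by exists (fun=> 0) => j /=; rewrite enorm0 ler01.
Qed.

Lemma tensor_pred (M : symmulti n m R^o) (w : W) : symmulti_pred (fun v => M v *: w).
Proof.
apply/asboolP; split=> [v i a u u'|v s]; last by rewrite (symmulti_sym M).
by rewrite (symmultiP M) scalerDl scalerA.
Qed.

Definition tensor (M : symmulti n m R^o) (w : W) : symmulti n m W :=
  SymMulti (tensor_pred M w).

Lemma tensorB M x y : tensor M (x - y) = tensor M x - tensor M y.
Proof. by apply/val_inj/funext => v /=; rewrite !fctE /= scalerBr. Qed.

Lemma tensor_norm M x : `|tensor M x| <= `|M| * `|x|.
Proof.
apply: symmulti_norm_le => v v1; rewrite /= normrZ ler_wpM2r//.
exact: symmulti_norm_ge.
Qed.

End SymmultiTensor.

(** |l a - q| < e holds iff for some p all late [u i a] satisfy |u i a - q| <= e - 1/(p+1), a closed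
    condition for each p and each starting index; the gap keeps the inequality strict in the
    limit. *)
Lemma measurable_limit_ball (R : realType) (V : ptopologicalType) (A : set (borel V))
    (u : nat -> V -> R) (l : V -> R) (q e : R) :
  measurable A -> (forall i, continuous (u i)) ->
  (forall a, A a -> forall t : R, 0 < t -> exists N, forall i, (N <= i)%N ->
     `|l a - u i a| <= t) ->
  measurable (A `&` [set a | `|l a - q| < e]).
Proof.
move=> mA cu lu.
rewrite (_ : _ `&` _ = A `&` \bigcup_p \bigcup_N
   [set a | forall i, [set i | (N <= i)%N] i -> `|u i a - q| <= e - p.+1%:R^-1]).
  apply: measurableI => //; apply: bigcupT_measurable => p.
  apply: bigcupT_measurable => N; apply: borel_closed.
  apply: (@closed_norm_le R V nat _ (fun i a => u i a - q)) => i _.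
  by apply: continuous_subr; [exact: cu|exact: cst_continuous].
apply/seteqP; split=> a [Aa].
  move=> /= lq; split=> //; have d0 : 0 < (e - `|l a - q|) / 2 by lra.
  have [p /(_ p (leqnn p)) hp] := invS_le d0; have [N hN] := lu a Aa _ d0.
  exists p => //; exists N => // i /= Ni.
  have := hN i Ni; have := ler_distD (l a) (u i a) q; rewrite (distrC (u i a) (l a)).
  by move: (p.+1%:R^-1 : R) hp => z *; lra.
move=> [p _ [N _ /= hN]]; split=> //=.
have t0 : 0 < p.+1%:R^-1 / 2 :> R by rewrite divr_gt0 ?invr_gt0.
have [M hM] := lu a Aa _ t0.
have h1 := hM _ (leq_maxr N M); have h2 := hN _ (leq_maxl N M).
have := ler_distD (u (maxn N M) a) (l a) q.
have : 0 < p.+1%:R^-1 :> R by rewrite invr_gt0.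
by move: (p.+1%:R^-1 : R) h1 h2 => z *; lra.
Qed.

Lemma measurable_setI_norm_le (R : realType) d (X : measurableType d) (A : set X)
    (l : X -> R) (q : R) :
  (forall e, measurable (A `&` [set a | `|l a - q| < e])) ->
  forall e, measurable (A `&` [set a | `|l a - q| <= e]).
Proof.
move=> mo e; rewrite (_ : _ `&` _ = \bigcap_p (A `&` [set a | `|l a - q| < e + p.+1%:R^-1])).
  by apply: bigcapT_measurable => p; exact: mo.
apply/seteqP; split=> a.
  move=> [Aa /= le] p _; split=> //=.
  by rewrite (le_lt_trans le)// ltrDl invr_gt0.
move=> H; have [Aa _] := H 0%N Logic.I; split=> //=.
apply/ler_addgt0Pr => t t0; have [p /(_ p (leqnn p)) hp] := invS_le t0.
have [_ /= h] := H p Logic.I; move: (p.+1%:R^-1 : R) hp h => z *; lra.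
Qed.

Section PointwiseDifferential.
Variables (R : realType) (n k : nat) (Y : completeNormedModType R).
Local Notation V := 'rV[R]_n.
Local Notation X := (testfun n Y).
Local Notation index := {ffun 'I_n -> 'I_k.+1}.
Implicit Types (f g : X) (al be : index) (a : V) (r : R) (y : Y).

Lemma iterD_shift (W : normedModType R) s (f : V -> W) a : smooth f ->
  iterD s (fun x => f (x - a)) = (fun x => iterD s f (x - a)).
Proof.
have E (h : V -> W) : (fun x => h (x - a)) = h \o aff 1 a.
  by apply/funext => x; rewrite /= /aff scale1r.
move=> sf; elim: s => //= v s ->; rewrite E derive_aff.
  by rewrite scale1r -E.
by move=> x; exact/smooth_diff/smooth_iterD.
Qed.

Lemma iterD_cpoly (W : normedModType R) s (c : index -> W) a :
  iterD s (fun x => cpoly c (x - a)) a =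
  \sum_(al | (deg al <= k)%N) iterD s (mono al : V -> R^o) 0 *: c al.
Proof.
pose c' al : W := if (deg al <= k)%N then c al else 0.
have sm al : smooth (mono al : V -> R^o) := flat_ring_smooth (flat_ring_mono R al).
have ss al : smooth (fun z => mono al z *: c' al) by exact: smooth_scaler.
have cE : cpoly c = \sum_al 1 *: (fun z => mono al z *: c' al).
  apply/funext => z; rewrite fct_sumE /cpoly big_mkcond; apply: eq_bigr => al _.
  by rewrite scale1r /c'; case: ifP => // _; rewrite scaler0.
rewrite iterD_shift cE; last exact: smooth_sum.
rewrite subrr iterD_sum// fct_sumE [RHS]big_mkcond; apply: eq_bigr => al _.
rewrite scale1r (iterD_scaler _ _ (sm al)) /c'; case: ifP => // _.
by rewrite scaler0.
Qed.

Definition mono_diff al : symmulti n k R^o := Dsym k (mono al : V -> R^o) 0.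

Lemma polyfun_mono al : (deg al <= k)%N -> polyfun k (mono al : V -> R^o).
Proof.
move=> ak; exists (fun be => (be == al)%:R) => x.
rewrite (bigD1 al)//= [X in _ + X]big1 => [|be /andP[_ bal]].
  by rewrite eqxx addr0 /GRing.scale /= mulr1.
by rewrite (negbTE bal) scaler0.
Qed.

Lemma symmulti_sum (Z : normedModType R) (I : Type) (s : seq I) (P : pred I)
    (F : I -> symmulti n k Z) v :
  (\sum_(i <- s | P i) F i) v = \sum_(i <- s | P i) F i v.
Proof. exact: (big_morph (fun F : symmulti n k Z => F v)). Qed.

Lemma symmulti_eval_sum (I : Type) (s : seq I) (P : pred I)
    (M : I -> symmulti n k R^o) (c : I -> dual Y) y :
  symmulti_eval y (\sum_(i <- s | P i) tensor (M i) (c i)) =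
  \sum_(i <- s | P i) tensor (M i) (c i y : R^o).
Proof.
apply/val_inj/funext => v; rewrite /= !symmulti_sum.
exact: (big_morph (fun g : dual Y => g y)).
Qed.

Variable T : {linear X -> R^o}.
Hypothesis T_cont : continuous T.

(** For the jet centred at a only the coefficients depend on a, the k-th derivatives of the
    monomials at 0 being fixed tensors. Measurability is thereby reduced to that of the
    coefficients. *)
Lemma ptD_tensor a : pt_differentiable T k a -> exists c : index -> dual Y,
  ptD T k a = \sum_(al | (deg al <= k)%N) tensor (mono_diff al) (c al) /\
  forall be, (deg be <= k)%N ->
    forall y, small (fun r => coef T be a r y - c be y).
Proof.
move=> [P0 jP0]; rewrite /ptD.
set P := xget _ _; have jP : pt_jet T k a P by apply: xgetPex; exists P0.
have [c hc] := polyfun_centred a jP.1.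
exists c; split=> [|be bk y e e0].
  apply/val_inj/funext => v /=.
  rewrite symmulti_sum (DsymE k a jP.1) /derivn.
  have -> : P = fun x => cpoly c (x - a).
    by apply/funext => x; rewrite -hc addrC subrK.
  rewrite iterD_cpoly; apply: eq_bigr => al ak /=.
  by rewrite /mono_diff (DsymE k 0 (polyfun_mono ak)).
have [i hi] := (pt_jet_error T hc).1 jP (dualtest be y) e e0.
exists i => r r0 ri; apply: (le_trans _ (hi r r0 ri)).
rewrite jet_error_dualtest// normrM -[leLHS]mul1r ler_wpM2r//.
rewrite (le_trans _ (ler_norm _))//.
by apply: pow_inv_ge1 => //; exact: radii_lt1 (conj r0 ri).
Qed.

End PointwiseDifferential.

Theorem theoremA (R : realType) (n k : nat) (n_ge1 : (1 <= n)%N)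
    (Y : completeNormedModType R) (Y_sep : separable Y)
    (T : {linear testfun n Y -> R^o}) (T_cont : continuous T) :
  let A : set (borel 'rV[R]_n) := [set a | pt_differentiable T k a] in
  [/\ measurable A,
      forall y : Y, measurable_fun A
        (fun a => symmulti_eval y (ptD T k a) : borel (symmulti n k R^o)) &
      separable (dual Y) ->
        measurable_fun A (ptD T k : borel 'rV[R]_n -> borel (symmulti n k (dual Y)))].
Proof.
move=> A; have [dd dd_dense] := separable_dense_seq Y_sep.
have mA : measurable A := @measurable_pt_differentiable R n k Y dd dd_dense T T_cont.
have /choice[c hc] : forall a, exists c : {ffun 'I_n -> 'I_k.+1} -> dual Y, A a ->
    ptD T k a = \sum_(al | (deg al <= k)%N) tensor (mono_diff R al) (c al) /\
    forall be, (deg be <= k)%N -> forall y, small (fun r => coef T be a r y - c be y).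
  move=> a; have [Aa|nA] := pselect (A a); last by exists (fun=> 0).
  by have [c hc] := ptD_tensor Aa; exists c.
(* The chosen coefficients are meaningful only up to degree k; extension by 0 gives a sum over the
   full finite index type. *)
pose c' al a : dual Y := if (deg al <= k)%N then c a al else 0.
have ptDE a : A a -> ptD T k a = \sum_al tensor (mono_diff R al) (c' al a).
  move=> /hc[-> _]; rewrite big_mkcond; apply: eq_bigr => al _.
  rewrite /c'; case: ifP => // _.
  by apply/val_inj/funext => v /=; rewrite scaler0.
have mc al y q (e : R) : measurable (A `&` [set a | `|c' al a y - q| < e]).
  (* Along the radii 1/(i+2) the coefficient evaluated at y is, on A, a pointwise limit of
     continuous functions of a. *)
  pose u (i : nat) a : R := if (deg al <= k)%N then coef T al a i.+2%:R^-1 y else 0.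
  apply: (@measurable_limit_ball R _ A u (fun a => c' al a y)) => // [i|a Aa t t0].
    rewrite /u; case: (deg al <= k)%N; last exact: cst_continuous.
    by apply: continuous_coef.
  rewrite /u /c'; case: ifP => ak; last by exists 0%N => i _; rewrite subrr normr0 ltW.
  have [i hi] := (hc a Aa).2 al ak y t t0; exists i => j ij.
  rewrite distrC; apply: hi; first by rewrite invr_gt0.
  by rewrite ltf_pV2 ?posrE// ltr_nat !ltnS.
pose C : R := \sum_(al : {ffun 'I_n -> 'I_k.+1}) `|mono_diff R al|.
have MC (al : {ffun 'I_n -> 'I_k.+1}) : `|mono_diff R al| <= C.
  by rewrite /C (bigD1 al)//= lerDl sumr_ge0.
split=> // [y|dY].
  have [q q_dense] : exists q : nat -> R^o, dense_seq q.
    apply: separable_dense_seq; exists (range ratr); last exact: dense_rat.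
    by apply: (@sub_countable _ _ _ [set: rat]); [exact: card_image_le|exact: countableP].
  apply: (@eq_measurable_fun _ _ _ _ A
    (fun a => \sum_al tensor (mono_diff R al) (c' al a y : R^o) : borel (symmulti n k R^o))).
    by move=> a /set_mem Aa; rewrite (ptDE _ Aa) symmulti_eval_sum.
  apply: (@measurable_sum_bounded_additive R _ (borel 'rV[R]_n) A _ R^o q _
    (fun al a => c' al a y) (fun al => tensor (mono_diff R al)) C q_dense mA) => [al x z|al x|al i e].
  - exact: tensorB.
  - by rewrite (le_trans (tensor_norm _ _))// ler_wpM2r.
  - exact: mc.
have [w w_dense] := separable_dense_seq dY.
apply: (@eq_measurable_fun _ _ _ _ A
  (fun a => \sum_al tensor (mono_diff R al) (c' al a) : borel (symmulti n k (dual Y)))).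
  by move=> a /set_mem Aa; rewrite (ptDE _ Aa).
apply: (@measurable_sum_bounded_additive R _ (borel 'rV[R]_n) A _ (dual Y) w _
  c' (fun al => tensor (mono_diff R al)) C w_dense mA) => [al x z|al x|al i e].
- exact: tensorB.
- by rewrite (le_trans (tensor_norm _ _))// ler_wpM2r.
(* Only evaluations at vectors y are known to be measurable so far. The open ball is a countable
   union of closed balls, and a closed ball of the dual is cut out by countably many evaluations at
   the points of [dd]. *)
rewrite (_ : _ `&` _ = \bigcup_p (A `&` [set a | `|c' al a - w i| <= e - p.+1%:R^-1])).
  apply: bigcupT_measurable => p; move: (e - _) => t.
  (* For small p the radius may be negative, and the closed ball is then empty; [dual_norm_dense]
     requires t >= 0. *)
  have [t0|t0] := ltP t 0.
    rewrite (_ : _ `&` _ = set0)//; apply/seteqP; split=> // a [_ /= ct].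
    by move: (le_lt_trans ct t0); rewrite ltNge normr_ge0.
  rewrite (_ : _ `&` _ = A `&` \bigcap_m (A `&`
      [set a | `|c' al a (dd m) - w i (dd m)| <= t * `|dd m|])).
    apply: measurableI => //; apply: bigcapT_measurable => m.
    exact: (@measurable_setI_norm_le R _ (borel 'rV[R]_n) A _ _ (mc al _ _)).
  apply/seteqP; split=> a [Aa].
    move=> /= ct; split=> // m _; split=> //=.
    by rewrite (le_trans (dual_norm_ge (c' al a - w i) (dd m)))// ler_wpM2r.
  move=> H; split=> //=; apply: (dual_norm_dense dd_dense t0) => m.
  by have [] := H m Logic.I.
apply/seteqP; split=> a.
  move=> [Aa /= ce]; have d0 : 0 < e - `|c' al a - w i| by rewrite subr_gt0.
  have [p /(_ p (leqnn p)) hp] := invS_le d0; exists p => //; split=> //=.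
  by rewrite lerBrDl -lerBrDr.
move=> [p _ [Aa /= ce]]; split=> //=; rewrite (le_lt_trans ce)//.
by rewrite ltrBlDr ltrDl invr_gt0.
Qed.
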